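(* Let $2\le k<l$ be integers. The Lie algebra $\mathfrak g^{I}_{k,l}$ of symmetries of first kind and the Lie algebra $\mathfrak g^{II}_{k,l}$ of symmetries of second kind of the system $y^{(k)}(x)=0$, $z^{(l)}(x)=0$ coincide (up to natural isomorphism of Lie algebras) with the Tanaka prolongations of the pairs $(\mathfrak n^{I}_{k,l},\operatorname{Stab}(E))$ and $(\mathfrak n^{II}_{k,l},\operatorname{Stab}(E))$ respectively, where $E=\langle X\rangle$.
   Context: Symmetry algebras. Let $\mathcal E=\mathbb R^{k+l+1}$ with coordinates $(x,y_0,\dots,y_{k-1},z_0,\dots,z_{l-1})$, and $$X=\frac{\partial}{\partial x}+\sum_{i=0}^{k-2}y_{i+1}\frac{\partial}{\partial y_i}+\sum_{j=0}^{l-2}z_{j+1}\frac{\partial}{\partial z_j},$$ $F_1=\langle\frac{\partial}{\partial y_i}\,(1\le i\le k-1),\frac{\partial}{\partial z_j}\,(1\le j\le l-1)\rangle$, $D=\langle X,\frac{\partial}{\partial y_{k-1}},\frac{\partial}{\partial z_{l-1}}\rangle$. $\mathfrak g^{I}_{k,l}$ (symmetries of first kind) is the Lie algebra of vector fields $S$ on $\mathcal E$ preserving the distributions $\langle X\rangle$ and $F_1$; $\mathfrak g^{II}_{k,l}$ (symmetries of second kind) is the Lie algebra of vector fields on $\mathcal E$ preserving $\langle X\rangle$ and $D$. (A vector field $S$ preserves a distribution $P$ if $[S,P]\subset P$.) The nilpotent Lie algebra. $\mathfrak n$ is the Lie algebra with basis $X$, $Y_i=\frac{\partial}{\partial y_i}$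 $(0\le i\le k-1)$, $Z_j=\frac{\partial}{\partial z_j}$ $(0\le j\le l-1)$, whose only nonzero brackets are $[Y_i,X]=Y_{i-1}$, $[Z_j,X]=Z_{j-1}$ for $i,j\ge1$. $\mathfrak n^{I}_{k,l}$ is $\mathfrak n$ with the grading $\deg X=-1$, $\deg Y_i=i-l$, $\deg Z_j=j-l$; $\mathfrak n^{II}_{k,l}$ is $\mathfrak n$ with the grading $\deg X=-1$, $\deg Y_i=i-k$, $\deg Z_j=j-l$. (Note $\mathfrak n^{I}_{k,l}$ is not generated by its degree $-1$ part.) Tanaka prolongation. For a negatively graded nilpotent Lie algebra $\mathfrak m=\bigoplus_{i<0}\mathfrak m_i$ (not necessarily generated by $\mathfrak m_{-1}$) let $\operatorname{Der}_0(\mathfrak m)$ be the Lie algebra of degree-preserving derivations of $\mathfrak m$. For a graded subspace $E\subset\mathfrak m$, $\operatorname{Stab}(E)=\{\varphi\in\operatorname{Der}_0(\mathfrak m):\varphi(E)\subset E\}$. For a subalgebra $\mathfrak g_0\subset\operatorname{Der}_0(\mathfrak m)$, the (universal Tanaka) prolongation of the pair $(\mathfrak m,\mathfrak g_0)$ is the largest graded Lie algebra $\mathfrak g(\mathfrak m,\mathfrak g_0)=\bigoplus_{i}\mathfrak g_i(\mathfrak m,\mathfrak g_0)$ such that (1) $\mathfrak g_i(\mathfrak m,\mathfrak g_0)=\mathfrak m_i$ for $i<0$ and $\mathfrak g_0(\mathfrak m,\mathfrak g_0)=\mathfrak g_0$; (2) for $A\in\mathfrak g_i(\mathfrak m,\mathfrak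 g_0)$ with $i\ge0$, $[A,\mathfrak m]=0$ implies $A=0$. *)

(* Defs.v *)
(* MathComp / MathComp-Analysis development over an abstract R : realType. *)
From mathcomp Require Import all_boot all_order all_algebra.
From mathcomp Require Import all_classical all_reals all_analysis.

Set Implicit Arguments.
Unset Strict Implicit.
Unset Printing Implicit Defensive.

Import Order.TTheory GRing.Theory Num.Theory.
Import numFieldNormedType.Exports.

Local Open Scope classical_set_scope.
Local Open Scope ring_scope.

Record gradedLie (F : fieldType) := GradedLie {
  gcarrier :> lmodType F;
  brk : gcarrier -> gcarrier -> gcarrier;
  homog : int -> set gcarrier;
  brk_linearl : forall a u v w, brk (a *: u + v) w = a *: brk u w + brk v w;
  brk_linearr : forall a u v w, brk w (a *: u + v) = a *: brk w u + brk w v;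
  brk_alt : forall u, brk u u = 0;
  brk_jacobi : forall u v w,
    brk u (brk v w) + brk v (brk w u) + brk w (brk u v) = 0;
  homog0 : forall d, homog d 0;
  homog_lin : forall d a u v, homog d u -> homog d v -> homog d (a *: u + v);
  homog_span : forall u, exists (s : seq int) (f : int -> gcarrier),
    (forall d, homog d (f d)) /\ u = \sum_(d <- s) f d;
  homog_direct : forall (s : seq int) (f : int -> gcarrier), uniq s ->
    (forall d, homog d (f d)) -> \sum_(d <- s) f d = 0 ->
    forall d, d \in s -> f d = 0;
  homog_brk : forall d e u v, homog d u -> homog e v -> homog (d + e) (brk u v)
}.

Section Tanaka.
Context {F : fieldType}.
Implicit Types m g h : gradedLie F.

Definition Der0 m : set {linear m -> m} :=
  [set phi | (forall u v, phi (brk u v) = brk (phi u) v + brk u (phi v)) /\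
             (forall d u, homog d u -> homog d (phi u))].

Definition Stab m (E : set m) : set {linear m -> m} :=
  [set phi | Der0 phi /\ forall v, E v -> E (phi v)].

(* g is a graded Lie algebra satisfying the conditions (1) and (2) on a
   prolongation of (m, g0), for m negatively graded.  The equality of the
   negative part of g with m is witnessed by iota; the degree-zero part of g is
   identified with g0 through its adjoint action on m, i.e. [phi, v] = phi v.
   By [prolongs_faithful] this identification is one-to-one, and by the Jacobi
   identity it is compatible with the brackets. *)
Record prolongs m (g0 : set {linear m -> m}) g (iota : {linear m -> g}) : Prop :=
  Prolongs {
    prolongs_inj : injective iota;
    prolongs_brk : forall u v, iota (brk u v) = brk (iota u) (iota v);
    prolongs_neg : forall d : int, d < 0 -> iota @` @homog _ m d = @homog _ g d;
    prolongs_deg0 : forall A, @homog _ g 0 A ->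
      exists2 phi, g0 phi & forall v, brk A (iota v) = iota (phi v);
    prolongs_g0 : forall phi, g0 phi ->
      exists2 A, @homog _ g 0 A & forall v, brk A (iota v) = iota (phi v);
    prolongs_faithful : forall (d : int) A, 0 <= d -> @homog _ g d A ->
      (forall v, brk A (iota v) = 0) -> A = 0
  }.

(* "Largest" is inclusion up to the identifications carried by iota: every h
   satisfying (1) and (2) embeds into g as a graded Lie algebra over m.  By
   [prolongs_faithful] such an embedding is also the identity on g0. *)
Definition tanaka_prolongation m (g0 : set {linear m -> m}) g
    (iota : {linear m -> g}) : Prop :=
  prolongs g0 iota /\
  forall h (iota' : {linear m -> h}), prolongs g0 iota' ->
    exists f : {linear h -> g},
      [/\ injective f,
          forall A B, f (brk A B) = brk (f A) (f B),
          forall d A, homog d A -> homog d (f A) &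
          forall v, f (iota' v) = iota v].

End Tanaka.

Section Coordinates.
Variables (R : realType) (k l : nat).

(* The column indices of a vector of R^(k+l+1) carry x, y_0, ..., y_(k-1),
   z_0, ..., z_(l-1) in this order.  iy i and iz j are only meaningful for
   i < k and j < l. *)
Definition ix : 'I_(k + l).+1 := ord0.
Definition iy (i : nat) : 'I_(k + l).+1 := inord i.+1.
Definition iz (j : nat) : 'I_(k + l).+1 := inord (k + j).+1.

Definition eX : 'rV[R]_(k + l).+1 := delta_mx 0 ix.
Definition eY (i : nat) : 'rV[R]_(k + l).+1 := delta_mx 0 (iy i).
Definition eZ (j : nat) : 'rV[R]_(k + l).+1 := delta_mx 0 (iz j).

Definition down (u : 'rV[R]_(k + l).+1) : 'rV[R]_(k + l).+1 :=
  \sum_(i < k.-1) u 0 (iy i.+1) *: eY i + \sum_(j < l.-1) u 0 (iz j.+1) *: eZ j.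

End Coordinates.

Section NilpotentAlgebra.
Variables (R : realType) (k l : nat).
Local Notation V := 'rV[R]_(k + l).+1.

(* The basis X, Y_i, Z_j of n is eX, eY i, eZ j, and down is ad(-X):
   down X = 0, down Y_i = Y_(i-1), down Z_j = Z_(j-1), down Y_0 = down Z_0 = 0. *)
Definition nil_brk (u v : V) : V :=
  v 0 (ix k l) *: down u - u 0 (ix k l) *: down v.

(* deg X = -1, deg Y_i = i - s, deg Z_j = j - l *)
Definition nil_deg (s : nat) (c : 'I_(k + l).+1) : int :=
  if c == 0%N :> nat then -1
  else if (c <= k)%N then c.-1%:Z - s%:Z
  else (c - k.+1)%N%:Z - l%:Z.

Definition nil_homog (s : nat) (d : int) : set V :=
  [set u | forall c, nil_deg s c != d -> u 0 c = 0].

Lemma down_lin a (u v : V) : down (a *: u + v) = a *: down u + down v.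
Proof.
rewrite /down scalerDr !scaler_sumr addrACA -!big_split /=.
by congr (_ + _); apply: eq_bigr => i _; rewrite !mxE scalerDl scalerA.
Qed.

Lemma downZ a (u : V) : down (a *: u) = a *: down u.
Proof.
have down0 : down (0 : V) = 0.
  by rewrite /down !big1 ?addr0 // => i _; rewrite mxE scale0r.
by have := down_lin a u 0; rewrite !addr0 down0 addr0.
Qed.

Lemma downB (u v : V) : down (u - v) = down u - down v.
Proof. by have := down_lin (-1) v u; rewrite !scaleN1r ![- _ + _]addrC. Qed.

Lemma down_ix (u : V) : down u 0 (ix k l) = 0.
Proof.
have h0 i : (i <= k + l)%N -> i != 0%N -> ix k l == inord i = false.
  by move=> hi /negbTE i0; apply/negbTE; rewrite -val_eqE /= inordK // eq_sym i0.
rewrite mxE !summxE !big1 ?addr0 // => j _; rewrite !mxE /= h0 ?mulr0 //.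
  by rewrite -addnS leq_add2l (leq_trans (ltn_ord j)) // leq_pred.
by rewrite (leq_trans (leq_trans (ltn_ord j) (leq_pred k))) // leq_addr.
Qed.

Lemma nil_brkE (u v : V) c : nil_brk u v 0 c =
  v 0 (ix k l) * down u 0 c - u 0 (ix k l) * down v 0 c.
Proof. by rewrite /nil_brk; move: (down u) (down v) => du dv; rewrite !mxE. Qed.

Lemma nil_brk_linearl a (u v w : V) :
  nil_brk (a *: u + v) w = a *: nil_brk u w + nil_brk v w.
Proof.
rewrite /nil_brk down_lin; move: (down u) (down v) (down w) => du dv dw.
rewrite !mxE scalerDr scalerDl scalerBr !scalerA.
by rewrite [w 0 _ * a]mulrC opprD addrACA.
Qed.

Lemma nil_brkC (u v : V) : nil_brk u v = - nil_brk v u.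
Proof. by rewrite /nil_brk opprB. Qed.

Lemma nil_brk_linearr a (u v w : V) :
  nil_brk w (a *: u + v) = a *: nil_brk w u + nil_brk w v.
Proof.
by rewrite nil_brkC nil_brk_linearl opprD -scalerN -!nil_brkC.
Qed.

Lemma nil_brk_alt (u : V) : nil_brk u u = 0.
Proof. by rewrite /nil_brk subrr. Qed.

Lemma nil_brk_jacobi (u v w : V) :
  nil_brk u (nil_brk v w) + nil_brk v (nil_brk w u) + nil_brk w (nil_brk u v) = 0.
Proof.
have ix0 (a b : V) : nil_brk a b 0 (ix k l) = 0.
  by rewrite nil_brkE !down_ix !mulr0 subr0.
rewrite {1 3 5}/nil_brk !ix0 !scale0r !sub0r /nil_brk !downB !downZ.
rewrite !scalerBr !scalerA !opprB.
rewrite [w _ _ * u _ _]mulrC [v _ _ * u _ _]mulrC [w _ _ * v _ _]mulrC.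
by rewrite [X in X + _]addrC !addrA !subrK subrr.
Qed.

Lemma nil_homog0 s d : nil_homog s d 0.
Proof. by move=> c _; rewrite mxE. Qed.

Lemma nil_homog_lin s d a (u v : V) :
  nil_homog s d u -> nil_homog s d v -> nil_homog s d (a *: u + v).
Proof. by move=> hu hv c hc; rewrite !mxE hu // hv // mulr0 addr0. Qed.

Lemma nil_homog_span s (u : V) : exists (t : seq int) (f : int -> V),
  (forall d, nil_homog s d (f d)) /\ u = \sum_(d <- t) f d.
Proof.
exists (undup [seq nil_deg s c | c <- enum 'I_(k + l).+1]).
exists (fun d => \row_c (if nil_deg s c == d then u 0 c else 0)); split.
  by move=> d c /negbTE hc; rewrite mxE hc.
apply/rowP => c; rewrite summxE (bigD1_seq (nil_deg s c)) ?undup_uniq //=.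
  rewrite mxE eqxx big1 ?addr0 // => d /negbTE hd.
  by rewrite mxE eq_sym hd.
by rewrite mem_undup map_f // mem_enum.
Qed.

Lemma nil_homog_direct s (t : seq int) (f : int -> V) : uniq t ->
  (forall d, nil_homog s d (f d)) -> \sum_(d <- t) f d = 0 ->
  forall d, d \in t -> f d = 0.
Proof.
move=> ut hf hs d dt; apply/rowP => c; rewrite [RHS]mxE.
have [hc|hc] := eqVneq (nil_deg s c) d; last exact: hf.
have /(congr1 (fun M : V => M 0 c)) := hs.
rewrite summxE [RHS]mxE (bigD1_seq d) //= big1 ?addr0 // => e ed.
by apply: hf; rewrite hc eq_sym.
Qed.

Lemma down_homog s d (u : V) : nil_homog s d u -> nil_homog s (d - 1) (down u).
Proof.
move=> hu c hc; rewrite mxE !summxE !big1 ?addr0 // => j _; rewrite !mxE /=;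
  (case: eqP => [ec|]; last by rewrite mulr0);
  rewrite hu ?mul0r //; apply: contra hc => /eqP <-; rewrite ec; apply/eqP.
  have hj : (j.+1 < l)%N by have := ltn_ord j; case: (l) j {ec} => [[]|].
  have hj1 : (k + j < k + l)%N by rewrite ltn_add2l ltnW.
  have hj2 : (k + j.+1 < k + l)%N by rewrite ltn_add2l.
  rewrite /nil_deg /iz !inordK ?ltnS //=.
  rewrite !ltnNge !leq_addr /= !subSS ![(k + _)%N]addnC !addnK.
  by rewrite -[in RHS]addn1 PoszD addrAC addrK.
have hj : (j.+1 < k)%N by have := ltn_ord j; case: (k) j {ec} => [[]|].
have hj2 : (j.+1 < k + l)%N by exact: leq_trans hj (leq_addr _ _).
have hj1 : (j < k + l)%N by exact: ltnW.
rewrite /nil_deg /iy !inordK ?ltnS //= hj (ltnW hj).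
by rewrite -[in RHS]addn1 PoszD addrAC addrK.
Qed.

Lemma nil_homog_brk s d e (u v : V) :
  nil_homog s d u -> nil_homog s e v -> nil_homog s (d + e) (nil_brk u v).
Proof.
move=> hu hv c hc; rewrite nil_brkE.
have aux (a b : V) f g : nil_homog s f a -> nil_homog s g b ->
    nil_deg s c != f + g -> b 0 (ix k l) * down a 0 c = 0.
  move=> ha hb hfg; have [hg|hg] := eqVneq g (-1).
    by rewrite (down_homog ha) ?mulr0 // -hg.
  by rewrite hb ?mul0r // /nil_deg /= eq_sym.
have hc' : nil_deg s c != e + d by rewrite addrC.
by rewrite (aux u v d e hu hv hc) (aux v u e d hv hu hc') subr0.
Qed.

Definition nilLie (s : nat) : gradedLie R :=
  GradedLie nil_brk_linearl nil_brk_linearr nil_brk_alt nil_brk_jacobi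
    (@nil_homog0 s) (@nil_homog_lin s) (@nil_homog_span s)
    (@nil_homog_direct s) (@nil_homog_brk s).

Definition nilI : gradedLie R := nilLie l.
Definition nilII : gradedLie R := nilLie k.

Definition lineX (s : nat) : set (nilLie s) :=
  [set v | exists a : R, v = a *: eX R k l].

End NilpotentAlgebra.

Arguments lineX : clear implicits.

Section VectorFields.
Variables (R : realType) (n : nat).
Local Notation V := 'rV[R]_n.

Fixpoint Ck (m : nat) (f : V -> R) : Prop :=
  continuous f /\
  if m is m'.+1 then
    forall c : 'I_n, (forall p, derivable f p (delta_mx 0 c)) /\
                     Ck m' (fun p => 'D_(delta_mx 0 c) f p)
  else True.

Definition smooth (S : V -> V) : Prop := forall m c, Ck m (fun p => S p 0 c).

(* Sign convention: vbrk S T is S T - T S as a derivation of functions. *)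
Definition vbrk (S T : V -> V) : V -> V :=
  fun p => 'D_(S p) T p - 'D_(T p) S p.

Definition tangent_distribution := V -> {vspace V}.

Definition vsection (P : tangent_distribution) (T : V -> V) : Prop :=
  smooth T /\ forall p, T p \in P p.

Definition preserves (S : V -> V) (P : tangent_distribution) : Prop :=
  forall T, vsection P T -> forall p, vbrk S T p \in P p.

End VectorFields.

Section SymmetryAlgebras.
Variables (R : realType) (k l : nat).
Local Notation V := 'rV[R]_(k + l).+1.

Definition fieldX (p : V) : V := eX R k l + down p.

Definition distX : tangent_distribution R (k + l).+1 := fun p => <[fieldX p]>%VS.

Definition distF1 : tangent_distribution R (k + l).+1 := fun _ =>
  (\sum_(1 <= i < k) <[eY R k l i]> + \sum_(1 <= j < l) <[eZ R k l j]>)%VS.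

Definition distD : tangent_distribution R (k + l).+1 := fun p =>
  (<[fieldX p]> + <[eY R k l k.-1]> + <[eZ R k l l.-1]>)%VS.

Definition symI : set (V -> V) :=
  [set S | [/\ smooth S, preserves S distX & preserves S distF1]].

Definition symII : set (V -> V) :=
  [set S | [/\ smooth S, preserves S distX & preserves S distD]].

Definition lie_iso (g : gradedLie R) (G : set (V -> V))
    (psi : {linear g -> (V -> V)}) : Prop :=
  [/\ injective psi, range psi = G &
      forall A B, psi (brk A B) = vbrk (psi A) (psi B)].

(* Naturality of an isomorphism psi from the prolongation to an algebra of
   symmetries: n has the tangent space at the origin as underlying vector space
   (X, Y_i, Z_j being the values there of the fields of the same name), and psi
   is compatible with evaluation at the origin on n and on the nonnegative
   part.  The sign comes from the bracket: psi maps n onto the fields that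
   commute with the fields X, d/dy_i, d/dz_j, and on those S |-> S(0) reverses
   brackets. *)
Definition natural_at_origin (s : nat) (g : gradedLie R)
    (iota : {linear nilLie R k l s -> g}) (psi : {linear g -> (V -> V)}) : Prop :=
  (forall v : V, psi (iota v) 0 = - v) /\
  (forall (d : int) A, 0 <= d -> @homog _ g d A -> psi A 0 = 0).

End SymmetryAlgebras.

Arguments symI : clear implicits.
Arguments symII : clear implicits.

(* Main.v *)
Require Import Defs.
From HB Require Import structures.
From mathcomp Require Import all_boot all_order all_algebra.
From mathcomp Require Import all_classical all_reals all_analysis.
From mathcomp Require Import ring lra zify.

Set Implicit Arguments.
Unset Strict Implicit.
Unset Printing Implicit Defensive.

Import Order.TTheory GRing.Theory Num.Theory.
Import numFieldNormedType.Exports.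

Local Open Scope classical_set_scope.
Local Open Scope ring_scope.

(* The group of the nilpotent algebra n acts simply transitively on R^(k+l+1); X
   and the d/dy_i, d/dz_j form an invariant frame, and the fields commuting with
   them form a copy of n.  In the components t_c of a field with respect to this
   frame, preserving <X> and F_1 (or D) amounts to preserving <X> and the whole
   weight filtration, a first-order linear system.  Its smooth solutions are
   polynomial, because X and the vertical derivatives act on them locally
   nilpotently; hence the Euler field splits every symmetry into homogeneous
   parts, and the symmetries form a graded Lie algebra.  Negative degrees give n,
   degree 0 gives Stab(E).  For the maximality, let h satisfy the same axioms.  An
   element A of positive degree is determined by the brackets [A, v], v in n,
   which by induction on the degree are already symmetries; they form a closed
   1-form on the group, and the weighted Poincare lemma provides a field whose
   brackets with n they are.  This field is again a symmetry, as the obstruction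
   is a constant of nonzero weight. *)

(** * Eigenvectors with integer eigenvalues *)

(** The grading of the first kind is not generated in degree -1, so nothing reduces to brackets with
    degree -1: the closed form lives on all of n, and its closedness involves the full bracket of n.
    Both gradings belong to one family, in which y_i has weight s - i. Frame, prolongation and
    maximality are uniform in s; the two kinds differ only in how preserving F_1 (s = l) or D (s =
    k) yields the whole filtration. Degree 0 is where E matters. The obstruction [V_a, t]_c, for a
    pair (a, c) that the filtration or <X> forbids, has weight deg t - w_a + w_c. This is positive
    if deg t > 0. In degree 0 it can be a nonzero constant only for V_a = X and w_c = 1, and that
    constant is the part of the image of X outside <X>, which Stab(E) excludes. An abstract
    competitor h offers no recursion on its elements, so its embedding into the fields is built as a
    relation, which is then shown to be functional. *)

Section Eigen.
Variables (R : realType) (U : lmodType R) (T : {linear U -> U}).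

Definition eigen (d : int) (u : U) := T u = d%:~R *: u.

Lemma eigen_lin d x u v : eigen d u -> eigen d v -> eigen d (x *: u + v).
Proof. by rewrite /eigen linearP => -> ->; rewrite scalerDr !scalerA mulrC. Qed.

Lemma eigen0 d : eigen d 0.
Proof. by rewrite /eigen linear0 scaler0. Qed.

(** The operator T - d0 kills [f d0] and multiplies each other [f e] by the nonzero scalar e - d0,
    so the induction hypothesis applies to the remaining components and the scalars can be divided
    out. P will be the set of symmetries, or {0}, which gives the independence of eigenvectors. *)
Lemma eigen_sub (P : set U) (s : seq int) (f : int -> U) :
  P 0 -> (forall x u v, P u -> P v -> P (x *: u + v)) ->
  (forall u, P u -> P (T u)) -> uniq s -> (forall d, eigen d (f d)) ->
  P (\sum_(d <- s) f d) -> forall d, d \in s -> P (f d).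
Proof.
move=> P0 Plin PT; elim: s f => [//|d0 s IH] f /= /andP[d0s us] ef.
have Tf d : T (f d) = d%:~R *: f d := ef d.
rewrite big_cons => Ps.
have Ps' d : d \in s -> P (f d).
  move=> ds; have dd0 : (d - d0)%:~R != 0 :> R.
    by rewrite intr_eq0 subr_eq0; apply: contraNneq d0s => <-.
  pose g e := (e - d0)%:~R *: f e.
  have eg e : eigen e (g e) by rewrite /eigen /g linearZ /= Tf !scalerA mulrC.
  have /(IH g us eg) /(_ d ds) : P (\sum_(e <- s) g e).
    have := Plin (- d0%:~R) _ _ Ps (PT _ Ps).
    congr P; rewrite (raddfD T) (raddf_sum T) /= Tf scalerDr scaleNr addrACA addNr add0r.
    rewrite scaler_sumr -big_split /=; apply: eq_bigr => e _.
    by rewrite Tf /g rmorphB /= scalerBl addrC scaleNr.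
  move=> /(Plin (d - d0)%:~R^-1 _ 0) /(_ P0).
  by rewrite addr0 /g scalerA mulVf // scale1r.
move=> d; rewrite inE => /predU1P[->|]; last exact: Ps'.
have -> : f d0 = (-1) *: (\sum_(d <- s) f d) + (f d0 + \sum_(d <- s) f d).
  by rewrite scaleN1r addrCA addNr addr0.
apply: (Plin) => //.
have : forall s', {subset s' <= s} -> P (\sum_(d <- s') f d).
  elim=> [|e s' IH' ss]; first by rewrite big_nil.
  rewrite big_cons -[f e]scale1r; apply: (Plin); first by apply: (Ps'); rewrite ss ?mem_head.
  by apply: IH' => e' es'; rewrite ss // inE es' orbT.
exact.
Qed.

Lemma eigen_direct (s : seq int) (f : int -> U) : uniq s ->
  (forall d, eigen d (f d)) -> \sum_(d <- s) f d = 0 ->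
  forall d, d \in s -> f d = 0.
Proof.
move=> us ef s0; apply: (@eigen_sub (fun u => u = 0)) => //.
- by move=> x u v -> ->; rewrite scaler0 addr0.
- by move=> u ->; rewrite linear0.
Qed.

Definition eigensum (t : seq (int * U)) (u : U) :=
  (forall x, x \in t -> eigen x.1 x.2) /\ u = \sum_(x <- t) x.2.

Lemma eigensum_group t u : eigensum t u -> exists f : int -> U,
  [/\ forall d, eigen d (f d), u = \sum_(d <- undup [seq x.1 | x <- t]) f d &
      forall d, d \notin [seq x.1 | x <- t] -> f d = 0].
Proof.
move=> [et ->]; exists (fun d => \sum_(x <- t | x.1 == d) x.2); split.
- move=> d; rewrite big_seq_cond; elim/big_rec: _ => [|x v]; first exact: eigen0.
  by case/andP=> xt /eqP <- ev; rewrite -[x.2]scale1r; apply: eigen_lin => //; apply: et.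
- rewrite [RHS](_ : _ = \sum_(d <- undup [seq x.1 | x <- t])
      \sum_(x <- t) if x.1 == d then x.2 else 0); last first.
    by apply: eq_bigr => d _; rewrite big_mkcond.
  rewrite exchange_big /= big_seq [RHS]big_seq; apply: eq_bigr => x xt.
  rewrite (bigD1_seq x.1) ?undup_uniq ?mem_undup ?map_f //= eqxx big1 ?addr0 //.
  by move=> d /negbTE dx; rewrite eq_sym dx.
- move=> d dt; rewrite big_seq_cond big1 // => x /andP[xt /eqP xd].
  by rewrite -xd map_f in dt.
Qed.

End Eigen.

(** * Vector fields in the invariant frame *)

(* The properties of the algebra of smooth functions on R^n on which the
   algebraic part relies; [ev0] is evaluation at the origin. *)
Record calculus (R : realType) (n : nat) := Calculus {
  calg :> comAlgType R;
  pd : 'I_n -> {linear calg -> calg};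
  coordf : 'I_n -> calg;
  ev0 : {linear calg -> R^o};
  pdM : forall c f g, pd c (f * g) = pd c f * g + f * pd c g;
  pdC : forall a c f, pd a (pd c f) = pd c (pd a f);
  pd_coord : forall a c, pd a (coordf c) = (a == c)%:R;
  ev0M : forall f g, ev0 (f * g) = ev0 f * ev0 g;
  ev0_1 : ev0 1 = 1;
  ev0_coord : forall c, ev0 (coordf c) = 0;
  pd_const : forall f, (forall c, pd c f = 0) -> f = (ev0 f)%:A
}.

(* The weights are the opposites of the degrees of the basis vectors; [shift_mx]
   is the matrix of ad(-X), which lowers the degree by one. *)
Record grading (R : realType) (n : nat) := Grading {
  shift_mx : 'M[R]_n.+1;
  weight : 'I_n.+1 -> nat;
  shift0r : forall c, shift_mx ord0 c = 0;
  shiftr0 : forall a, shift_mx a ord0 = 0;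
  weight_shift : forall a c, shift_mx a c != 0 -> weight c = (weight a).+1;
  weight_gt0 : forall c, (0 < weight c)%N;
  weight0 : weight ord0 = 1%N
}.

Section Frame.
Variables (R : realType) (n : nat) (A : calculus R n.+1) (W : grading R n).
Local Notation M := (shift_mx W).
Local Notation w := (weight W).
Local Notation q := (@coordf R n.+1 A).
Local Notation D := (@pd R n.+1 A).
Local Notation field := ('I_n.+1 -> A).
Implicit Types (f g : A) (t u s : field) (a b c : 'I_n.+1).

(* A [field] t stands for \sum_a t_a V_a, where V_0 = X and V_a is the partial
   derivative for a != 0; [twist] is X minus the x-derivative, and [nb] collects
   the contribution of the brackets [V_a, V_0] to [br]. *)
Definition mulM (t : field) : field := fun c => \sum_a M a c *: t a.

Definition twist (f : A) : A := \sum_c mulM q c * D c f.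

Definition frame a (f : A) : A := D a f + (a == ord0)%:R * twist f.

Definition lie (t : field) (f : A) : A := \sum_a t a * frame a f.

Lemma pd1 c : D c 1 = 0.
Proof.
have := pdM c (1 : A) 1; rewrite !mulr1 mul1r.
by move/(congr1 (fun z => z - D c 1)); rewrite addrK subrr => ->.
Qed.

Lemma pd_cst c (x : R) : D c (x%:A) = 0.
Proof. by rewrite linearZ /= pd1 scaler0. Qed.

Lemma twist_linear (x : R) f g : twist (x *: f + g) = x *: twist f + twist g.
Proof.
rewrite /twist scaler_sumr -big_split; apply: eq_bigr => c _ /=.
by rewrite linearP mulrDr scalerAr.
Qed.

Lemma twistM f g : twist (f * g) = twist f * g + f * twist g.
Proof.
rewrite /twist mulr_suml mulr_sumr -big_split; apply: eq_bigr => c _ /=.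
by rewrite pdM; ring.
Qed.

Lemma frame_linear a (x : R) f g : frame a (x *: f + g) = x *: frame a f + frame a g.
Proof.
rewrite /frame linearP twist_linear mulrDr -scalerAr scalerDr.
by rewrite addrACA.
Qed.
HB.instance Definition _ a := GRing.isLinear.Build R A A *:%R (frame a)
  (fun x f g => frame_linear a x f g).

Lemma frameM a f g : frame a (f * g) = frame a f * g + f * frame a g.
Proof. by rewrite /frame pdM twistM; ring. Qed.

Lemma lie_linear t (x : R) f g : lie t (x *: f + g) = x *: lie t f + lie t g.
Proof.
rewrite /lie scaler_sumr -big_split; apply: eq_bigr => c _ /=.
by rewrite linearP mulrDr scalerAr.
Qed.
HB.instance Definition _ t := GRing.isLinear.Build R A A *:%R (lie t)
  (fun x f g => lie_linear t x f g).

Lemma lieM t f g : lie t (f * g) = lie t f * g + f * lie t g.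
Proof.
rewrite /lie mulr_suml mulr_sumr -big_split; apply: eq_bigr => c _ /=.
by rewrite frameM; ring.
Qed.

Lemma lieDl (x : R) t u f : lie (x *: t + u) f = x *: lie t f + lie u f.
Proof.
rewrite /lie scaler_sumr -big_split; apply: eq_bigr => c _ /=.
by rewrite mulrDl scalerAl.
Qed.

Lemma frame0E f : frame ord0 f = D ord0 f + twist f.
Proof. by rewrite /frame eqxx mul1r. Qed.

Lemma frameE a f : a != ord0 -> frame a f = D a f.
Proof. by move=> /negbTE a0; rewrite /frame a0 mul0r addr0. Qed.

Lemma pd_mulM a c : D a (mulM q c) = (M a c)%:A.
Proof.
rewrite /mulM linear_sum (bigD1 a) //= linearZ /= pd_coord eqxx big1 ?addr0 //.
by move=> b /negbTE ba; rewrite linearZ /= pd_coord eq_sym ba scaler0.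
Qed.

Lemma sumMframe a f : \sum_c M a c *: frame c f = \sum_c M a c *: D c f.
Proof.
apply: eq_bigr => c _; have [->|c0] := eqVneq c ord0; first by rewrite shiftr0 !scale0r.
by rewrite frameE.
Qed.

Lemma pd_twist a f : D a (twist f) = twist (D a f) + \sum_c M a c *: frame c f.
Proof.
rewrite sumMframe /twist linear_sum -big_split /=; apply: eq_bigr => c _.
by rewrite pdM pd_mulM pdC mulr_algl addrC.
Qed.

(** The coefficients of [twist] are linear in the coordinates, so a partial derivative passes
    through it at the price of a field with constant coefficients: the frame is closed under
    brackets, with structure constants from M. *)
Lemma frame_comm a b f : frame a (frame b f) - frame b (frame a f) =
  (b == ord0)%:R * (\sum_c M a c *: frame c f)
   - (a == ord0)%:R * (\sum_c M b c *: frame c f).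
Proof.
have z : \sum_c M ord0 c *: frame c f = 0.
  by rewrite big1 // => c _; rewrite shift0r scale0r.
have [->|a0] := eqVneq a ord0; have [->|b0] := eqVneq b ord0; rewrite ?eqxx.
- by rewrite !subrr.
- rewrite mul0r mul1r sub0r !(frameE _ b0) !frame0E.
  rewrite linearD /= pd_twist (pdC ord0 b); ring.
- rewrite mul0r mul1r subr0 !(frameE _ a0) !frame0E.
  rewrite linearD /= pd_twist (pdC ord0 a); ring.
by rewrite !mul0r !frameE // pdC !subrr.
Qed.

Definition nb t s : field := fun c => s ord0 * mulM t c - t ord0 * mulM s c.
(** Locked so that nested brackets are not unfolded by simplification; [brE] opens it. *)
Definition br t s : field :=
  locked (fun c => lie t (s c) - lie s (t c) + nb t s c).

Lemma brE t s c : br t s c = lie t (s c) - lie s (t c) + nb t s c.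
Proof. by rewrite /br -lock. Qed.

Lemma sum_mulM_frame t f : \sum_c mulM t c * frame c f =
  \sum_a t a * \sum_c M a c *: frame c f.
Proof.
under eq_bigr => c _ do rewrite /mulM mulr_suml.
rewrite exchange_big /=; apply: eq_bigr => a _; rewrite mulr_sumr.
by apply: eq_bigr => c _; rewrite -scalerAl scalerAr.
Qed.

Lemma lie_br t s f : lie (br t s) f = lie t (lie s f) - lie s (lie t f).
Proof.
have lieS (x y : field) : lie x (lie y f) =
    \sum_b lie x (y b) * frame b f + \sum_b \sum_a x a * y b * frame a (frame b f).
  rewrite {2}/lie linear_sum /= -big_split /=; apply: eq_bigr => b _.
  rewrite lieM; congr (_ + _); rewrite /lie mulr_sumr; apply: eq_bigr => a _; ring.
have -> : lie (br t s) f = \sum_c lie t (s c) * frame c f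
    - \sum_c lie s (t c) * frame c f + \sum_c nb t s c * frame c f.
  rewrite -sumrB -big_split /=; apply: eq_bigr => c _; rewrite brE; ring.
rewrite !lieS [X in _ = _ - (_ + X)]exchange_big /=.
rewrite opprD addrACA; congr (_ + _); rewrite -sumrB.
transitivity (\sum_b \sum_a t a * s b *
    ((b == ord0)%:R * (\sum_c M a c *: frame c f)
   - (a == ord0)%:R * (\sum_c M b c *: frame c f))).
  have -> : \sum_c nb t s c * frame c f = s ord0 * (\sum_c mulM t c * frame c f)
     - t ord0 * (\sum_c mulM s c * frame c f).
    rewrite !mulr_sumr -sumrB; apply: eq_bigr => c _; rewrite /nb; ring.
  rewrite !sum_mulM_frame.
  under [RHS]eq_bigr => b _ do under eq_bigr => a _ do rewrite mulrBr.
  under [RHS]eq_bigr => b _ do rewrite sumrB.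
  rewrite sumrB; congr (_ - _).
    rewrite [RHS](bigD1 ord0) //= [X in _ + X]big1 ?addr0.
      by rewrite mulr_sumr; apply: eq_bigr => a _; ring.
    by move=> b /negbTE b0; rewrite big1 // => a _; rewrite b0 mul0r mulr0.
  rewrite mulr_sumr; apply: eq_bigr => b _.
  rewrite [RHS](bigD1 ord0) //= [X in _ + X]big1 ?addr0; first by ring.
  by move=> a /negbTE a0; rewrite a0 mul0r mulr0.
apply: eq_bigr => b _; rewrite -sumrB; apply: eq_bigr => a _.
by rewrite -frame_comm; ring.
Qed.

(** The components of the same field along the partial derivatives: V_0 has the c-th coordinate
    [mulM q c] besides its x-coordinate 1. *)
Definition coords t : field := fun c => t c + t ord0 * mulM q c.

Lemma mulM0 t : mulM t ord0 = 0.
Proof. by rewrite /mulM big1 // => a _; rewrite shiftr0 scale0r. Qed.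

Lemma frame_coord a c : frame a (q c) = (a == c)%:R + (a == ord0)%:R * mulM q c.
Proof.
rewrite /frame pd_coord; congr (_ + _ * _).
rewrite /twist (bigD1 c) //= pd_coord eqxx mulr1 big1 ?addr0 // => b /negbTE bc.
by rewrite pd_coord bc mulr0.
Qed.

Lemma sum_delta (t : field) c : \sum_a t a * (a == c)%:R = t c.
Proof.
rewrite (bigD1 c) //= eqxx mulr1 big1 ?addr0 // => b /negbTE bc.
by rewrite bc mulr0.
Qed.

Lemma lie_coord t c : lie t (q c) = coords t c.
Proof.
rewrite /lie /coords; under eq_bigr => a _ do rewrite frame_coord mulrDr mulrA.
by rewrite big_split /= sum_delta -mulr_suml sum_delta.
Qed.

Lemma coords_inj t s : coords t = coords s -> t = s.
Proof.
move=> h; have h0 : t ord0 = s ord0.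
  by have /(congr1 (@^~ ord0)) := h; rewrite /coords mulM0 !mulr0 !addr0.
apply/funext => c; have /(congr1 (@^~ c)) := h; rewrite /coords h0.
by move/addIr.
Qed.

(** A field is determined by its action on the coordinates. Together with [lie_br] this reduces the
    identities of [br] to those of commutators of derivations. *)
Lemma lie_inj t s : (forall c, lie t (q c) = lie s (q c)) -> t = s.
Proof.
by move=> h; apply: coords_inj; apply/funext => c; rewrite -!lie_coord h.
Qed.

Lemma lieE t f : lie t f = \sum_c coords t c * D c f.
Proof.
rewrite /lie /coords /frame; under eq_bigr => a _ do rewrite mulrDr mulrA.
under [RHS]eq_bigr => a _ do rewrite mulrDl.
rewrite !big_split /=; congr (_ + _).
rewrite -mulr_suml sum_delta /twist mulr_sumr.
by apply: eq_bigr => c _; rewrite mulrA.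
Qed.

Lemma coords_br t s c :
  coords (br t s) c = lie t (coords s c) - lie s (coords t c).
Proof. by rewrite -!lie_coord lie_br. Qed.

Lemma lie_addl t s f : lie (t + s) f = lie t f + lie s f.
Proof. by have := lieDl 1 t s f; rewrite !scale1r. Qed.

Lemma lie0l f : lie 0 f = 0.
Proof. by rewrite /lie big1 // => a _; rewrite mul0r. Qed.

Lemma br_jacobi t u s : br t (br u s) + br u (br s t) + br s (br t u) = 0.
Proof. by apply: lie_inj => c; rewrite !lie_addl lie0l !lie_br !linearB /=; ring. Qed.

Lemma br_linearl (x : R) t u s : br (x *: t + u) s = x *: br t s + br u s.
Proof.
apply: lie_inj => c; rewrite !lieDl !lie_br !lieDl linearP /=.
by rewrite scalerBr opprD addrACA.
Qed.

Lemma brN t s : br t s = - br s t.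
Proof. by apply/funext => c; rewrite !fctE !brE /nb; ring. Qed.

Lemma br_linearr (x : R) t u s : br s (x *: t + u) = x *: br s t + br s u.
Proof. by rewrite brN br_linearl opprD -scalerN -!brN. Qed.

Lemma br_alt t : br t t = 0.
Proof. by apply/funext => c; rewrite brE /nb !subrr addr0. Qed.

Definition unit_field a : field := fun c => (a == c)%:R.

Lemma br_unit a t c : br (unit_field a) t c =
  frame a (t c) + (M a c)%:A * t ord0 - (a == ord0)%:R * mulM t c.
Proof.
have z : lie t (a == c)%:R = 0.
  by rewrite lieE big1 // => b _; case: (a == c); rewrite ?pd1 ?linear0 mulr0.
have lieu f : lie (unit_field a) f = frame a f.
  rewrite /lie (bigD1 a) //= /unit_field eqxx mul1r big1 ?addr0 // => b /negbTE ba.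
  by rewrite eq_sym ba mul0r.
have mulu : mulM (unit_field a) c = (M a c)%:A.
  rewrite /mulM (bigD1 a) //= /unit_field eqxx big1 ?addr0 // => b /negbTE ba.
  by rewrite eq_sym ba scaler0.
by rewrite brE /nb {2}/unit_field z subr0 lieu mulu {1}/unit_field; ring.
Qed.

(** Leibniz rule for t = sum_b t_b V_b. It lets conditions on the brackets of the frame fields with
    s pass to arbitrary function combinations of them. *)
Lemma br_frame t s c : br t s c = \sum_b t b * br (unit_field b) s c - lie s (t c).
Proof.
under eq_bigr => b _ do rewrite br_unit mulrBr mulrDr.
rewrite sumrB big_split /= brE -!addrA; congr (_ + _).
rewrite [RHS]addrA [RHS]addrC; congr (_ + _); rewrite /nb; congr (_ - _).
  by rewrite /mulM mulr_sumr; apply: eq_bigr => b _; rewrite mulr_algl -scalerAr -scalerAr mulrC.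
by under eq_bigr => a _ do rewrite mulrA; rewrite -mulr_suml sum_delta.
Qed.

(** * Polynomial functions *)

Inductive Pol : A -> Prop :=
| Pol_cst x : Pol (x%:A)
| Pol_coord c : Pol (q c)
| PolD f g : Pol f -> Pol g -> Pol (f + g)
| PolM f g : Pol f -> Pol g -> Pol (f * g).

Lemma PolZ (x : R) f : Pol f -> Pol (x *: f).
Proof. by move=> pf; rewrite -mulr_algl; apply: PolM => //; apply: Pol_cst. Qed.

Lemma Pol0 : Pol 0.
Proof. by rewrite -(scale0r 1); apply: Pol_cst. Qed.

Lemma Pol1 : Pol 1.
Proof. by rewrite -(scale1r 1); apply: Pol_cst. Qed.

Lemma PolN f : Pol f -> Pol (- f).
Proof. by move=> pf; rewrite -scaleN1r; apply: PolZ. Qed.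

Lemma PolB f g : Pol f -> Pol g -> Pol (f - g).
Proof. by move=> pf pg; apply: PolD => //; apply: PolN. Qed.

Lemma Pol_bool (b : bool) : Pol b%:R.
Proof. by case: b; [exact: Pol1 | exact: Pol0]. Qed.

Lemma Pol_sum (I : Type) (r : seq I) (P : pred I) (F : I -> A) :
  (forall i, P i -> Pol (F i)) -> Pol (\sum_(i <- r | P i) F i).
Proof.
by move=> h; elim/big_rec: _ => [|i x Pi px]; [exact: Pol0 | apply: PolD => //; apply: h].
Qed.

Lemma Pol_pd c f : Pol f -> Pol (D c f).
Proof.
elim=> [x|a|g h _ pg _ ph|g h pg pdg ph pdh].
- by rewrite pd_cst; apply: Pol0.
- by rewrite pd_coord; apply: Pol_bool.
- by rewrite linearD; apply: PolD.
- by rewrite pdM; apply: PolD; apply: PolM.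
Qed.

Lemma Pol_mulM t c : (forall a, Pol (t a)) -> Pol (mulM t c).
Proof. by move=> pt; apply: Pol_sum => a _; apply: PolZ. Qed.

Lemma Pol_frame a f : Pol f -> Pol (frame a f).
Proof.
move=> pf; rewrite /frame; apply: PolD; first exact: Pol_pd.
apply: PolM; first exact: Pol_bool.
apply: Pol_sum => c _; apply: PolM; last exact: Pol_pd.
by apply: Pol_mulM => b; apply: Pol_coord.
Qed.

Lemma Pol_lie t f : (forall c, Pol (t c)) -> Pol f -> Pol (lie t f).
Proof. by move=> pt pf; apply: Pol_sum => c _; apply: PolM => //; apply: Pol_frame. Qed.

Lemma Pol_br t s c : (forall c, Pol (t c)) -> (forall c, Pol (s c)) -> Pol (br t s c).
Proof.
move=> pt ps; rewrite brE; apply: PolD.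
  by apply: PolB; apply: Pol_lie.
by apply: PolB; apply: PolM => //; apply: Pol_mulM.
Qed.

(** The generator of the dilations that scale each q_c with exponent w c; its eigenfunctions are the
    weighted homogeneous functions. *)
Definition euler (f : A) : A := \sum_c (w c)%:R *: (q c * D c f).

Lemma euler_linear (x : R) f g : euler (x *: f + g) = x *: euler f + euler g.
Proof.
rewrite /euler scaler_sumr -big_split; apply: eq_bigr => c _ /=.
by rewrite linearP mulrDr scalerDr -scalerAr !scalerA mulrC.
Qed.
HB.instance Definition _ := GRing.isLinear.Build R A A *:%R euler euler_linear.

Lemma eulerM f g : euler (f * g) = euler f * g + f * euler g.
Proof.
rewrite /euler mulr_suml mulr_sumr -big_split; apply: eq_bigr => c _ /=.
by rewrite pdM -scalerAl -scalerAr -scalerDr; congr (_ *: _); ring.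
Qed.

Lemma euler_coord c : euler (q c) = (w c)%:R *: q c.
Proof.
rewrite /euler (bigD1 c) //= pd_coord eqxx mulr1 big1 ?addr0 // => b /negbTE bc.
by rewrite pd_coord bc mulr0 scaler0.
Qed.

Lemma euler_cst (x : R) : euler (x%:A) = 0.
Proof. by rewrite /euler big1 // => c _; rewrite pd_cst mulr0 scaler0. Qed.

Lemma pd_euler c f : D c (euler f) = euler (D c f) + (w c)%:R *: D c f.
Proof.
transitivity (\sum_a ((w a)%:R *: (q a * D a (D c f)) +
    (w a)%:R *: ((c == a)%:R * D a f))).
  rewrite /euler linear_sum; apply: eq_bigr => a _ /=.
  by rewrite linearZ /= pdM pd_coord pdC -scalerDr addrC.
rewrite big_split /=; congr (_ + _).
rewrite (bigD1 c) //= eqxx mul1r big1 ?addr0 // => b /negbTE bc.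
by rewrite eq_sym bc mul0r scaler0.
Qed.

Lemma euler_mulM c : euler (mulM q c) = ((w c)%:R - 1) *: mulM q c.
Proof.
rewrite /mulM linear_sum scaler_sumr; apply: eq_bigr => a _ /=.
rewrite linearZ /= euler_coord !scalerA; congr (_ *: _).
have [->|/weight_shift ->] := eqVneq (M a c) 0; first by rewrite !(mulr0, mul0r).
by rewrite mulrC -natr1; ring.
Qed.

Lemma euler_twist f : euler (twist f) = twist (euler f) - twist f.
Proof.
rewrite /twist linear_sum -sumrB; apply: eq_bigr => c _ /=.
rewrite eulerM euler_mulM pd_euler -scalerAl mulrDr -scalerAr scalerBl scale1r.
ring.
Qed.

Lemma euler_frame a f : euler (frame a f) = frame a (euler f) - (w a)%:R *: frame a f.
Proof.
have [->|a0] := eqVneq a ord0; last first.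
  by rewrite !frameE // pd_euler addrK.
rewrite !frame0E weight0 scale1r linearD /= euler_twist pd_euler weight0 scale1r.
ring.
Qed.

Lemma eigen_euler_cst (x : R) : eigen euler 0 x%:A.
Proof. by rewrite /eigen /= euler_cst scale0r. Qed.

Lemma eigenM d e f g : eigen euler d f -> eigen euler e g -> eigen euler (d + e) (f * g).
Proof.
rewrite /eigen /= eulerM => -> ->.
by rewrite -scalerAl -scalerAr -scalerDl rmorphD.
Qed.

Lemma eigen_frame d a f : eigen euler d f -> eigen euler (d - (w a)%:Z) (frame a f).
Proof.
rewrite /eigen /= euler_frame => ->; rewrite linearZ /= -scalerBl.
by rewrite rmorphB /= pmulrn.
Qed.

Lemma eigen_mulM d t c : (forall a, eigen euler (d + (w a)%:Z) (t a)) ->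
  eigen euler (d + (w c)%:Z - 1) (mulM t c).
Proof.
move=> h; rewrite /eigen /= /mulM linear_sum scaler_sumr; apply: eq_bigr => a _ /=.
have [->|/weight_shift ->] := eqVneq (M a c) 0; first by rewrite !scale0r linear0 scaler0.
rewrite linearZ /= h !scalerA mulrC; congr (_%:~R * _ *: _).
by rewrite -addn1 PoszD addrA addrK.
Qed.

Lemma Pol_eigensum f : Pol f -> exists t : seq (int * A), eigensum euler t f /\
  forall x, x \in t -> 0 <= x.1 /\ Pol x.2.
Proof.
elim=> [x|c|g h pg [t [[et ->] pt]] ph [r [[er ->] pr]]|
        g h pg [t [[et ->] pt]] ph [r [[er ->] pr]]].
- exists [:: (0, x%:A)]; split; first split.
  + by move=> y; rewrite inE => /eqP ->; apply: eigen_euler_cst.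
  + by rewrite big_seq1.
  + by move=> y; rewrite inE => /eqP ->; split=> //; apply: Pol_cst.
- exists [:: ((w c)%:Z, q c)]; split; first split.
  + by move=> y; rewrite inE => /eqP -> /=; rewrite /eigen /= euler_coord pmulrn.
  + by rewrite big_seq1.
  + by move=> y; rewrite inE => /eqP ->; split=> //; apply: Pol_coord.
- exists (t ++ r); split; first split; last 1 first.
  + by move=> y; rewrite mem_cat => /orP[/pt|/pr].
  + by move=> y; rewrite mem_cat => /orP[/et|/er].
  + by rewrite big_cat.
- exists [seq (x.1 + y.1, x.2 * y.2) | x <- t, y <- r]; split; first split.
  + by move=> z /allpairsP[[x y] [/= /et hx /er hy ->]]; apply: eigenM.
  + by rewrite big_allpairs_dep /= mulr_suml; apply: eq_bigr => x _; rewrite mulr_sumr.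
  + move=> z /allpairsP[[x y] [/= /pt[? ?] /pr[? ?] ->]]; split=> /=.
      exact: addr_ge0.
    exact: PolM.
Qed.

(** A polynomial is a sum of eigenfunctions of nonnegative weights. Adding - f, of weight d < 0,
    gives a vanishing sum of eigenvectors with distinct eigenvalues. *)
Lemma eigen_neg d f : Pol f -> eigen euler d f -> d < 0 -> f = 0.
Proof.
move=> /Pol_eigensum[t [et pt]] ef dlt0; have [h [eh fE h0]] := eigensum_group et.
set r := undup _ in fE.
have dr : d \notin r.
  rewrite mem_undup; apply/negP => /mapP[x /pt[x0 _] dx].
  by move: dlt0; rewrite dx ltNge x0.
pose h' e := if e == d then - f else h e.
have s0 : \sum_(e <- d :: r) h' e = 0.
  rewrite big_cons /h' eqxx big_seq; apply/eqP; rewrite addrC subr_eq0; apply/eqP.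
  rewrite fE [RHS]big_seq; apply: eq_bigr => e er.
  by case: eqP er dr => // -> ->.
have := @eigen_direct _ _ euler (d :: r) h' _ _ s0 d (mem_head _ _).
rewrite /h' eqxx => h0'; apply/eqP; rewrite -oppr_eq0; apply/eqP/h0'.
  by rewrite cons_uniq dr undup_uniq.
move=> e; case: eqP => [->|_]; last exact: eh.
by rewrite /eigen linearN /= ef scalerN.
Qed.

Lemma ev0_eigen d f : eigen euler d f -> d != 0 -> ev0 A f = 0.
Proof.
move=> /(congr1 (ev0 A)); rewrite linearZ /= {1}/euler linear_sum big1 /=.
  by move=> /eqP h d0; apply/eqP; move: h; rewrite eq_sym scaler_eq0 intr_eq0 (negbTE d0).
by move=> c _; rewrite linearZ /= ev0M ev0_coord mul0r scaler0.
Qed.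

Lemma eigen_cst_eq0 d (x : R) : eigen euler d x%:A -> d != 0 -> x%:A = 0 :> A.
Proof.
rewrite /eigen /= euler_cst => /eqP h d0; move: h.
by rewrite eq_sym scaler_eq0 intr_eq0 (negbTE d0) => /eqP.
Qed.

(** The bracket with the Euler field E, since [E, V_c] = - w_c V_c by [euler_frame]. Its eigenvalue
    is the degree of a field, so V_c has degree - w_c. *)
Definition ad_euler (t : field) : field := fun c => euler (t c) - (w c)%:R *: t c.

Lemma ad_euler_linear (x : R) t s : ad_euler (x *: t + s) = x *: ad_euler t + ad_euler s.
Proof.
apply/funext => c; rewrite /ad_euler !fctE linearP /= scalerDr opprD addrACA.
by rewrite scalerBr !scalerA [_ * x]mulrC.
Qed.
HB.instance Definition _ := GRing.isLinear.Build R field field *:%R ad_euler ad_euler_linear.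

Lemma eigen_field d t : eigen ad_euler d t <->
  forall c, eigen euler (d + (w c)%:Z) (t c).
Proof.
rewrite /eigen /=; split=> [h c|h].
  have /(congr1 (@^~ c)) := h; rewrite /ad_euler !fctE => /eqP.
  by rewrite subr_eq => /eqP ->; rewrite rmorphD /= scalerDl pmulrn.
by apply/funext => c; rewrite /ad_euler h !fctE rmorphD /= scalerDl pmulrn addrK.
Qed.

Lemma eigen_lie d e t f : (forall c, eigen euler (d + (w c)%:Z) (t c)) ->
  eigen euler e f -> eigen euler (d + e) (lie t f).
Proof.
move=> ht hf; rewrite /lie; elim/big_rec: _ => [|a x _ hx]; first exact: eigen0.
rewrite -[t a * _]scale1r; apply: eigen_lin => //.
have := eigenM (ht a) (eigen_frame a hf).
by rewrite addrACA subrr addr0.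
Qed.

Lemma eigenB d f g : eigen euler d f -> eigen euler d g -> eigen euler d (f - g).
Proof. by move=> hf hg; rewrite addrC -scaleN1r; apply: eigen_lin. Qed.

Lemma eigenD d f g : eigen euler d f -> eigen euler d g -> eigen euler d (f + g).
Proof. by move=> hf hg; rewrite -[f]scale1r; apply: eigen_lin. Qed.

Lemma eigen_br d e t s : eigen ad_euler d t -> eigen ad_euler e s ->
  eigen ad_euler (d + e) (br t s).
Proof.
move=> /eigen_field ht /eigen_field hs; apply/eigen_field => c; rewrite brE.
apply: eigenD; first apply: eigenB.
- by rewrite -addrA; apply: eigen_lie.
- by rewrite [d + e]addrC -addrA; apply: eigen_lie.
have aux (x y : field) (k m : int) : (forall c, eigen euler (k + (w c)%:Z) (x c)) ->
    (forall c, eigen euler (m + (w c)%:Z) (y c)) ->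
    eigen euler (k + m + (w c)%:Z) (y ord0 * mulM x c).
  move=> hx hy; have := eigenM (hy ord0) (eigen_mulM c hx).
  by rewrite weight0; congr (eigen _ _ _); ring.
by apply: eigenB; [exact: aux | rewrite [d + e]addrC; exact: aux].
Qed.

(** The Jacobi identity for the Euler field, V_a and t. The component c of [V_a, ad_euler t]
    involves only the same component of [V_a, t], so the equations defining symmetries are stable
    under [ad_euler]. *)
Lemma ad_euler_unit a t c : br (unit_field a) (ad_euler t) c =
  euler (br (unit_field a) t c) + ((w a)%:R - (w c)%:R) *: br (unit_field a) t c.
Proof.
have mulMad : mulM (ad_euler t) c = euler (mulM t c) - ((w c)%:R - 1) *: mulM t c.
  rewrite /mulM linear_sum scaler_sumr -sumrB; apply: eq_bigr => b _ /=.
  rewrite linearZ /= /ad_euler scalerBr !scalerA; congr (_ - _ *: _).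
  have [->|/weight_shift ->] := eqVneq (M b c) 0; first by rewrite !(mulr0, mul0r).
  by rewrite -natr1; ring.
have frame_ad : frame a (ad_euler t c) = euler (frame a (t c)) +
    ((w a)%:R - (w c)%:R) *: frame a (t c).
  rewrite /ad_euler (raddfB (frame a)) /= linearZ /= euler_frame scalerBl.
  by rewrite addrA subrK.
have M_ad : (M a c)%:A * ad_euler t ord0 = euler ((M a c)%:A * t ord0) +
    ((w a)%:R - (w c)%:R) *: ((M a c)%:A * t ord0).
  rewrite !mulr_algl linearZ /= /ad_euler weight0 scale1r scalerBr scalerA -scaleNr.
  congr (_ + _ *: _).
  have [->|/weight_shift ->] := eqVneq (M a c) 0; first by rewrite mulr0 oppr0.
  by rewrite -natr1; ring.
have mulM_ad : (a == ord0)%:R * mulM (ad_euler t) c = euler ((a == ord0)%:R * mulM t c) +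
    ((w a)%:R - (w c)%:R) *: ((a == ord0)%:R * mulM t c).
  have [->|_] := eqVneq a ord0; last by rewrite !mul0r linear0 scaler0 addr0.
  by rewrite !mul1r mulMad weight0 -scaleNr opprB.
rewrite !br_unit frame_ad M_ad mulM_ad.
move: (frame a (t c)) => F; rewrite (raddfB euler) (raddfD euler) /= scalerBr scalerDr.
ring.
Qed.

Lemma brr0 u : br u 0 = 0.
Proof. by have := br_linearr (-1) 0 0 u; rewrite scaler0 addr0 scaleN1r addNr. Qed.

Lemma brNr u t : br u (- t) = - br u t.
Proof. by have := br_linearr (-1) t 0 u; rewrite brr0 !addr0 !scaleN1r. Qed.

(* [bad a c] marks the components of [V_a, t] along V_c which vanish when t
   preserves <X> and the filtration by weights. *)
Definition bad a c := (c != ord0) && ((a == ord0) || (w a < w c)%N).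

(** Polynomiality is imposed here so that symmetries split into finitely many homogeneous parts;
    [Pol_comp] shows that smooth solutions have it automatically. *)
Definition symmetric (t : field) :=
  (forall a c, bad a c -> br (unit_field a) t c = 0) /\ (forall c, Pol (t c)).

Lemma symmetric_lin (x : R) t s : symmetric t -> symmetric s -> symmetric (x *: t + s).
Proof.
move=> [ht pt] [hs ps]; split=> [a c b|c]; last by apply: PolD => //; apply: PolZ.
by rewrite br_linearr !fctE ht // hs // scaler0 addr0.
Qed.

Lemma symmetric0 : symmetric 0.
Proof.
by split=> [a c _|c]; [rewrite brr0 | exact: Pol0].
Qed.

Lemma symmetric_ad_euler t : symmetric t -> symmetric (ad_euler t).
Proof.
move=> [ht pt]; split=> [a c b|c]; first by rewrite ad_euler_unit ht // linear0 scaler0 addr0.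
apply: PolB; last exact: PolZ.
by apply: Pol_sum => b _; apply/PolZ/PolM; [exact: Pol_coord | exact: Pol_pd].
Qed.

Lemma br_unit_br a t s : br (unit_field a) (br t s) =
  br (br (unit_field a) t) s - br (br (unit_field a) s) t.
Proof.
have /eqP := br_jacobi (unit_field a) t s.
rewrite -addrA addr_eq0 => /eqP ->.
rewrite (brN (br _ t) s) (brN (br _ s) t) (brN (unit_field a) s) brNr !opprK.
by rewrite opprD addrC.
Qed.

(** If [bad a c], then for every b at least one of [bad a b] and [bad b c] holds. Hence every term
    of the component c of [[V_a, t], s], expanded by [br_frame], contains a vanishing factor. *)
Lemma symmetric_br t s : symmetric t -> symmetric s -> symmetric (br t s).
Proof.
move=> [ht pt] [hs ps]; split=> [a c bac|c]; last exact: Pol_br.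
have aux (x y : field) : (forall a c, bad a c -> br (unit_field a) x c = 0) ->
    (forall a c, bad a c -> br (unit_field a) y c = 0) ->
    br (br (unit_field a) x) y c = 0.
  move=> hx hy; rewrite br_frame hx // linear0 subr0 big1 // => b _.
  have [bab|nbab] := boolP (bad a b); first by rewrite hx // mul0r.
  rewrite hy ?mulr0 //; move: bac nbab; rewrite /bad => /andP[-> /=].
  have [->|_] := eqVneq b ord0 => //=.
  case/orP=> [->//|ac]; rewrite negb_or -leqNgt => /andP[_ ba].
  exact: leq_ltn_trans ba ac.
by rewrite br_unit_br !fctE (aux t s ht hs) (aux s t hs ht) oppr0 addr0.
Qed.

End Frame.

(** * The invariant copy of the nilpotent algebra *)

Section RightFields.
Variables (R : realType) (n : nat) (A : calculus R n.+1) (W : grading R n).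
Local Notation M := (shift_mx W).
Local Notation w := (weight W).
Local Notation q := (@coordf R n.+1 A).
Local Notation D := (@pd R n.+1 A).
Local Notation field := ('I_n.+1 -> A).
Local Notation V := 'rV[R]_n.+1.
Local Notation mulM := (@mulM R n A W).
Local Notation twist := (@twist R n A W).
Local Notation frame := (@frame R n A W).
Local Notation lie := (@lie R n A W).
Local Notation br := (@br R n A W).
Local Notation coords := (@coords R n A W).
Local Notation euler := (@euler R n A W).
Local Notation ad_euler := (@ad_euler R n A W).
Local Notation bad := (@bad R n W).
Local Notation symmetric := (@symmetric R n A W).
Local Notation unit_field := (@unit_field R n A).
Implicit Types (f g : A) (t u s : field) (a b c e : 'I_n.+1) (v : V).

(** M raises weights by one and no weight reaches B, so M^B = 0 and the exponential of x M is a
    finite sum. *)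
Let B := (\max_c w c).+1.

Lemma shiftX_weight m a c : (M ^+ m) a c != 0 -> w c = (w a + m)%N.
Proof.
elim: m c => [|m IH] c; first by rewrite expr0 mxE addn0; have [->|_] := eqVneq a c; rewrite ?eqxx.
rewrite exprSr mxE => h; have [b] : exists b, (M ^+ m) a b * M b c != 0.
  apply/existsP; apply: contraNT h => /existsPn h; rewrite big1 // => b _.
  by have /negPn/eqP := h b.
by rewrite mulf_eq0 negb_or => /andP[/IH hb /weight_shift ->]; rewrite hb addnS.
Qed.

Lemma shiftX_nil : M ^+ B = 0.
Proof.
apply/matrixP => a c; rewrite [RHS]mxE; apply/eqP; apply: contraTT isT => /shiftX_weight wc.
have : (w c < B)%N by rewrite ltnS leq_bigmax.
by rewrite wc ltnNge leq_addl.
Qed.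

(* The entries of the exponential of x M. *)
Definition flow a c : A := \sum_(m < B) ((m`!)%:R^-1 * (M ^+ m) a c) *: q ord0 ^+ m.

Lemma pd_exp_coord b c m : D b (q c ^+ m) = ((b == c)%:R * q c ^+ m.-1) *+ m.
Proof.
elim: m => [|m IH]; first by rewrite expr0 pd1 mulr0n.
rewrite exprS pdM pd_coord IH; case: m {IH} => [|m]; first by rewrite !mulr0n mulr0 addr0.
by rewrite exprS mulrnAr mulrCA -mulrS.
Qed.

(** Differentiation in x shifts the coefficient sequence; [F B = 0] supplies the top term that the
    truncated sum would otherwise miss. *)
Lemma flow_aux (F : nat -> R) b : F B = 0 ->
  D b (\sum_(m < B) ((m`!)%:R^-1 * F m) *: q ord0 ^+ m) =
  (b == ord0)%:R * \sum_(m < B) ((m`!)%:R^-1 * F m.+1) *: q ord0 ^+ m.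
Proof.
move=> FB; have [->|b0] := eqVneq b ord0; last first.
  rewrite linear_sum big1 ?mul0r // => m _ /=.
  by rewrite linearZ /= pd_exp_coord (negbTE b0) mul0r mul0rn scaler0.
rewrite mul1r linear_sum /= big_ord_recl /= linearZ /= pd1 scaler0 add0r.
rewrite [RHS]big_ord_recr /= FB mulr0 scale0r addr0; apply: eq_bigr => m _.
rewrite linearZ /= pd_exp_coord eqxx mul1r /bump /= add1n /= -[_ *+ m.+1]scaler_nat scalerA.
congr (_ *: _).
by rewrite factS natrM invfM; field; rewrite nat1r !pnatr_eq0 -lt0n fact_gt0.
Qed.

Lemma pd_flowl b a c : D b (flow a c) = (b == ord0)%:R * \sum_e M a e *: flow e c.
Proof.
rewrite /flow (flow_aux (F := fun m => (M ^+ m) a c)) ?shiftX_nil ?mxE //.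
congr (_ * _); under [RHS]eq_bigr => e _ do rewrite scaler_sumr.
rewrite exchange_big; apply: eq_bigr => m _ /=.
rewrite exprS mxE mulr_sumr scaler_suml; apply: eq_bigr => e _.
by rewrite scalerA; congr (_ *: _); ring.
Qed.

Lemma pd_flowr b a c : D b (flow a c) = (b == ord0)%:R * \sum_e M e c *: flow a e.
Proof.
rewrite /flow (flow_aux (F := fun m => (M ^+ m) a c)) ?shiftX_nil ?mxE //.
congr (_ * _); under [RHS]eq_bigr => e _ do rewrite scaler_sumr.
rewrite exchange_big; apply: eq_bigr => m _ /=.
rewrite exprSr mxE mulr_sumr scaler_suml; apply: eq_bigr => e _.
by rewrite scalerA; congr (_ *: _); ring.
Qed.

Lemma eigen_coord c : eigen euler (w c)%:Z (q c).
Proof. by rewrite /eigen /= euler_coord pmulrn. Qed.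

Lemma eigen_exp_coord c m : eigen euler (w c * m)%:Z (q c ^+ m).
Proof.
elim: m => [|m IH]; first by rewrite muln0 expr0 -(scale1r 1); apply: eigen_euler_cst.
by rewrite exprS mulnS PoszD; apply: eigenM => //; apply: eigen_coord.
Qed.

Lemma eigenZ d (x : R) f : eigen euler d f -> eigen euler d (x *: f).
Proof. by move=> h; rewrite -[_ *: _]addr0; apply: eigen_lin => //; apply: eigen0. Qed.

Lemma eigen_sum (I : Type) (r : seq I) (P : pred I) (F : I -> A) d :
  (forall i, P i -> eigen euler d (F i)) -> eigen euler d (\sum_(i <- r | P i) F i).
Proof.
by move=> h; elim/big_rec: _ => [|i x Pi px]; [exact: eigen0 | apply: eigenD => //; apply: h].
Qed.

Lemma eigen_flow a c : eigen euler ((w c)%:Z - (w a)%:Z) (flow a c).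
Proof.
apply: eigen_sum => m _.
have [->|/shiftX_weight wc] := eqVneq ((M ^+ m) a c) 0.
  by rewrite mulr0 scale0r; apply: eigen0.
apply: eigenZ; have := eigen_exp_coord ord0 m.
by rewrite weight0 mul1n wc PoszD addrAC subrr add0r.
Qed.

Lemma Pol_exp f m : Pol f -> Pol (f ^+ m).
Proof.
move=> pf; elim: m => [|m IH]; first by rewrite expr0; apply: Pol1.
by rewrite exprS; apply: PolM.
Qed.

Lemma Pol_flow a c : Pol (flow a c).
Proof. by apply: Pol_sum => m _; apply/PolZ/Pol_exp/Pol_coord. Qed.

Lemma ev0_flow a c : ev0 A (flow a c) = (a == c)%:R.
Proof.
rewrite /flow linear_sum /= big_ord_recl /= linearZ /= ?expr0 ev0_1 big1 => [|m _].
  by rewrite fact0 invr1 mul1r ?expr0 mxE addr0 -[LHS]/(_ * _) mulr1.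
by rewrite linearZ /= /bump /= add1n [q _ ^+ _]exprS ev0M ev0_coord mul0r scaler0.
Qed.

Lemma flowr0 a : flow a ord0 = (a == ord0)%:R.
Proof.
rewrite /flow big_ord_recl /= big1 => [|m _].
  rewrite fact0 invr1 mul1r ?expr0 mxE ?expr0 addr0.
  by case: (a == ord0); rewrite ?scale1r ?scale0r.
rewrite /bump /= add1n exprSr mxE [\sum_(j < n.+1) _]big1 ?mulr0 ?scale0r // => b _.
by rewrite shiftr0 mulr0.
Qed.

(** The matrix 1 - G strictly raises weights, so it is nilpotent and its Neumann series inverts G
    within the polynomials. No addition law for the exponential is involved. *)
Lemma flow_inv : exists H : 'M[A]_n.+1, [/\ forall a c, \sum_b flow a b * H b c = (a == c)%:R,
  forall a c, \sum_b H a b * flow b c = (a == c)%:R & forall a c, Pol (H a c)].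
Proof.
pose G : 'M[A]_n.+1 := \matrix_(a, c) flow a c; pose N := 1 - G.
have wN a c : N a c != 0 -> (w a < w c)%N.
  apply: contraNT; rewrite -leqNgt => wca; rewrite !mxE /flow big_ord_recl /=.
  rewrite big1 => [|m _].
    rewrite fact0 invr1 mul1r ?expr0 mxE ?expr0 addr0.
    by case: (a == c); rewrite ?scale1r ?scale0r subrr.
  have [->|/shiftX_weight wc] := eqVneq ((M ^+ bump 0 m) a c) 0; first by rewrite mulr0 scale0r.
  by move: wca; rewrite wc /bump /= add1n addnS ltnNge leq_addr.
have wNX m a c : (N ^+ m) a c != 0 -> (w a + m <= w c)%N.
  elim: m c => [|m IH] c; first by rewrite expr0 mxE addn0; have [->|_] := eqVneq a c; rewrite ?eqxx.
  rewrite exprSr mxE => h; have [b] : exists b, (N ^+ m) a b * N b c != 0.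
    apply/existsP; apply: contraNT h => /existsPn h; rewrite big1 // => b _.
    by have /negPn/eqP := h b.
  have [->|/IH hb] := eqVneq ((N ^+ m) a b) 0; first by rewrite mul0r eqxx.
  have [->|/wN hc] := eqVneq (N b c) 0; first by rewrite mulr0 eqxx.
  by move=> _; rewrite addnS; apply: leq_ltn_trans hb hc.
have NB : N ^+ B = 0.
  apply/matrixP => a c; rewrite [RHS]mxE; apply/eqP; apply: contraTT isT => /wNX h.
  have : (w c < B)%N by rewrite ltnS leq_bigmax.
  by rewrite ltnNge (leq_trans _ h) ?leq_addl.
pose H := \sum_(m < B) N ^+ m.
have GH : G *m H = 1.
  have := subrX1 N B; rewrite NB sub0r -/H => /(congr1 -%R).
  by rewrite opprK -mulNr opprB /N opprB addrC subrK => ->.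
have HG : H *m G = 1 by apply: mulmx1C.
have PG a c : Pol (G a c) by rewrite mxE; apply: Pol_flow.
exists H; split=> a c.
- by have /matrixP/(_ a c) := GH; rewrite !mxE => <-; apply: eq_bigr => b _; rewrite !mxE.
- by have /matrixP/(_ a c) := HG; rewrite !mxE => <-; apply: eq_bigr => b _; rewrite !mxE.
- rewrite /H summxE; apply: Pol_sum => m _.
  elim: (nat_of_ord m) a c => [|k IH] a c; first by rewrite expr0 mxE; apply: Pol_bool.
  rewrite exprS mxE; apply: Pol_sum => b _; apply: PolM => //.
  by rewrite !mxE; apply: PolB; [apply: Pol_bool | apply: Pol_flow].
Qed.

(* The field commuting with the frame and taking the value - v at the origin. *)
Definition rf v : field :=
  fun c => v 0 ord0 *: mulM q c - \sum_a v 0 a *: flow a c.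

Lemma rf_linear (x : R) v1 v2 : rf (x *: v1 + v2) = x *: rf v1 + rf v2.
Proof.
apply/funext => c; rewrite /rf !fctE !mxE scalerDl scalerBr scalerA.
rewrite [X in _ - X](_ : _ = x *: (\sum_a v1 0 a *: flow a c) + \sum_a v2 0 a *: flow a c).
  by rewrite opprD addrACA.
rewrite scaler_sumr -big_split; apply: eq_bigr => a _ /=.
by rewrite !mxE scalerDl scalerA.
Qed.

Lemma rf0 v : rf v ord0 = - (v 0 ord0)%:A.
Proof.
rewrite /rf mulM0 scaler0 sub0r; congr (- _).
rewrite (bigD1 ord0) //= flowr0 eqxx big1 ?addr0 // => a /negbTE a0.
by rewrite flowr0 a0 scaler0.
Qed.

(** In coordinates [rf v] is just - v exp(x M); the term with [mulM q] in its definition is the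
    change to the invariant frame. *)
Lemma coords_rf v c : coords (rf v) c = - \sum_a v 0 a *: flow a c.
Proof. by rewrite /coords rf0 mulNr mulr_algl /rf addrAC subrr add0r. Qed.

Lemma lie_rf v f : lie (rf v) f = - \sum_a v 0 a *: \sum_c flow a c * D c f.
Proof.
rewrite lieE; under eq_bigr => c _ do rewrite coords_rf mulNr mulr_suml.
rewrite sumrN exchange_big /=; congr (- _); apply: eq_bigr => a _.
by rewrite scaler_sumr; apply: eq_bigr => c _; rewrite scalerAl.
Qed.

Lemma br_unit_rf a v : br (unit_field a) (rf v) = 0.
Proof.
apply/funext => c; rewrite br_unit rf0 [RHS]/=.
have [->|a0] := eqVneq a ord0.
  rewrite shift0r scale0r mul0r addr0 mul1r.
  have X_flow b : frame ord0 (flow b c) = \sum_e M e c *: flow b e.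
    rewrite frame0E pd_flowr eqxx mul1r /twist [X in _ + X]big1 ?addr0 // => e _.
    have [->|e0] := eqVneq e ord0; first by rewrite mulM0 mul0r.
    by rewrite pd_flowr (negbTE e0) mul0r mulr0.
  have X_mulM : frame ord0 (mulM q c) = mulM (mulM q) c.
    rewrite frame0E pd_mulM shift0r scale0r add0r /twist; apply: eq_bigr => e _.
    by rewrite pd_mulM -scalerAr mulr1.
  rewrite {1}/rf (raddfB (frame ord0)) /= linearZ /= X_mulM (raddf_sum (frame ord0)) /=.
  have -> : mulM (rf v) c = v 0 ord0 *: mulM (mulM q) c -
      \sum_a0 v 0 a0 *: \sum_e M e c *: flow a0 e.
    rewrite /rf /mulM scaler_sumr.
    under [X in _ - X]eq_bigr => b _ do rewrite scaler_sumr.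
    rewrite [X in _ - X]exchange_big -sumrB /=; apply: eq_bigr => e _.
    rewrite scalerBr; congr (_ - _); first by rewrite !scalerA mulrC.
    by rewrite scaler_sumr; apply: eq_bigr => b _; rewrite !scalerA mulrC.
  under eq_bigr => b _ do rewrite linearZ /= X_flow.
  by rewrite subrr.
rewrite mul0r subr0 frameE // /rf (raddfB (D a)) /= linearZ /= pd_mulM (raddf_sum (D a)) /=.
rewrite big1 ?subr0 => [|b _].
  by rewrite mulrN mulr_algl scalerA mulrC -scalerA subrr.
by rewrite linearZ /= pd_flowl (negbTE a0) mul0r scaler0.
Qed.

Lemma br_rf v t c : br (rf v) t c = lie (rf v) (t c).
Proof.
rewrite brN fctE br_frame big1 ?sub0r ?opprK // => b _.
by rewrite br_unit_rf mulr0.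
Qed.

Lemma Pol_rf v c : Pol (rf v c).
Proof.
apply: PolB; first by apply/PolZ/Pol_mulM => b; apply: Pol_coord.
by apply: Pol_sum => a _; apply/PolZ/Pol_flow.
Qed.

Lemma symmetric_rf v : symmetric (rf v).
Proof. by split=> [a c _|c]; [rewrite br_unit_rf | exact: Pol_rf]. Qed.

Lemma ev0_mulM c : ev0 A (mulM q c) = 0.
Proof. by rewrite /mulM linear_sum big1 // => a _; rewrite linearZ /= ev0_coord scaler0. Qed.

Lemma ev0_rf v c : ev0 A (rf v c) = - v 0 c.
Proof.
rewrite /rf (raddfB (ev0 A)) /= linearZ /= ev0_mulM scaler0 (raddf_sum (ev0 A)) /= sub0r; congr (- _).
under eq_bigr => a _ do rewrite linearZ /= ev0_flow.
rewrite (bigD1 c) //= eqxx big1 ?addr0 => [|a /negbTE ->]; last by rewrite scaler0.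
by rewrite -[LHS]/(_ * _) mulr1.
Qed.

Lemma pd_frame0 f : (forall a, frame a f = 0) -> forall c, D c f = 0.
Proof.
move=> h; have hD c : c != ord0 -> D c f = 0 by move=> c0; rewrite -(frameE W) //.
move=> c; have [->|] := eqVneq c ord0; last exact: hD.
have := h ord0; rewrite frame0E /twist big1 ?addr0 // => b _.
have [->|b0] := eqVneq b ord0; first by rewrite mulM0 mul0r.
by rewrite hD // mulr0.
Qed.

(** Induction on the weight. The component along V_0 has vanishing derivatives, hence is a constant
    and thus zero. The derivatives of [t c] then involve only those [t b] with [M b c] nonzero, of
    weight one less. *)
Lemma commuting_eq0 t : (forall a, br (unit_field a) t = 0) ->
  (forall c, ev0 A (t c) = 0) -> t = 0.
Proof.
move=> ht et; have cst0 f : (forall a, frame a f = 0) -> ev0 A f = 0 -> f = 0.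
  by move=> /pd_frame0/pd_const fE f0; rewrite fE f0 scale0r.
have htE a c : frame a (t c) + (M a c)%:A * t ord0 - (a == ord0)%:R * mulM t c = 0.
  by rewrite -br_unit ht.
have t0 : t ord0 = 0.
  apply: cst0 => // a; have := htE a ord0.
  by rewrite shiftr0 scale0r mul0r addr0 mulM0 mulr0 subr0.
suff h m c : (w c < m)%N -> t c = 0 by apply/funext => c; apply: (h (w c).+1).
elim: m c => [//|k IH] c; rewrite ltnS => wc; apply: cst0 => // a.
have := htE a c; rewrite t0 mulr0 addr0 => /eqP; rewrite subr_eq0 => /eqP ->.
rewrite /mulM big1 ?mulr0 // => b _.
have [->|/weight_shift wb] := eqVneq (M b c) 0; first by rewrite scale0r.
by rewrite IH ?scaler0 // -wb.
Qed.

Lemma commuting_rf t : (forall a, br (unit_field a) t = 0) ->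
  t = rf (\row_c - ev0 A (t c)).
Proof.
move=> ht; apply/eqP; rewrite -subr_eq0; apply/eqP; apply: commuting_eq0 => [a|c].
  by rewrite addrC -scaleN1r br_linearr ht br_unit_rf scaler0 addr0.
rewrite !fctE (raddfB (ev0 A)) /= ev0_rf !mxE opprK.
by rewrite subrr.
Qed.

Lemma rf_inj : injective rf.
Proof.
move=> v1 v2 h; apply/rowP => c; apply: oppr_inj.
by rewrite -!ev0_rf h.
Qed.

Definition nbv v1 v2 : V := v2 0 ord0 *: (v1 *m M) - v1 0 ord0 *: (v2 *m M).

Lemma sum_scalar_delta (x : 'I_n.+1 -> R) c : \sum_b x b * (b == c)%:R = x c.
Proof.
rewrite (bigD1 c) //= eqxx mulr1 big1 ?addr0 // => b /negbTE ->.
by rewrite mulr0.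
Qed.

Lemma ev0_pd_rf b v c : ev0 A (D b (rf v c)) =
  v 0 ord0 * M b c - (b == ord0)%:R * (v *m M) 0 c.
Proof.
rewrite /rf (raddfB (D b)) /= linearZ /= pd_mulM (raddfB (ev0 A)) /=; congr (_ - _).
  by rewrite linearZ /= linearZ /= ev0_1 -[LHS]/(_ * (_ * _)) mulr1.
rewrite mxE mulr_sumr (raddf_sum (D b)) (raddf_sum (ev0 A)) /=.
apply: eq_bigr => a _; rewrite linearZ /= linearZ /= pd_flowl ev0M.
have -> : ev0 A (\sum_e M a e *: flow e c) = M a c.
  rewrite (raddf_sum (ev0 A)) /=; under eq_bigr => e _.
    by rewrite linearZ /= ev0_flow -[_ *: _]/(_ * _); over.
  by rewrite sum_scalar_delta.
rewrite -[LHS]/(_ * (_ * _)) mulrCA; congr (_ * _).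
by case: (b == ord0); rewrite ?ev0_1 ?linear0.
Qed.

(** By the Jacobi identity the bracket again commutes with the frame, so [commuting_rf] reduces the
    claim to values at the origin. *)
Lemma rf_br v1 v2 : br (rf v1) (rf v2) = rf (nbv v1 v2).
Proof.
rewrite [LHS]commuting_rf => [|a].
  congr rf; apply/rowP => c; rewrite mxE br_rf lieE linear_sum /= -sumrN.
  rewrite [RHS]mxE (mxE _ _ 0 c) [X in _ + X]mxE.
  transitivity (\sum_b (v2 0 ord0 * (v1 0 b * M b c)
      - v1 0 b * (v2 *m M) 0 c * (b == ord0)%:R)).
    apply: eq_bigr => b _; rewrite ev0M ev0_pd_rf.
    have -> : ev0 A (coords (rf v1) b) = - v1 0 b.
      rewrite coords_rf (raddfN (ev0 A)) (raddf_sum (ev0 A)) /=; congr (- _).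
      under eq_bigr => a _ do rewrite linearZ /= ev0_flow -[_ *: _]/(_ * _).
      by rewrite sum_scalar_delta.
    by ring.
  rewrite sumrB sum_scalar_delta -mulr_sumr.
  by rewrite !mxE.
rewrite br_unit_br !br_unit_rf.
have br0l s : br 0 s = 0 by rewrite brN brr0 oppr0.
by rewrite !br0l subrr.
Qed.

Local Notation delta a := (delta_mx 0 a : V).

Lemma delta_sum (x : 'I_n.+1 -> A) a :
  \sum_e (delta a) 0 e *: x e = x a.
Proof.
rewrite (bigD1 a) //= !mxE !eqxx scale1r big1 ?addr0 // => e /negbTE ea.
by rewrite mxE ea andbF scale0r.
Qed.

Lemma lie_rf_delta b f : lie (rf (delta b)) f = - \sum_c flow b c * D c f.
Proof. by rewrite lie_rf delta_sum. Qed.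

Lemma lie_rf_coord b c : lie (rf (delta b)) (q c) = - flow b c.
Proof. by rewrite lie_coord coords_rf delta_sum. Qed.

(** The fields [rf (delta b)] span every tangent space: the inverse of [flow] recovers the partial
    derivatives from them. *)
Lemma lie_rf_const f : (forall b, lie (rf (delta b)) f = 0) -> f = (ev0 A f)%:A.
Proof.
have [H [_ HG _]] := flow_inv; move=> h; apply: pd_const => c.
transitivity (\sum_b H c b * \sum_e flow b e * D e f).
  under eq_bigr => b _ do rewrite mulr_sumr.
  rewrite exchange_big /=; under eq_bigr => e _.
    under eq_bigr => b _ do rewrite mulrA; rewrite -mulr_suml HG; over.
  rewrite (bigD1 c) //= eqxx mul1r big1 ?addr0 // => e /negbTE ec.
  by rewrite eq_sym ec mul0r.
by rewrite big1 // => b _; rewrite -[X in _ * X]opprK -lie_rf_delta h oppr0 mulr0.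
Qed.

Lemma eigen_unit_field a : eigen ad_euler (- (w a)%:Z) (unit_field a).
Proof.
apply/eigen_field => c; rewrite /unit_field; have [->|_] := eqVneq a c; last exact: eigen0.
by rewrite addNr -[1%:R](scale1r 1); apply: eigen_euler_cst.
Qed.

Lemma eigen_rf d v : eigen ad_euler d (rf v) <->
  forall c, - (w c)%:Z != d -> v 0 c = 0.
Proof.
split=> [/eigen_field h c cd|h].
  apply: oppr_inj; rewrite -ev0_rf oppr0; apply: ev0_eigen (h c) _.
  by apply: contraNneq cd => e; rewrite -(addrK (w c)%:Z d) e sub0r.
apply/eigen_field => c; apply: eigenB.
  have [->|v0] := eqVneq (v 0 ord0) 0; first by rewrite scale0r; apply: eigen0.
  have <- : - (w ord0)%:Z = d by apply/eqP; apply: contraNT v0 => /h ->.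
  rewrite weight0 addrC; apply: eigenZ.
  have := @eigen_mulM _ _ A W 0 q c (fun a => _); rewrite add0r; apply => a.
  by rewrite add0r; apply: eigen_coord.
apply: eigen_sum => a _; have [->|va] := eqVneq (v 0 a) 0.
  by rewrite scale0r; apply: eigen0.
have <- : - (w a)%:Z = d by apply/eqP; apply: contraNT va => /h ->.
by rewrite addrC; apply/eigenZ/eigen_flow.
Qed.

(** The component c of [V_a, t] has weight d - w_a + w_c. If (a, c) is not bad then w_c <= w_a, so
    this weight is negative and the polynomial component vanishes; t therefore commutes with the
    frame. *)
Lemma symmetric_neg d t : symmetric t -> eigen ad_euler d t -> d < 0 ->
  t = rf (\row_c - ev0 A (t c)).
Proof.
move=> [st pt] et d0; apply: commuting_rf => a; apply/funext => c.
have [/st //|nb] := boolP (bad a c).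
have /eigen_field/(_ c) := eigen_br (eigen_unit_field a) et; move/eigen_neg; apply.
  by apply: Pol_br => // b; apply: Pol_bool.
have wca : (w c <= w a)%N.
  move: nb; rewrite /bad negb_and negbK negb_or -leqNgt.
  by have [->|_] /= := eqVneq c ord0; [rewrite weight0 weight_gt0 | case/andP].
by rewrite addrAC -lez_nat in wca *; lia.
Qed.

Lemma rf_delta_nb b a : nbv (delta b) (delta a) =
  (a == ord0)%:R *: row b M - (b == ord0)%:R *: row a M.
Proof.
rewrite /nbv -!rowE !mxE /= [ord0 == a]eq_sym [ord0 == b]eq_sym.
by congr (_ *: _ - _ *: _).
Qed.

(* Weighted Poincare lemma in the frame of the right-invariant fields: the
   primitive of a closed form of positive weight is its contraction with the
   Euler field divided by the weight. *)
Lemma rf_primitive d (z : 'I_n.+1 -> field) : 0 <= d ->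
  (forall a, eigen ad_euler (d - (w a)%:Z) (z a)) ->
  (forall a c, Pol (z a c)) ->
  (forall a b, br (rf (delta b)) (z a) - br (rf (delta a)) (z b) =
     \sum_e (nbv (delta b) (delta a)) 0 e *: z e) ->
  exists t, [/\ eigen ad_euler d t, forall c, Pol (t c) &
    forall a, br (rf (delta a)) t = z a].
Proof.
move=> d0 ez pz cz; have [H [GH HG pH]] := flow_inv.
(* The coefficients of the Euler field with respect to the fields [rf (delta a)]; the sign is that
   of [coords_rf]. *)
pose e a := - \sum_b ((w b)%:R *: q b) * H b a.
have eG c : \sum_a e a * flow a c = - ((w c)%:R *: q c).
  under eq_bigr => a _ do rewrite mulNr mulr_suml.
  rewrite sumrN exchange_big /=; congr (- _); under eq_bigr => b _.
    under eq_bigr => a _ do rewrite -mulrA; rewrite -mulr_sumr HG; over.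
  exact: sum_delta.
(* H is known only as the inverse of [flow], so identities for [e] are checked after multiplication
   by [flow]. *)
have flow_cancel (x y : field) :
    (forall c, \sum_a x a * flow a c = \sum_a y a * flow a c) -> x = y.
  move=> xy; apply/funext => b.
  have inv (u : field) : \sum_c (\sum_a u a * flow a c) * H c b = u b.
    under eq_bigr => c _ do rewrite mulr_suml.
    rewrite exchange_big /=; under eq_bigr => a _.
      under eq_bigr => c _ do rewrite -mulrA; rewrite -mulr_sumr GH; over.
    exact: sum_delta.
  by rewrite -[LHS]inv -[RHS]inv; apply: eq_bigr => c _; rewrite xy.
have e0 : e ord0 = - q ord0.
  have := eG ord0; rewrite weight0 scale1r => <-; under eq_bigr => a _ do rewrite flowr0.
  by rewrite sum_delta.
have euler_rf f : \sum_a e a * lie (rf (delta a)) f = euler f.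
  under eq_bigr => a _ do rewrite lie_rf_delta mulrN mulr_sumr.
  rewrite sumrN exchange_big /=; under eq_bigr => c _.
    under eq_bigr => a _ do rewrite mulrA; rewrite -mulr_suml eG mulNr; over.
  by rewrite sumrN opprK; apply: eq_bigr => c _; rewrite scalerAl.
have Eflow a c : euler (flow a c) = ((w c)%:R - (w a)%:R) *: flow a c.
  by rewrite (eigen_flow a c) rmorphB /= !pmulrn.
have Ee a : euler (e a) = (w a)%:R *: e a.
  suff /(congr1 (@^~ a)) : (fun a => euler (e a)) = (fun a => (w a)%:R *: e a) :> field by [].
  apply: flow_cancel => c.
  transitivity (euler (\sum_a e a * flow a c) - \sum_a e a * euler (flow a c)).
    rewrite (raddf_sum euler) -sumrB; apply: eq_bigr => b _ /=.
    by rewrite eulerM addrK.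
  have -> : \sum_a e a * euler (flow a c) = (w c)%:R *: (\sum_a e a * flow a c)
      - \sum_a ((w a)%:R *: e a) * flow a c.
    rewrite scaler_sumr -sumrB; apply: eq_bigr => b _.
    by rewrite Eflow -scalerAr -scalerAl scalerBl.
  by rewrite eG linearN linearZ /= euler_coord scalerN opprB addrC subrK.
have Re b a : lie (rf (delta b)) (e a) = (w b)%:R *: (b == a)%:R + M b a *: q ord0
    + (b == ord0)%:R * \sum_a' M a' a *: e a'.
  suff /(congr1 (@^~ a)) : (fun a => lie (rf (delta b)) (e a)) =
    (fun a => (w b)%:R *: (b == a)%:R + M b a *: q ord0
       + (b == ord0)%:R * \sum_a' M a' a *: e a') :> field by [].
  apply: flow_cancel => c.
  have lflow a1 : lie (rf (delta b)) (flow a1 c) =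
      - ((b == ord0)%:R * \sum_e M a1 e *: flow e c).
    rewrite lie_rf_delta (bigD1 ord0) //= flowr0 pd_flowl eqxx mul1r [X in _ + X]big1 ?addr0 //.
    by move=> e1 /negbTE e10; rewrite pd_flowl e10 mul0r mulr0.
  transitivity (lie (rf (delta b)) (\sum_a e a * flow a c)
      - \sum_a e a * lie (rf (delta b)) (flow a c)).
    rewrite (raddf_sum (lie _)) -sumrB; apply: eq_bigr => a1 _ /=.
    by rewrite lieM addrK.
  rewrite eG (raddfN (lie _)) /= linearZ /= lie_rf_coord scalerN opprK.
  have -> : (w c)%:R *: flow b c = (w b)%:R *: flow b c +
      q ord0 * \sum_e1 M b e1 *: flow e1 c.
    have -> : (w c)%:R *: flow b c = (w b)%:R *: flow b c + euler (flow b c).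
      by rewrite Eflow scalerBl addrC subrK.
    congr (_ + _); rewrite /euler (bigD1 ord0) //= weight0 scale1r pd_flowl eqxx mul1r.
    by rewrite [X in _ + X]big1 ?addr0 // => e1 /negbTE e10; rewrite pd_flowl e10 mul0r mulr0 scaler0.
  under [RHS]eq_bigr => a1 _ do rewrite !mulrDl.
  rewrite !big_split /=; congr (_ + _ + _).
  - under [RHS]eq_bigr => a1 _ do rewrite -scalerAl.
    rewrite -scaler_sumr; congr (_ *: _).
    by under eq_bigr => a1 _ do rewrite mulrC eq_sym; rewrite sum_delta.
  - by rewrite mulr_sumr; apply: eq_bigr => a1 _; rewrite -scalerAr scalerAl.
  under eq_bigr => a1 _ do rewrite lflow mulrN.
  rewrite sumrN opprK; under [LHS]eq_bigr => a1 _ do rewrite mulrCA.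
  under [RHS]eq_bigr => a1 _ do rewrite -mulrA.
  rewrite -!mulr_sumr; congr (_ * _).
  under [LHS]eq_bigr => a1 _ do rewrite mulr_sumr.
  under [RHS]eq_bigr => a1 _ do rewrite mulr_suml.
  rewrite exchange_big /=; apply: eq_bigr => a1 _; apply: eq_bigr => e1 _.
  by rewrite -scalerAr scalerAl.
(* The contraction has weight d + w_c in its component c. This is positive because d >= 0, so it can
   be divided by. *)
pose t : field := fun c => (d + (w c)%:Z)%:~R^-1 *: \sum_a e a * z a c.
have ee a : eigen euler (w a)%:Z (e a) by rewrite /eigen /= Ee pmulrn.
exists t; split.
- apply/eigen_field => c; apply/eigenZ/eigen_sum => a _.
  have /eigen_field/(_ c) := ez a; move/(eigenM (ee a)).
  by congr (eigen _ _ _); ring.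
- move=> c; apply/PolZ/Pol_sum => a _; apply: PolM => //; apply/PolN/Pol_sum => b _.
  by apply: PolM => //; apply/PolZ/Pol_coord.
move=> b; apply/funext => c; rewrite br_rf /t linearZ /= (raddf_sum (lie _)) /=.
pose S a := \sum_e M a e *: z e c.
(* Closedness exchanges a and b, so that the sum over a rebuilds the Euler field acting on [z b c].
   The terms in S come from the structure constants and cancel at the end against those of [Re]. *)
have Rz a : lie (rf (delta b)) (z a c) = lie (rf (delta a)) (z b c)
    + ((a == ord0)%:R * S b - (b == ord0)%:R * S a).
  have /(congr1 (@^~ c)) := cz a b; rewrite !fctE !br_rf => /eqP; rewrite subr_eq => /eqP ->.
  rewrite addrC; congr (_ + _); rewrite fct_sumE /S !mulr_sumr -sumrB.
  apply: eq_bigr => e1 _; rewrite rf_delta_nb !mxE scalerBl; congr (_ - _).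
    by case: (a == ord0); rewrite ?mul1r ?mul0r ?scale0r.
  by case: (b == ord0); rewrite ?mul1r ?mul0r ?scale0r.
have dw : (d + (w c)%:Z)%:~R != 0 :> R.
  by rewrite intr_eq0; have := weight_gt0 W c; lia.
apply: (scalerI dw); rewrite scalerA mulfV // scale1r.
transitivity (euler (z b c) + (w b)%:R *: z b c); last first.
  have /eigen_field/(_ c) := ez b; rewrite /eigen /= => ->; rewrite -scalerDl; congr (_ *: _).
  by rewrite !(rmorphD, rmorphB) /= !pmulrn; ring.
under eq_bigr => a _ do rewrite lieM Re Rz !mulrDl !mulrDr.
rewrite !big_split /= euler_rf.
have -> : \sum_a (w b)%:R *: (b == a)%:R * z a c = (w b)%:R *: z b c.
  under eq_bigr => a _ do rewrite -scalerAl mulrC eq_sym.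
  by rewrite -scaler_sumr sum_delta.
have -> : \sum_a M b a *: q ord0 * z a c = q ord0 * S b.
  by rewrite /S mulr_sumr; apply: eq_bigr => a _; rewrite -scalerAl scalerAr.
have -> : \sum_a e a * ((a == ord0)%:R * S b) = - (q ord0 * S b).
  under eq_bigr => a _ do rewrite mulrA.
  by rewrite -mulr_suml sum_delta e0 mulNr.
have -> : \sum_a (b == ord0)%:R * (\sum_a' M a' a *: e a') * z a c =
    - \sum_a e a * - ((b == ord0)%:R * S a).
  under [in RHS]eq_bigr => a _ do rewrite mulrN mulrCA.
  rewrite sumrN opprK; under eq_bigr => a _ do rewrite -mulrA.
  rewrite -!mulr_sumr; congr (_ * _).
  under eq_bigr => a _ do rewrite mulr_suml.
  rewrite exchange_big /=; apply: eq_bigr => a _; rewrite /S mulr_sumr.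
  by apply: eq_bigr => e1 _; rewrite -scalerAl scalerAr.
by ring.
Qed.

(* Uniqueness of the symbol: a field of positive degree whose brackets with the
   right-invariant fields are symmetries is a symmetry, since the obstruction is
   a constant of nonzero weight. *)
Lemma symmetric_of_rf d t : 0 < d -> eigen ad_euler d t -> (forall c, Pol (t c)) ->
  (forall a, symmetric (br (rf (delta a)) t)) -> symmetric t.
Proof.
move=> d0 et pt st; split=> // a c bac.
have h : br (unit_field a) t c = (ev0 A (br (unit_field a) t c))%:A.
  apply: lie_rf_const => b; rewrite -br_rf.
  have [/(_ a c bac) <- _] := st b.
  have br0 : br 0 t = 0 by rewrite brN brr0 oppr0.
  by rewrite br_unit_br br_unit_rf br0 sub0r -brN.
have /eigen_field/(_ c) := eigen_br (eigen_unit_field a) et.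
rewrite h => /eigen_cst_eq0; apply.
move: bac; rewrite /bad => /andP[c0 /orP[/eqP->|wac]].
  by rewrite weight0; have := weight_gt0 W c; lia.
lia.
Qed.

HB.instance Definition _ := GRing.isLinear.Build R V field *:%R rf rf_linear.
HB.instance Definition _ t := GRing.isLinear.Build R field field *:%R (br t)
  (fun x s1 s2 => br_linearr W x s1 s2 t).

Lemma br0l t : br 0 t = 0.
Proof. by rewrite brN brr0 oppr0. Qed.

Lemma ev0_eigen_field d t c : eigen ad_euler d t -> 0 <= d -> ev0 A (t c) = 0.
Proof.
move=> /eigen_field/(_ c)/ev0_eigen et d0; apply: et.
by have := weight_gt0 W c; lia.
Qed.

Lemma ev0_br_rf t v c : ev0 A (br t (rf v) c) = \sum_b v 0 b * ev0 A (D b (t c)).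
Proof.
rewrite brN fctE br_rf lie_rf opprK (raddf_sum (ev0 A)); apply: eq_bigr => b _ /=.
rewrite linearZ /= -[_ *: _]/(_ * _); congr (_ * _).
rewrite (raddf_sum (ev0 A)) /= (bigD1 b) //= ev0M ev0_flow eqxx mul1r big1 ?addr0 //.
by move=> e /negbTE eb; rewrite ev0M ev0_flow eq_sym eb mul0r.
Qed.

Lemma br_const (x : 'I_n.+1 -> R) t :
  br (fun c => (x c)%:A) t = \sum_a x a *: br (unit_field a) t.
Proof.
have -> : (fun c => (x c)%:A) = \sum_a x a *: unit_field a.
  apply/funext => c; rewrite fct_sumE (bigD1 c) //= !fctE /unit_field eqxx.
  by rewrite big1 ?addr0 // => b /negbTE bc; rewrite !fctE bc scaler0.
elim: (index_enum _) => [|a r IH]; first by rewrite !big_nil br0l.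
by rewrite !big_cons br_linearl IH.
Qed.

(** * Degree zero: derivations of n as vector fields *)

Section LinearField.
(** P is the matrix, acting on row vectors, of a degree-preserving derivation with X mapped to x0 X:
    [P0r] says that the span of the Y_i and Z_j is stable, [P0c] that <X> is, and [MP] is the
    Leibniz rule for brackets with X. *)
Variables (P : 'M[R]_n.+1) (x0 : R).
Hypothesis P0r : forall b, P b ord0 = x0 *+ (b == ord0).
Hypothesis P0c : forall c, P ord0 c = x0 *+ (c == ord0).
Hypothesis MP : M *m P = P *m M + x0 *: M.
Hypothesis wP : forall a c, P a c != 0 -> w a = w c.

(* The field vanishing at the origin whose bracket with [rf v] is [rf (v *m P)]. *)
Definition linear_field : field :=
  fun c => x0 *: (q ord0 * mulM q c) - \sum_b P b c *: q b.

Lemma linear_field0 : linear_field ord0 = - (x0 *: q ord0).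
Proof.
rewrite /linear_field mulM0 mulr0 scaler0 sub0r (bigD1 ord0) //= P0r eqxx big1 ?addr0 //.
by move=> b /negbTE b0; rewrite P0r b0 scale0r.
Qed.

Lemma pd_sumP a c : D a (\sum_b P b c *: q b) = (P a c)%:A.
Proof.
rewrite (raddf_sum (D a)) (bigD1 a) //= linearZ /= pd_coord eqxx big1 ?addr0 //.
by move=> b /negbTE ba; rewrite linearZ /= pd_coord eq_sym ba scaler0.
Qed.

(** The field acts on the frame with constant coefficients. For V_0 the terms that are not constant
    cancel thanks to [MP]. Being a symmetry thus becomes the vanishing of [P a c] for bad pairs. *)
Lemma br_unit_linear_field a :
  br (unit_field a) linear_field = fun c => (- P a c)%:A.
Proof.
apply/funext => c; rewrite br_unit linear_field0.
have [->|a0] := eqVneq a ord0; last first.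
  rewrite mul0r subr0 frameE // /linear_field (raddfB (D a)) /= pd_sumP linearZ /=.
  rewrite pdM pd_coord (negbTE a0) mul0r add0r pd_mulM scaleNr mulr_algr mulr_algl.
  by rewrite scalerN !scalerA (mulrC x0) addrAC subrr add0r.
rewrite shift0r scale0r mul0r addr0 mul1r frame0E.
rewrite /linear_field !(raddfB (D ord0)) /= pd_sumP linearZ /= pdM pd_coord eqxx mul1r.
rewrite pd_mulM shift0r scale0r mulr0 addr0.
have -> : twist (x0 *: (q ord0 * mulM q c) - \sum_b P b c *: q b) =
    x0 *: (q ord0 * mulM (mulM q) c) - \sum_b P b c *: mulM q b.
  rewrite /twist; transitivity (\sum_e (x0 *: (q ord0 * (mulM q e * (M e c)%:A))
      - P e c *: mulM q e)).
    apply: eq_bigr => e _; rewrite (raddfB (D e)) /= pd_sumP linearZ /= pdM pd_coord pd_mulM.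
    have [->|e0] := eqVneq e ord0; first by rewrite mulM0 !mul0r mulr0 !scaler0 subrr.
    by rewrite mul0r add0r mulrBr -scalerAr mulrCA [X in _ - X = _]mulr_algr.
  rewrite sumrB -scaler_sumr -mulr_sumr; congr (_ *: (_ * _) - _).
  by apply: eq_bigr => e _; rewrite mulr_algr.
have -> : mulM (fun c => x0 *: (q ord0 * mulM q c) - \sum_b P b c *: q b) c =
   x0 *: (q ord0 * mulM (mulM q) c) - \sum_b (P *m M) b c *: q b.
  rewrite /mulM mulr_sumr scaler_sumr.
  under [X in _ - X]eq_bigr => b _ do rewrite mxE scaler_suml.
  rewrite [X in _ - X]exchange_big -sumrB /=; apply: eq_bigr => e _.
  rewrite scalerBr scaler_sumr; congr (_ - _).
    by rewrite -!scalerAr !scalerA mulrC.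
  by apply: eq_bigr => b _; rewrite scalerA mulrC.
have -> : \sum_b P b c *: mulM q b = \sum_b (P *m M) b c *: q b + x0 *: mulM q c.
  have -> : \sum_b P b c *: mulM q b = \sum_b (M *m P) b c *: q b.
    rewrite /mulM; under eq_bigr => b _ do rewrite scaler_sumr.
    rewrite exchange_big /=; apply: eq_bigr => a1 _; rewrite mxE scaler_suml.
    by apply: eq_bigr => b _; rewrite scalerA mulrC.
  rewrite MP /mulM scaler_sumr -big_split /=; apply: eq_bigr => b _.
  have -> : (P *m M + x0 *: M) b c = (P *m M) b c + x0 * M b c by rewrite !mxE.
  by rewrite scalerDl scalerA.
rewrite scaleNr; ring.
Qed.

Lemma Pol_linear_field c : Pol (linear_field c).
Proof.
apply: PolB; last by apply: Pol_sum => b _; apply/PolZ/Pol_coord.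
apply/PolZ/PolM; first exact: Pol_coord.
by apply: Pol_mulM => a; apply: Pol_coord.
Qed.

Lemma symmetric_linear_field : symmetric linear_field.
Proof.
split=> [a c bac|c]; last exact: Pol_linear_field.
rewrite br_unit_linear_field; suff -> : P a c = 0 by rewrite oppr0 scale0r.
move: bac; rewrite /bad => /andP[c0 h].
have [a0|a0] := eqVneq a ord0; first by rewrite a0 P0c (negbTE c0).
apply/eqP; apply: contraTT h => /wP ->.
by rewrite negb_or a0 ltnn.
Qed.

Lemma eigen_linear_field : eigen ad_euler 0 linear_field.
Proof.
apply/eigen_field => c; rewrite add0r; apply: eigenB.
  apply: eigenZ; have := @eigen_mulM _ _ A W 0 q c; rewrite add0r => h.
  have := eigenM (eigen_coord ord0) (h (fun a => _)); rewrite weight0 addrC subrK.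
  by apply=> a; rewrite add0r; apply: eigen_coord.
apply: eigen_sum => b _; have [->|/wP <-] := eqVneq (P b c) 0.
  by rewrite scale0r; apply: eigen0.
by apply/eigenZ/eigen_coord.
Qed.

Lemma br_linear_field v : br linear_field (rf v) = rf (v *m P).
Proof.
rewrite [LHS]commuting_rf => [|a].
  congr rf; apply/rowP => c; rewrite mxE ev0_br_rf mxE -sumrN; apply: eq_bigr => b _.
  rewrite -mulrN; congr (_ * _).
  rewrite /linear_field (raddfB (D b)) /= pd_sumP linearZ /= pdM pd_mulM (raddfB (ev0 A)) /=.
  rewrite linearZ /= (raddfD (ev0 A)) /= !ev0M ev0_coord ev0_mulM mulr0 mul0r addr0 scaler0.
  by rewrite sub0r opprK linearZ /= ev0_1 -[LHS]/(_ * _) mulr1.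
rewrite br_unit_br br_unit_rf br0l subr0 br_unit_linear_field br_const big1 // => b _.
by rewrite br_unit_rf scaler0.
Qed.

End LinearField.

(** The brackets with [rf (delta b)] are symmetries of negative degree, hence again of the form
    [rf v], and P collects their values at the origin. Its row 0 is read from [V_0, t]_c = 0 at the
    origin, where t vanishes. *)
Lemma symmetric_deg0 t : symmetric t -> eigen ad_euler 0 t ->
  exists P : 'M[R]_n.+1, [/\ forall v, br t (rf v) = rf (v *m P),
    forall a c, P a c != 0 -> w a = w c &
    forall c, c != ord0 -> P ord0 c = 0].
Proof.
move=> st et; pose P := \matrix_(b, c) (- ev0 A (br t (rf (delta b)) c)); exists P.
have ed b : eigen ad_euler (- (w b)%:Z) (rf (delta b)).
  apply/eigen_rf => c; rewrite mxE eqxx /=.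
  by case: (eqVneq c b) => [->|//]; rewrite eqxx.
have eb b : eigen ad_euler (- (w b)%:Z) (br t (rf (delta b))).
  by have := eigen_br et (ed b); rewrite add0r.
have Pd b : br t (rf (delta b)) = rf (row b P).
  have /symmetric_neg -> := eb b.
  - by congr rf; apply/rowP => c; rewrite !mxE.
  - exact/symmetric_br/symmetric_rf.
  - by have := weight_gt0 W b; lia.
split.
- move=> v; rewrite {1}[v]row_sum_delta !raddf_sum mulmx_sum_row raddf_sum /=.
  by apply: eq_bigr => b _; rewrite !linearZ /= Pd.
- move=> a c; rewrite mxE oppr_eq0; apply: contraNeq => wac; apply/eqP.
  have /eigen_field/(_ c)/ev0_eigen := eb a; apply.
  by apply: contraNneq wac => h; apply/eqP; lia.
move=> c c0; rewrite mxE ev0_br_rf (bigD1 ord0) //= mxE !eqxx mul1r big1 => [|b /negbTE b0].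
  rewrite addr0; have [/(_ ord0 c)] := st; rewrite /bad c0 eqxx => /(_ isT) + _.
  rewrite br_unit shift0r scale0r mul0r addr0 mul1r frame0E => /(congr1 (ev0 A)).
  rewrite (raddfB (ev0 A)) (raddfD (ev0 A)) /= linear0.
  have -> : ev0 A (twist (t c)) = 0.
    rewrite /twist (raddf_sum (ev0 A)) big1 // => b _ /=.
    by rewrite ev0M ev0_mulM mul0r.
  have -> : ev0 A (mulM t c) = 0.
    rewrite /mulM (raddf_sum (ev0 A)) big1 // => b _ /=.
    by rewrite linearZ /= (ev0_eigen_field b et) // scaler0.
  by rewrite addr0 subr0 => ->; rewrite oppr0.
by rewrite mxE b0 andbF mul0r.
Qed.

End RightFields.

(** * Symmetries as the Tanaka prolongation *)

Section GradedLieTheory.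
Variables (F : fieldType) (h : gradedLie F).
Implicit Types a b c : h.

Lemma gbrkC a b : brk a b = - brk b a.
Proof.
have brkDl x y z : brk (x + y) z = brk x z + brk y z :> h.
  by have := brk_linearl 1 x y z; rewrite !scale1r.
have brkDr x y z : brk z (x + y) = brk z x + brk z y :> h.
  by have := brk_linearr 1 x y z; rewrite !scale1r.
have := brk_alt (a + b); rewrite brkDl !brkDr !brk_alt add0r addr0 => /eqP.
by rewrite addr_eq0 => /eqP.
Qed.

Lemma gbrk0r a : brk a 0 = 0.
Proof. by have := brk_linearr (-1) 0 0 a; rewrite scaler0 addr0 scaleN1r addNr. Qed.

Lemma gbrk0l a : brk 0 a = 0.
Proof. by rewrite gbrkC gbrk0r oppr0. Qed.

Lemma gbrkNr a b : brk a (- b) = - brk a b.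
Proof. by have := brk_linearr (-1) b 0 a; rewrite gbrk0r !addr0 !scaleN1r. Qed.

Lemma gbrk_leibniz a b c : brk a (brk b c) = brk (brk a b) c + brk b (brk a c).
Proof.
have /eqP := brk_jacobi a b c; rewrite -addrA addr_eq0 => /eqP ->.
by rewrite opprD addrC (gbrkC c (brk a b)) opprK (gbrkC c a) gbrkNr opprK.
Qed.

Lemma gbrk_leibnizr a b c : brk (brk a b) c = brk (brk a c) b + brk a (brk b c).
Proof. by rewrite gbrk_leibniz (gbrkC (brk a c)) addrC addrK. Qed.

HB.instance Definition _ a := GRing.isLinear.Build F h h *:%R (brk a)
  (fun x b c => brk_linearr x b c a).

Lemma homogN d a : homog d a -> homog d (- a).
Proof. by move=> ha; rewrite -[- a]addr0 -scaleN1r; apply: homog_lin => //; apply: homog0. Qed.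

End GradedLieTheory.

(** * The graded Lie algebra of polynomial symmetries *)

Section SymmetryAlgebra.
Variables (R : realType) (n : nat) (A : calculus R n.+1) (W : grading R n).
Local Notation w := (weight W).
Local Notation field := ('I_n.+1 -> A).

Definition symmetry_pred : {pred field} := fun t => `[< symmetric W t >].

Lemma symmetry_predP t : reflect (symmetric W t) (t \in symmetry_pred).
Proof. by apply: (iffP idP) => [/asboolP|?]; last apply/asboolP. Qed.

Fact symmetry_submod : submod_closed symmetry_pred.
Proof.
split=> [|x u v /symmetry_predP su /symmetry_predP sv]; apply/symmetry_predP.
  exact: symmetric0.
exact: symmetric_lin.
Qed.
HB.instance Definition _ := GRing.isSubmodClosed.Build R field symmetry_pred symmetry_submod.

Record symmetry := Symmetry { symmetry_val :> field; _ : symmetry_val \in symmetry_pred }.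
HB.instance Definition _ := [isSub for symmetry_val].
HB.instance Definition _ := [Choice of symmetry by <:].
HB.instance Definition _ := [SubChoice_isSubLmodule of symmetry by <:].

Lemma symmetryP (t : symmetry) : symmetric W t.
Proof. by apply/symmetry_predP; case: t. Qed.

Definition to_symmetry t (st : symmetric W t) : symmetry :=
  Symmetry (introT (symmetry_predP t) st).

Definition symmetry_brk (t u : symmetry) : symmetry :=
  to_symmetry (symmetric_br (symmetryP t) (symmetryP u)).

Definition symmetry_homog (d : int) : set symmetry :=
  [set t | eigen (ad_euler W) d (symmetry_val t)].

Lemma symmetry_val_sum (I : Type) (s : seq I) (f : I -> symmetry) :
  symmetry_val (\sum_(d <- s) f d) = \sum_(d <- s) symmetry_val (f d).
Proof. by apply: (big_morph symmetry_val). Qed.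

Fact symmetry_linearl a t u v :
  symmetry_brk (a *: t + u) v = a *: symmetry_brk t v + symmetry_brk u v.
Proof. by apply: val_inj; rewrite /= br_linearl. Qed.

Fact symmetry_linearr a t u v :
  symmetry_brk v (a *: t + u) = a *: symmetry_brk v t + symmetry_brk v u.
Proof. by apply: val_inj; rewrite /= br_linearr. Qed.

Fact symmetry_alt t : symmetry_brk t t = 0.
Proof. by apply: val_inj; rewrite /= br_alt. Qed.

Fact symmetry_jacobi t u v : symmetry_brk t (symmetry_brk u v) +
  symmetry_brk u (symmetry_brk v t) + symmetry_brk v (symmetry_brk t u) = 0.
Proof. by apply: val_inj; rewrite /= br_jacobi. Qed.

Fact symmetry_homog0 d : symmetry_homog d 0.
Proof. exact: eigen0. Qed.

Fact symmetry_homog_lin d a t u :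
  symmetry_homog d t -> symmetry_homog d u -> symmetry_homog d (a *: t + u).
Proof. exact: eigen_lin. Qed.

Lemma Pol_field_eigensum (t : field) : (forall c, Pol (t c)) ->
  exists r : seq (int * field), eigensum (ad_euler W) r t.
Proof.
move=> pt; have single c : exists r : seq (int * field),
    eigensum (ad_euler W) r (fun b => (b == c)%:R * t c).
  have [r [[er rE] _]] := Pol_eigensum W (pt c).
  exists [seq (x.1 - (w c)%:Z, fun b => (b == c)%:R * x.2) | x <- r]; split.
    move=> y /mapP[x /er ex ->] /=; apply/eigen_field => b.
    have [->|_] := eqVneq b c; last by rewrite mul0r; apply: eigen0.
    by rewrite mul1r subrK.
  apply/funext => b; rewrite big_map /= fct_sumE {1}rE mulr_sumr.
  by [].
have -> : t = \sum_c (fun b => (b == c)%:R * t c).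
  apply/funext => b; rewrite fct_sumE (bigD1 b) //= eqxx mul1r big1 ?addr0 //.
  by move=> c /negbTE cb; rewrite eq_sym cb mul0r.
elim: (index_enum _) => [|c l [r [er rE]]].
  by exists [::]; split=> //; rewrite !big_nil.
have [r' [er' r'E]] := single c; exists (r' ++ r); split.
  by move=> x; rewrite mem_cat => /orP[/er'|/er].
by rewrite big_cons big_cat /= -rE -r'E.
Qed.

(** The homogeneous parts are first found among polynomial fields; stability under [ad_euler] makes
    each of them a symmetry by [eigen_sub]. *)
Fact symmetry_span t : exists (s : seq int) (f : int -> symmetry),
  (forall d, symmetry_homog d (f d)) /\ t = \sum_(d <- s) f d.
Proof.
have [st pt] := symmetryP t; have [r /eigensum_group[f [ef fE f0]]] := Pol_field_eigensum pt.
set s := undup _ in fE; exists s.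
have sf d : symmetric W (f d).
  have [ds|ds] := boolP (d \in [seq x.1 | x <- r]); last first.
    by rewrite f0 //; apply: symmetric0.
  apply: (@eigen_sub _ _ (ad_euler W) (symmetric W) s) => //.
  - exact: symmetric0.
  - by move=> x u v; apply: symmetric_lin.
  - by move=> u; apply: symmetric_ad_euler.
  - exact: undup_uniq.
  - by rewrite -fE; apply: symmetryP.
  - by rewrite mem_undup.
exists (fun d => to_symmetry (sf d)); split=> //.
by apply: val_inj; rewrite /= symmetry_val_sum.
Qed.

Fact symmetry_direct (s : seq int) (f : int -> symmetry) : uniq s ->
  (forall d, symmetry_homog d (f d)) -> \sum_(d <- s) f d = 0 ->
  forall d, d \in s -> f d = 0.
Proof.
move=> us hf sf d ds; apply: val_inj => /=.
apply: (@eigen_direct _ _ (ad_euler W) s (fun d => symmetry_val (f d))) => //.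
by rewrite -symmetry_val_sum sf.
Qed.

Fact symmetry_homog_brk d e t u : symmetry_homog d t -> symmetry_homog e u ->
  symmetry_homog (d + e) (symmetry_brk t u).
Proof. exact: eigen_br. Qed.

Definition symmetryLie : gradedLie R :=
  GradedLie symmetry_linearl symmetry_linearr symmetry_alt symmetry_jacobi
    symmetry_homog0 symmetry_homog_lin symmetry_span symmetry_direct
    symmetry_homog_brk.

End SymmetryAlgebra.

(** * The symmetry algebra satisfies the conditions on a prolongation *)

Section Prolongation.
Variables (R : realType) (k l s : nat) (A : calculus R (k + l).+1).
Variable W : grading R (k + l).
Local Notation w := (weight W).
Local Notation V := 'rV[R]_(k + l).+1.
Local Notation delta a := (delta_mx 0 a : V).
Local Notation down := (@Defs.down R k l).
Local Notation m := (nilLie R k l s).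
Local Notation g := (symmetryLie A W).
Hypothesis downE : forall u : V, down u = u *m shift_mx W.
Hypothesis nil_degE : forall c, nil_deg s c = - (w c)%:Z.

Lemma nil_brk_nbv (u v : V) : nil_brk u v = nbv W u v.
Proof. by rewrite /nil_brk !downE. Qed.

Definition right_field (v : m) : g := to_symmetry (symmetric_rf A W v).

Fact right_field_linear : linear right_field.
Proof. by move=> x u v; apply: val_inj; rewrite /= rf_linear. Qed.
HB.instance Definition _ := GRing.isLinear.Build R m g *:%R right_field right_field_linear.

Lemma right_field_inj : injective right_field.
Proof. by move=> u v /(congr1 (@symmetry_val _ _ _ _)) /rf_inj. Qed.

Lemma right_field_brk (u v : m) :
  right_field (brk u v) = brk (right_field u) (right_field v).
Proof. by apply: val_inj; rewrite /= rf_br nil_brk_nbv. Qed.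

Lemma right_field_homog d v : homog d (right_field v) <-> @homog _ m d v.
Proof.
apply: (iff_trans (eigen_rf A W d v)); split=> h c; first by rewrite nil_degE; apply: h.
by rewrite -nil_degE; apply: h.
Qed.

Lemma right_field_neg (d : int) (t : g) : d < 0 -> homog d t ->
  exists2 v, @homog _ m d v & right_field v = t.
Proof.
move=> d0 ht; have tE := symmetric_neg (symmetryP t) ht d0.
have tE' : right_field (\row_c - ev0 A (t c)) = t by apply: val_inj.
by exists (\row_c - ev0 A (t c)) => //; apply/right_field_homog; rewrite tE'.
Qed.

(** Vanishing brackets with the right-invariant fields make the components constant, and in degree d
    >= 0 all components vanish at the origin. *)
Lemma symmetry_faithful (d : int) (t : g) : 0 <= d -> homog d t ->
  (forall v, brk t (right_field v) = 0) -> t = 0.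
Proof.
move=> d0 ht h; apply: val_inj; apply/funext => c.
rewrite [LHS](lie_rf_const (W := W)) => [|b].
  by rewrite (ev0_eigen_field c ht d0) scale0r.
rewrite -br_rf brN fctE.
have /(congr1 (@symmetry_val _ _ _ _)) /(congr1 (@^~ c)) /= -> := h (delta b).
by rewrite oppr0.
Qed.

Lemma delta_homog a : @homog _ m (- (w a)%:Z) (delta a).
Proof.
move=> c; rewrite nil_degE mxE eqxx /=.
by case: (eqVneq c a) => [->|//]; rewrite eqxx.
Qed.

Lemma homog_coord (e : int) (v : m) c : homog e v -> (v : V) 0 c != 0 -> e = - (w c)%:Z.
Proof. by move=> hv; apply: contraNeq => ec; rewrite hv // nil_degE eq_sym. Qed.

Variables (u1 u2 : V) (i1 i2 : 'I_(k + l).+1).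
Hypothesis u1_0 : u1 0 ord0 = 0.
Hypothesis u2_0 : u2 0 ord0 = 0.
Hypothesis down_u1 : down u1 = delta i1.
Hypothesis down_u2 : down u2 = delta i2.
Hypothesis i12 : i1 != i2.

(** The derivation rule on the commuting pair x, y reads (phi y)_0 down x = (phi x)_0 down y. Two
    vectors u1, u2 with independent images under [down] force (phi u1)_0 = 0, and comparison with u1
    then settles every u. *)
Lemma Der0_ix (phi : {linear m -> m}) (u : V) : Der0 phi -> u 0 ord0 = 0 ->
  (phi u : V) 0 ord0 = 0.
Proof.
move=> [dphi _].
have der (x y : V) : x 0 ord0 = 0 -> y 0 ord0 = 0 ->
    (phi y : V) 0 ord0 *: down x = (phi x : V) 0 ord0 *: down y.
  move=> x0 y0; have := dphi x y; rewrite /= /nil_brk /ix x0 y0 !scale0r subr0 raddf0.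
  by rewrite sub0r subr0 => /eqP; rewrite eq_sym addrC subr_eq0 => /eqP.
have e : (phi u1 : V) 0 ord0 = 0.
  have /(congr1 (fun x : V => x 0 i2)) := der u1 u2 u1_0 u2_0.
  by rewrite down_u1 down_u2 !mxE !eqxx eq_sym (negbTE i12) mulr0 mulr1.
move=> u0; have /(congr1 (fun x : V => x 0 i1)) := der u1 u u1_0 u0.
by rewrite e scale0r down_u1 !mxE !eqxx mulr1.
Qed.

Lemma Stab_right_field (phi : {linear m -> m}) : Stab (lineX R k l s) phi ->
  exists2 t : g, homog 0 t & forall v, brk t (right_field v) = right_field (phi v).
Proof.
move=> [der sphi]; have [dphi hphi] := der.
pose P : 'M[R]_((k + l).+1) := \matrix_(a, c) (phi (delta a) : V) 0 c.
have phiE (v : V) : (phi v : V) = v *m P.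
  rewrite {1}[v]row_sum_delta mulmx_sum_row raddf_sum; apply: eq_bigr => a _ /=.
  rewrite linearZ /=; congr (_ *: _).
  by apply/rowP => c; rewrite !mxE.
have [x0 x0E] : exists x0, (phi (delta ord0) : V) = x0 *: delta ord0.
  by apply: (sphi); exists 1; rewrite scale1r.
have P0r b : P b ord0 = x0 *+ (b == ord0).
  rewrite mxE; have [->|b0] := eqVneq b ord0; first by rewrite x0E !mxE !eqxx mulr1.
  by rewrite (Der0_ix der) // mxE eqxx eq_sym (negbTE b0).
have P0c c : P ord0 c = x0 *+ (c == ord0) by rewrite mxE x0E !mxE eqxx mulr_natr.
(* The Leibniz rule for [u, X] = down u, with phi X = x0 X. *)
have MP : shift_mx W *m P = P *m shift_mx W + x0 *: shift_mx W.
  have h (u : V) : (phi (down u) : V) = down (phi u) + x0 *: down u.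
    have := dphi u (delta ord0); rewrite /= /nil_brk !x0E.
    have -> : down (delta ord0) = 0.
      by rewrite downE -rowE; apply/rowP => c; rewrite !mxE shift0r.
    rewrite downZ !mxE !eqxx !scaler0 subr0 !scale1r mulr1 => ->.
    have -> : down (delta ord0) = 0.
      by rewrite downE -rowE; apply/rowP => c; rewrite !mxE shift0r.
    by rewrite !scaler0 !subr0.
  apply/row_matrixP => a; rewrite !rowE mulmxA -downE -phiE h phiE downE mulmxDr.
  by rewrite mulmxA downE scalemxAr.
have wP a c : P a c != 0 -> w a = w c.
  move=> Pac; have /= := hphi (- (w a)%:Z) (delta a).
  move=> /(_ (@delta_homog a) c); rewrite nil_degE => hc; apply/eqP; apply: contraNT Pac => wac.
  by rewrite mxE hc // eqr_opp eqz_nat eq_sym.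
exists (to_symmetry (symmetric_linear_field A P0r P0c MP wP)).
  exact: eigen_linear_field.
move=> v; apply: val_inj; rewrite /= br_linear_field //.
by rewrite phiE.
Qed.

Lemma right_field_Stab (t : g) : homog 0 t -> exists2 phi : {linear m -> m},
  Stab (lineX R k l s) phi & forall v, brk t (right_field v) = right_field (phi v).
Proof.
move=> ht; have [P [tP wP P0]] := symmetric_deg0 (symmetryP t) ht.
have tP' (v : m) : brk t (right_field v) = right_field (mulmxr P (v : V) : m).
  by apply: val_inj; rewrite /= tP.
exists (mulmxr P : {linear m -> m}) => //; split; first split.
- move=> u v; apply: right_field_inj.
  have rfD a b : right_field (a + b) = right_field a + right_field b by exact: raddfD.
  rewrite -tP' rfD !right_field_brk -!tP'.
  exact: gbrk_leibniz.
- move=> d u hu c hc /=; rewrite mxE big1 // => a _.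
  have [->|Pac] := eqVneq (P a c) 0; first by rewrite mulr0.
  by rewrite hu ?mul0r // nil_degE (wP _ _ Pac) -nil_degE.
move=> v [x ->]; exists (x * P ord0 ord0); rewrite /= -scalemxAl -scalerA; congr (_ *: _).
rewrite -rowE; apply/rowP => c; rewrite !mxE eqxx /=.
by have [->|c0] := eqVneq c ord0; [rewrite mulr1 | rewrite mulr0 P0].
Qed.

Lemma symmetry_prolongs : prolongs (Stab (lineX R k l s)) right_field.
Proof.
split.
- exact: right_field_inj.
- exact: right_field_brk.
- move=> d d0; apply/seteqP; split=> [_ [v hv <-]|t ht]; first exact/right_field_homog.
  by have [v hv vt] := right_field_neg d0 ht; exists v.
- exact: right_field_Stab.
- exact: Stab_right_field.
- exact: symmetry_faithful.
Qed.

(** The induction hypothesis is available only for d >= 0, so all negative degrees are base cases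
    and the induction is well founded. *)
Lemma int_lt_ind (P : int -> Prop) :
  (forall d, (0 <= d -> forall e, e < d -> P e) -> P d) -> forall d, P d.
Proof.
move=> step d; have : forall (i : nat) d, d < i%:Z -> P d; last first.
  by move=> /(_ `|d|.+1 d); apply; lia.
elim=> [|i IH] e ei; apply: step => e0 e' e'e; first by lia.
by apply: IH; lia.
Qed.

(** * Embedding of a competing prolongation *)

Section Maximality.
Variables (h : gradedLie R) (iota : {linear m -> h}).
Hypothesis prolongs_h : prolongs (Stab (lineX R k l s)) iota.
Implicit Types (a b : h) (t u : g) (d e : int).

(* The graph of the embedding of h into the symmetries: in nonnegative degree,
   partners are those with partnered brackets with n. *)
Inductive related : int -> h -> g -> Prop :=
| RelatedNeg d v : d < 0 -> @homog _ m d v -> related d (iota v) (right_field v)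
| RelatedNonneg d a t : 0 <= d -> homog d a -> homog d t ->
    (forall e v, e < 0 -> @homog _ m e v ->
       related (d + e) (brk a (iota v)) (brk t (right_field v))) ->
    related d a t.

Lemma related_neg d a t : d < 0 -> related d a t ->
  exists v, [/\ @homog _ m d v, a = iota v & t = right_field v].
Proof.
move=> d0 r; case: r d0 => [{}d v _ hv _|{}d ? ? d1 _ _ _ d0]; first by exists v.
by move: d0; rewrite ltNge d1.
Qed.

Lemma iota_homog d v : d < 0 -> @homog _ m d v -> homog d (iota v).
Proof. by move=> d0 hv; rewrite -(prolongs_neg prolongs_h d0); exists v. Qed.

Lemma related_homogl d a t : related d a t -> homog d a.
Proof. by case=> // {}d v d0 hv; apply: iota_homog. Qed.

Lemma related_homogr d a t : related d a t -> homog d t.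
Proof. by case=> // {}d v d0 hv; apply/right_field_homog. Qed.

Lemma related_brkr d e a t v : related d a t -> e < 0 -> @homog _ m e v ->
  related (d + e) (brk a (iota v)) (brk t (right_field v)).
Proof.
move=> r e0 hv; case: r => [{}d v' d0 hv'|{}d {}a {}t _ _ _]; last exact.
rewrite -(prolongs_brk prolongs_h) -right_field_brk; apply: RelatedNeg; first by lia.
exact: homog_brk.
Qed.

Lemma related_lin d (x : R) a b t u :
  related d a t -> related d b u -> related d (x *: a + b) (x *: t + u).
Proof.
move=> r; elim: r b u => {d a t} [d v d0 hv b u|d a t d0 ha ht _ IH b u r].
  move=> /(related_neg d0)[v' [hv' -> ->]]; rewrite -!linearP.
  by apply: RelatedNeg => //; apply: homog_lin.
apply: RelatedNonneg => // [||e v e0 hv].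
- by apply: homog_lin => //; apply: related_homogl r.
- by apply: homog_lin => //; apply: related_homogr r.
by rewrite !brk_linearl; apply: IH => //; apply: related_brkr.
Qed.

Lemma related0 d : related d 0 0.
Proof.
elim/int_lt_ind: d => d IH; have [d0|d0] := ltP d 0.
  rewrite -(linear0 iota) -(linear0 right_field); apply: RelatedNeg => //.
  exact: homog0.
apply: RelatedNonneg => // [||e v e0 _]; try exact: homog0.
by rewrite !gbrk0l; apply: IH => //; lia.
Qed.

Lemma related_sum d (I : Type) (r : seq I) (x : I -> R) (a : I -> h) (t : I -> g) :
  (forall i, x i != 0 -> related d (a i) (t i)) ->
  related d (\sum_(i <- r) x i *: a i) (\sum_(i <- r) x i *: t i).
Proof.
move=> rat; elim: r => [|i r IH]; first by rewrite !big_nil; apply: related0.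
rewrite !big_cons; have [->|/rat] := eqVneq (x i) 0; first by rewrite !scale0r !add0r.
by move=> rat'; apply: related_lin.
Qed.

Lemma brk_delta_sum (h' : gradedLie R) (j : {linear m -> h'}) (x : h') (v : m) :
  brk x (j v) = \sum_a (v : V) 0 a *: brk x (j (delta a)).
Proof.
rewrite {1}[v]row_sum_delta !raddf_sum; apply: eq_bigr => a _ /=.
by rewrite !linearZ.
Qed.

(** If 0 has the partner t, then 0 also has the partners [t, v], of lower degree, which vanish by
    induction; faithfulness of the symmetries gives t = 0. [related_inj] is the mirror image, with
    the faithfulness of h. *)
Lemma related_unique d t : related d 0 t -> t = 0.
Proof.
elim/int_lt_ind: d t => d IH t r; have [d0|d0] := ltP d 0.
  have [v [_ v0 ->]] := related_neg d0 r; suff -> : v = 0 by rewrite linear0.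
  by apply: (prolongs_inj prolongs_h); rewrite -v0 linear0.
apply: (symmetry_faithful d0 (related_homogr r)) => v.
rewrite brk_delta_sum big1 // => a _; have w0 := weight_gt0 W a.
have := related_brkr r (e := - (w a)%:Z) _ (@delta_homog a); rewrite gbrk0l => r'.
by rewrite (IH d0 _ _ _ (r' _)) ?scaler0 //; lia.
Qed.

Lemma related_inj d a : related d a 0 -> a = 0.
Proof.
elim/int_lt_ind: d a => d IH a r; have [d0|d0] := ltP d 0.
  have [v [_ -> v0]] := related_neg d0 r; suff -> : v = 0 by rewrite linear0.
  by apply: right_field_inj; rewrite -v0 linear0.
apply: (prolongs_faithful prolongs_h d0 (related_homogl r)) => v.
rewrite brk_delta_sum big1 // => c _; have w0 := weight_gt0 W c.
have := related_brkr r (e := - (w c)%:Z) _ (@delta_homog c); rewrite gbrk0l => r'.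
by rewrite (IH d0 _ _ _ (r' _)) ?scaler0 //; lia.
Qed.

Lemma related_fun d a t u : related d a t -> related d a u -> t = u.
Proof.
move=> rt ru; have := related_lin (-1) ru rt.
rewrite scaleN1r addNr => /related_unique/eqP.
by rewrite scaleN1r addrC subr_eq0 => /eqP.
Qed.

Lemma related_primitive d a : 0 < d -> homog d a ->
  (forall e b, e < d -> homog e b -> exists t, related e b t) ->
  exists t, related d a t.
Proof.
move=> d0 ha IH.
have hbrk c : homog (d - (w c)%:Z) (brk a (iota (delta c))).
  apply: homog_brk => //; apply: iota_homog (@delta_homog c).
  by have := weight_gt0 W c; lia.
have /choice[z zP] : forall c, exists t, related (d - (w c)%:Z) (brk a (iota (delta c))) t.
  by move=> c; apply: (IH _ _ _ (hbrk c)); have := weight_gt0 W c; lia.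
have wneg c : - (w c)%:Z < 0 by have := weight_gt0 W c; lia.
(* By the Jacobi identity in h the combination on the left is a partner of [a, [delta j, delta i]].
   So is the right-hand side, by linearity, and partners are unique. *)
have closed i j : brk (z j) (right_field (delta i)) - brk (z i) (right_field (delta j)) =
    \sum_e (nbv W (delta j) (delta i)) 0 e *: z e.
  have r1 := related_brkr (zP j) (wneg i) (@delta_homog i).
  have r2 := related_brkr (zP i) (wneg j) (@delta_homog j).
  rewrite addrAC in r2; have r3 := related_lin (-1) r2 r1; rewrite !scaleN1r in r3.
  rewrite addrC; apply: (related_fun r3).
  have -> : - brk (brk a (iota (delta i))) (iota (delta j)) +
      brk (brk a (iota (delta j))) (iota (delta i)) =
      brk a (iota (nil_brk (delta j) (delta i) : m)).
    rewrite (gbrk_leibnizr a (iota (delta j))) addrA addNr add0r.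
    by rewrite -(prolongs_brk prolongs_h).
  rewrite brk_delta_sum -nil_brk_nbv; apply: related_sum => e nbe.
  have hji : @homog _ m (- (w j)%:Z - (w i)%:Z) (nil_brk (delta j) (delta i)).
    exact: (@homog_brk _ m _ _ _ _ (@delta_homog j) (@delta_homog i)).
  by rewrite -addrA (homog_coord hji nbe).
(* The sign passes from [rf, t] = - z to the wanted [t, rf] = z. *)
have [||| t [et pt tz]] :=
    @rf_primitive _ _ A W d (fun c => - (z c : 'I_(k + l).+1 -> A)) (ltW d0).
- by move=> c; apply: (homogN (related_homogr (zP c))).
- by move=> c i; apply: PolN; apply: (symmetryP (z c)).2.
- move=> i j; rewrite !brNr opprK.
  transitivity (- symmetry_val
      (brk (z j) (right_field (delta i)) - brk (z i) (right_field (delta j)))).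
    rewrite (brN W (rf A W (delta j))) (brN W (rf A W (delta i))) opprK.
    by rewrite -[RHS]/(- (_ - _)) opprB.
  rewrite closed symmetry_val_sum -sumrN; apply: eq_bigr => e _.
  by rewrite scalerN.
have st : symmetric W t.
  apply: (symmetric_of_rf d0 et pt) => c; rewrite tz.
  exact: (symmetryP (- z c)).
exists (to_symmetry st); apply: RelatedNonneg => [||//|e v e0 hv]; [exact: ltW | by [] |].
rewrite !brk_delta_sum; apply: related_sum => c vc.
have -> : brk (to_symmetry st : g) (right_field (delta c)) = z c.
  by apply: val_inj; rewrite /= brN tz opprK.
by rewrite (homog_coord hv vc).
Qed.

Lemma related_total d a : homog d a -> exists t, related d a t.
Proof.
elim/int_lt_ind: d a => d IH a ha; have [d0|d0|d0] := ltrgtP d 0.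
- by move: ha; rewrite -(prolongs_neg prolongs_h d0) => -[v hv <-]; exists (right_field v);
    apply: RelatedNeg.
- by apply: related_primitive => // e b ed; apply: IH => //; apply: ltW.
(* In degree 0 the partner is the field of a derivation in Stab(E), as [symmetric_of_rf] requires
   positive degree. *)
- rewrite d0 in ha *; have [phi sphi aphi] := prolongs_deg0 prolongs_h ha.
  have [t ht tphi] := Stab_right_field sphi.
  exists t; apply: RelatedNonneg => // e v e0 hv; rewrite aphi tphi add0r.
  by apply: RelatedNeg => //; apply: (proj2 (proj1 sphi)).
Qed.

(** Induction on the total degree. If both degrees are nonnegative, a further bracket with v in n
    acts on one factor at a time and lowers the total; if one is negative, [related_brkr]
    applies. *)
Lemma related_brk d e a b t u : related d a t -> related e b u ->
  related (d + e) (brk a b) (brk t u).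
Proof.
move: {2}(d + e) (erefl (d + e)) => f; elim/int_lt_ind: f d e a b t u.
move=> f IH d e a b t u def_f ra rb.
have [e0|e0] := ltP e 0.
  by have [v [hv -> ->]] := related_neg e0 rb; apply: related_brkr.
have [d0|d0] := ltP d 0.
  have [v [hv -> ->]] := related_neg d0 ra; rewrite addrC gbrkC (gbrkC (right_field v)).
  have := related_lin (-1) (related_brkr rb d0 hv) (related0 _).
  by rewrite !addr0 !scaleN1r.
apply: RelatedNonneg => [|||i v i0 hv]; first by lia.
- by apply: homog_brk; [apply: related_homogl ra | apply: related_homogl rb].
- by apply: homog_brk; [apply: related_homogr ra | apply: related_homogr rb].
rewrite (gbrk_leibnizr a) (gbrk_leibnizr t) -[brk (brk a _) b]scale1r.
rewrite -[brk (brk t _) u]scale1r; apply: related_lin.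
  have -> : d + e + i = (d + i) + e by ring.
  apply: IH (related_brkr ra i0 hv) rb => //; lia.
rewrite -addrA; apply: IH ra (related_brkr rb i0 hv) => //; lia.
Qed.

(** The additive extension to inhomogeneous elements. Degrees may repeat in the sum, which makes
    linearity and totality immediate; [Related_sum] merges equal degrees so that directness of the
    gradings yields uniqueness and injectivity. *)
Inductive Related : h -> g -> Prop :=
| Related_nil : Related 0 0
| Related_cons d a t b u : related d a t -> Related b u -> Related (a + b) (t + u).

Lemma Related_homog d a t : related d a t -> Related a t.
Proof. by move=> r; rewrite -[a]addr0 -[t]addr0; apply: Related_cons r Related_nil. Qed.

Lemma Related_lin (x : R) a b t u :
  Related a t -> Related b u -> Related (x *: a + b) (x *: t + u).
Proof.
elim=> {a t} [|d a t a' t' r _ IH] rb; first by rewrite !scaler0 !add0r.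
rewrite !scalerDr -!addrA; apply: (@Related_cons d) (IH rb).
by have := related_lin x r (related0 d); rewrite !addr0.
Qed.

Lemma Related_total a : exists t, Related a t.
Proof.
have [r [f [hf ->]]] := homog_span a; elim: r => [|d r [t IH]].
  by exists 0; rewrite big_nil; apply: Related_nil.
have [u ru] := related_total (hf d); exists (u + t); rewrite big_cons.
exact: Related_cons ru IH.
Qed.

Lemma Related_sum a t : Related a t -> exists (r : seq int) (f : int -> h) (z : int -> g),
  [/\ uniq r, forall d, related d (f d) (z d), a = \sum_(d <- r) f d & t = \sum_(d <- r) z d].
Proof.
elim=> {a t} [|d a t b u rat _ [r [f [z [ur rfz -> ->]]]]].
  by exists [::], (fun _ => 0), (fun _ => 0); split=> [//|d||]; rewrite ?big_nil //; apply: related0.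
pose f' e := if e == d then a + (if d \in r then f d else 0) else f e.
pose z' e := if e == d then t + (if d \in r then z d else 0) else z e.
exists (if d \in r then r else d :: r), f', z'.
have rfz' e : related e (f' e) (z' e).
  rewrite /f' /z'; case: eqP => [->|//]; rewrite -[a]scale1r -[t]scale1r.
  by apply: related_lin => //; case: (d \in r) => //; apply: related0.
have sumE (M : lmodType R) (y : int -> M) (x : M) (y' := fun e => if e == d
    then x + (if d \in r then y d else 0) else y e) :
    x + \sum_(e <- r) y e = \sum_(e <- if d \in r then r else d :: r) y' e.
  rewrite /y'; have [dr|dr] := boolP (d \in r).
    rewrite (bigD1_seq d) //= [RHS](bigD1_seq d) //= eqxx addrA; congr (_ + _).
    by apply: eq_bigr => e /negbTE ->.
  rewrite big_cons eqxx addr0; congr (_ + _); rewrite !big_seq; apply: eq_bigr => e er.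
  by case: eqP er dr => // -> ->.
split=> //; [by case: ifP => //= ->|exact: sumE|exact: sumE].
Qed.

Lemma Related_unique t : Related 0 t -> t = 0.
Proof.
move=> /Related_sum[r [f [z [ur rfz f0 ->]]]]; rewrite big_seq big1 // => d dr.
have := homog_direct ur (fun d => related_homogl (rfz d)) (esym f0) dr.
by move=> fd; have := rfz d; rewrite fd => /related_unique.
Qed.

Lemma Related_inj a : Related a 0 -> a = 0.
Proof.
move=> /Related_sum[r [f [z [ur rfz -> z0]]]]; rewrite big_seq big1 // => d dr.
have := homog_direct ur (fun d => related_homogr (rfz d)) (esym z0) dr.
by move=> zd; have := rfz d; rewrite zd => /related_inj.
Qed.

Lemma Related_fun a t u : Related a t -> Related a u -> t = u.
Proof.
move=> rt ru; have := Related_lin (-1) ru rt.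
rewrite scaleN1r addNr => /Related_unique/eqP.
by rewrite scaleN1r addrC subr_eq0 => /eqP.
Qed.

Lemma Related_brk a b t u : Related a t -> Related b u -> Related (brk a b) (brk t u).
Proof.
elim=> {a t} [|d a t a' t' ra _ IH] rb; first by rewrite !gbrk0l; apply: Related_nil.
rewrite -[a]scale1r -[t]scale1r !brk_linearl; apply: Related_lin (IH rb).
elim: rb {IH} => {b u} [|e b u b' u' rb _ IH]; first by rewrite !gbrk0r; apply: Related_nil.
rewrite -[b]scale1r -[u]scale1r !brk_linearr; apply: Related_lin IH.
exact: Related_homog (related_brk ra rb).
Qed.

(** An arbitrary choice of partners is automatically linear, multiplicative and graded, because
    partners are unique. *)
Lemma symmetry_universal : exists f : {linear h -> g},
  [/\ injective f, forall a b, f (brk a b) = brk (f a) (f b),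
      forall d a, homog d a -> homog d (f a) &
      forall v, f (iota v) = right_field v].
Proof.
have [f fP] := choice Related_total.
have f_lin : linear f.
  by move=> x a b; apply: Related_fun (fP _) (Related_lin x (fP a) (fP b)).
pose F : {linear h -> g} := HB.pack f (GRing.isLinear.Build R h g *:%R f f_lin).
exists F; split.
- move=> a b /= fab; apply/eqP; rewrite -subr_eq0; apply/eqP/Related_inj.
  have := Related_lin (-1) (fP b) (fP a).
  by rewrite fab !scaleN1r addNr addrC.
- by move=> a b; apply: Related_fun (fP _) (Related_brk (fP a) (fP b)).
- move=> d a ha; have [t rt] := related_total ha.
  by rewrite /= (Related_fun (fP a) (Related_homog rt)); apply: related_homogr rt.
have Fd c : F (iota (delta c)) = right_field (delta c).
  apply: Related_fun (fP _) (Related_homog _).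
  by apply: RelatedNeg (@delta_homog c); have := weight_gt0 W c; lia.
move=> v; rewrite [v]row_sum_delta; elim: (index_enum _) => [|c r IH].
  by rewrite !big_nil (raddf0 iota) (raddf0 F) (raddf0 right_field).
rewrite !big_cons; move: (\sum_(j <- r) _) IH => u IH.
rewrite (linearP iota) (linearP F) (linearP right_field).
by congr (_ *: _ + _); [exact: Fd | exact: IH].
Qed.

End Maximality.

Lemma symmetry_tanaka : tanaka_prolongation (Stab (lineX R k l s)) right_field.
Proof.
by split; [exact: symmetry_prolongs | exact: symmetry_universal].
Qed.

End Prolongation.

(** * The gradings of n as instances of [grading] *)

Section ConcreteGrading.
Variables (R : realType) (k l s : nat).
Local Notation V := 'rV[R]_(k + l).+1.
Local Notation down := (@Defs.down R k l).
Local Notation delta a := (delta_mx 0 a : V).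
Implicit Types (u : V) (c : 'I_(k + l).+1).
Hypothesis k_gt0 : (0 < k)%N.
Hypothesis l_gt0 : (0 < l)%N.
Hypothesis ks : (k <= s)%N.

(** The indices of X, Y_(k-1) and Z_(l-1): the basis vectors on which the image of [down] has no
    component, and also those whose frame fields span D. *)
Definition last_index c := [|| c == 0%N :> nat, c == k :> nat | c == (k + l)%N :> nat].

Lemma down_coord u c : down u 0 c = if last_index c then 0 else u 0 (inord c.+1).
Proof.
have ordS (i : nat) : (i <= k + l)%N -> (c == inord i) = (c == i :> nat).
  by move=> hi; rewrite -val_eqE /= inordK.
rewrite /Defs.down mxE !summxE.
have -> : \sum_(i < k.-1) (u 0 (iy k l i.+1) *: eY R k l i) 0 c =
    if (0 < c < k)%N then u 0 (inord c.+1) else 0.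
  case: ifPn => [/andP[c0 ck]|hc].
    have ck1 : (c.-1 < k.-1)%N by lia.
    rewrite (bigD1 (Ordinal ck1)) //= big1 ?addr0 => [|i ic].
      by rewrite !mxE eqxx /iy prednK //= ordS ?eqxx ?mulr1 //; lia.
    rewrite !mxE eqxx /iy ordS; last by have := ltn_ord i; lia.
    rewrite [_ == _](_ : _ = false) ?mulr0 //; apply: contraNF ic => /eqP ic.
    by rewrite -val_eqE /= ic.
  rewrite big1 // => i _; rewrite !mxE eqxx /iy ordS; last by have := ltn_ord i; lia.
  by rewrite [_ == _](_ : _ = false) ?mulr0 //; have := ltn_ord i; lia.
have -> : \sum_(i < l.-1) (u 0 (iz k l i.+1) *: eZ R k l i) 0 c =
    if (k < c < k + l)%N then u 0 (inord c.+1) else 0.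
  case: ifPn => [/andP[c0 ck]|hc].
    have ck1 : (c - k.+1 < l.-1)%N by lia.
    rewrite (bigD1 (Ordinal ck1)) //= big1 ?addr0 => [|i ic].
      rewrite !mxE eqxx /iz /= ordS; last by lia.
      have -> : (k + (c - k.+1)).+1 = c by lia.
      by rewrite eqxx mulr1; congr (u 0 (inord _)); lia.
    rewrite !mxE eqxx /iz ordS; last by have := ltn_ord i; lia.
    rewrite [_ == _](_ : _ = false) ?mulr0 //; apply: contraNF ic => /eqP ic.
    by rewrite -val_eqE /=; apply/eqP; lia.
  rewrite big1 // => i _; rewrite !mxE eqxx /iz ordS; last by have := ltn_ord i; lia.
  by rewrite [_ == _](_ : _ = false) ?mulr0 //; have := ltn_ord i; lia.
have := ltn_ord c; have [h1|h1] := boolP (0 < c < k)%N;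
  have [h2|h2] := boolP (k < c < k + l)%N; have [h3|h3] := boolP (last_index c);
  rewrite ?addr0 ?add0r //; move: h3; rewrite /last_index; lia.
Qed.

(** All degrees are negative as soon as k <= s, so the absolute value is the opposite. *)
Definition nil_weight c : nat := `|nil_deg s c|%N.

Lemma nil_weightE c : nil_deg s c = - (nil_weight c)%:Z.
Proof. by rewrite /nil_weight /nil_deg; have := ltn_ord c; do 2?case: ifP; lia. Qed.

Definition down_mx : 'M[R]_((k + l).+1) := \matrix_a down (delta a).

Lemma down_mxE u : down u = u *m down_mx.
Proof.
rewrite mulmx_sum_row {1}[u]row_sum_delta; elim: (index_enum _) => [|a r IH].
  by rewrite !big_nil; have := downB (0 : V) 0; rewrite !subr0 subrr.
by rewrite !big_cons down_lin IH rowK.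
Qed.

Lemma down_mx_coord a c : down_mx a c = (~~ last_index c && (a == c.+1 :> nat))%:R.
Proof.
rewrite mxE down_coord; case: ifPn => //= hc; rewrite mxE eqxx /=; congr (_%:R).
rewrite -val_eqE /= inordK 1?eq_sym //; move: hc; rewrite /last_index; have := ltn_ord c.
by lia.
Qed.

Fact down_mx0r c : down_mx ord0 c = 0.
Proof. by rewrite down_mx_coord andbF. Qed.

Fact down_mxr0 a : down_mx a ord0 = 0.
Proof. by rewrite down_mx_coord /last_index eqxx. Qed.

Fact down_mx_weight a c : down_mx a c != 0 -> nil_weight c = (nil_weight a).+1.
Proof.
rewrite down_mx_coord; case: andP => [[hc /eqP ac] _|]; last by rewrite eqxx.
have := nil_weightE c; have := nil_weightE a; move: hc.
rewrite /last_index /nil_deg ac; have := ltn_ord c; do 4?case: ifP; lia.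
Qed.

Fact nil_weight_gt0 c : (0 < nil_weight c)%N.
Proof.
have := nil_weightE c; rewrite /nil_deg; have := ltn_ord c; do 2?case: ifP; lia.
Qed.

Fact nil_weight0 : nil_weight ord0 = 1%N.
Proof. by []. Qed.

Definition nil_grading : grading R (k + l) :=
  Grading down_mx0r down_mxr0 down_mx_weight nil_weight_gt0 nil_weight0.

End ConcreteGrading.

(** * Local nilpotency and polynomiality *)

Section LocallyNilpotent.
Variables (R : realType) (n : nat) (A : calculus R n.+1) (W : grading R n).
Local Notation M := (shift_mx W).
Local Notation w := (weight W).
Local Notation q := (@coordf R n.+1 A).
Local Notation D := (@pd R n.+1 A).
Local Notation X := (@frame R n A W ord0).
Local Notation Dpow r a := (iter r (D a)).
Local Notation iterX j := (iter j X).
Implicit Types (f g u : A) (a b c e : 'I_n.+1).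

Definition pd_shift a f : A := \sum_c M a c *: D c f.

Lemma pd_X a f : D a (X f) = X (D a f) + pd_shift a f.
Proof.
rewrite !frame0E (raddfD (D a)) /= pd_twist pdC addrA; congr (_ + _).
exact: sumMframe.
Qed.

Lemma pd_shift_pd a b f : D a (pd_shift b f) = pd_shift b (D a f).
Proof.
rewrite /pd_shift (raddf_sum (D a)); apply: eq_bigr => c _ /=.
by rewrite linearZ /= pdC.
Qed.

Lemma pd_shift0 a : pd_shift a 0 = 0.
Proof. by rewrite /pd_shift big1 // => c _; rewrite linear0 scaler0. Qed.

Lemma iterD_lin r a (x : R) f g : Dpow r a (x *: f + g) = x *: Dpow r a f + Dpow r a g.
Proof. by elim: r => //= r ->; rewrite linearP. Qed.

Lemma iterD0 r a : Dpow r a 0 = 0.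
Proof. by elim: r => //= r ->; rewrite linear0. Qed.

Lemma iterDB r a f g : Dpow r a (f - g) = Dpow r a f - Dpow r a g.
Proof. by elim: r => //= r ->; rewrite linearB. Qed.

Lemma iterDD r a f g : Dpow r a (f + g) = Dpow r a f + Dpow r a g.
Proof. by elim: r => //= r ->; rewrite linearD. Qed.

Lemma iterDMn r a f k : Dpow r a (f *+ k) = Dpow r a f *+ k.
Proof. by elim: r => //= r ->; rewrite linearMn. Qed.

Lemma iterX0 j : iterX j 0 = 0.
Proof. by elim: j => //= j ->; rewrite linear0. Qed.

Lemma iterXB j f g : iterX j (f - g) = iterX j f - iterX j g.
Proof. by elim: j => //= j ->; rewrite linearB. Qed.

Lemma iterX_sum j (I : Type) (r : seq I) (x : I -> R) (F : I -> A) :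
  iterX j (\sum_(i <- r) x i *: F i) = \sum_(i <- r) x i *: iterX j (F i).
Proof.
elim: j => //= j ->; rewrite (raddf_sum X); apply: eq_bigr => i _ /=.
by rewrite linearZ.
Qed.

Lemma iterD_pd r a b f : Dpow r a (D b f) = D b (Dpow r a f).
Proof. by elim: r => //= r ->; rewrite pdC. Qed.

Lemma iterDC r a p b f : Dpow r a (Dpow p b f) = Dpow p b (Dpow r a f).
Proof. by elim: p => //= p <-; rewrite iterD_pd. Qed.

Lemma iterD_shift r a b f : Dpow r a (pd_shift b f) = pd_shift b (Dpow r a f).
Proof. by elim: r => //= r ->; rewrite pd_shift_pd. Qed.

Lemma iter_nil_le (F : A -> A) r p f : F 0 = 0 -> (r <= p)%N -> iter r F f = 0 -> iter p F f = 0.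
Proof.
move=> F0 rp h; rewrite -(subnK rp) iterD h.
by elim: (p - r)%N => //= i ->.
Qed.

Lemma iterD_le r p a f : (r <= p)%N -> Dpow r a f = 0 -> Dpow p a f = 0.
Proof. by apply: iter_nil_le; rewrite linear0. Qed.

Lemma iterX_le r p f : (r <= p)%N -> iterX r f = 0 -> iterX p f = 0.
Proof. by apply: iter_nil_le; rewrite linear0. Qed.

Lemma iterD_X r a f :
  Dpow r a (X f) = X (Dpow r a f) + pd_shift a (Dpow r.-1 a f) *+ r.
Proof.
elim: r => [|r IH]; first by rewrite mulr0n addr0.
rewrite [LHS]/= IH (raddfD (D a)) /= pd_X (raddfMn (D a)) /= pd_shift_pd -addrA.
by case: r {IH} => [|r]; rewrite ?mulr0n ?addr0 //= -mulrS.
Qed.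

Definition nilp a r f := forall j, Dpow r a (iterX j f) = 0.

(** Moving X past a power of D_a costs one factor D_a ([iterD_X]), and only the powers of X below N
    can leave f nonzero. *)
Lemma nilp_start a r N f : Dpow r a f = 0 -> iterX N f = 0 -> nilp a (r + N) f.
Proof.
move=> rf Nf j; have aux i : Dpow (r + i) a (iterX i f) = 0.
  elim: i => [|i IH]; first by rewrite addn0.
  rewrite addnS [iterX i.+1 f]iterS iterD_X [(r + i).+1.-1]/= iterS IH.
  by rewrite !linear0 pd_shift0 mul0rn addr0.
have [jN|Nj] := leqP j N; first by apply: iterD_le (aux j); rewrite leq_add2l.
by rewrite (iterX_le (ltnW Nj) Nf) iterD0.
Qed.

(* In the commutative algebra of the derivations, the operators annihilating
   all X^j f form an ideal stable under ad X; its radical is then stable under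
   ad X as well. *)
Lemma nilp_shift a b r f : (forall g, pd_shift a g = D b g) ->
  nilp a r f -> nilp b (r + r) f.
Proof.
(* Each step trades one factor D_a for two factors D_b; after r steps only D_b is left. *)
move=> ab ha; suff h i : (i <= r)%N -> forall j,
    Dpow (r - i) a (Dpow (i + i) b (iterX j f)) = 0.
  by move=> j; have := h r (leqnn r) j; rewrite subnn.
elim: i => [_ j|i IH ir j]; first by rewrite subn0 ha.
set g := iterX j f; set p := (r - i.+1)%N.
have pE : (r - i)%N = p.+1 by rewrite /p; lia.
have := IH (ltnW ir) j.+1; have hg := IH (ltnW ir) j.
rewrite -/g in hg; rewrite pE in hg *; rewrite [iterX j.+1 f]/= -/g iterD_X.
rewrite iterDD iterD_X ab iterDMn iterD_shift hg linear0 add0r /=.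
(* The additional D_b makes the term from commuting X with the power of D_b vanish. The remaining
   coefficient r - i is nonzero and can be cancelled. *)
move=> /(congr1 (D b)); rewrite linear0 (raddfD (D b)) (raddfMn (D b)) (raddfMn (D b)) /=.
have -> : D b (pd_shift b (D a (Dpow p a (Dpow (i + i).-1 b g)))) *+ (i + i) = 0.
  have [->|i0] := posnP i; first by rewrite mulr0n.
  rewrite pd_shift_pd pdC -iterD_pd -[D b (Dpow _ b g)]iterS prednK ?addn_gt0 ?i0 //.
  by rewrite -[D a _]/(Dpow p.+1 a _) hg pd_shift0 mul0rn.
rewrite addr0 => /eqP; rewrite -scaler_nat scaler_eq0 pnatr_eq0 /= => /eqP h.
by rewrite addnS iterS !iterD_pd.
Qed.

(** X D_c is D_c X minus a combination of D_e with w_e = w_c + 1. The first term lowers N and the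
    second raises the weight, which is bounded by K, so the bound K - w_c + N drops either way. *)
Lemma pd_nilX K t c N f : (forall c, (w c <= K)%N) -> (K - w c + N <= t)%N ->
  iterX N f = 0 -> iterX t (D c f) = 0.
Proof.
move=> wK; elim: t c N f => [|t IH] c N f.
  by rewrite leqn0 addn_eq0 => /andP[_ /eqP->] /= ->; exact: linear0.
case: N => [|N] ht hf; first by rewrite (hf : f = 0) linear0 iterX0.
rewrite iterSr.
have -> : X (D c f) = D c (X f) - pd_shift c f by rewrite pd_X addrK.
rewrite iterXB (IH c N); [|lia|by rewrite -iterSr].
rewrite sub0r /pd_shift iterX_sum big1 ?oppr0 // => e _.
have [->|/weight_shift we] := eqVneq (M c e) 0; first by rewrite scale0r.
rewrite (IH e N.+1) ?scaler0 //; have := wK e; rewrite we; lia.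
Qed.

(** Induction on the sum of the exponents: each D_b f has a smaller exponent in b and is still
    killed by a power of X. A suitable power of D_0 then kills all D_b f. *)
Lemma pd0_nil (m : 'I_n.+1 -> nat) N f :
  (forall c, c != ord0 -> Dpow (m c) c f = 0) -> iterX N f = 0 ->
  exists r, Dpow r ord0 f = 0.
Proof.
have [t] := ubnP (\sum_(c | c != ord0) m c); elim: t m N f => // t IH m N f mt hm hN.
have [r hr] : exists r, forall b, b != ord0 -> Dpow r ord0 (D b f) = 0.
  have /choice[r hr] : forall b, exists r, b != ord0 -> Dpow r ord0 (D b f) = 0.
    move=> b; have [->|b0] := eqVneq b ord0; first by exists 0%N.
    case mb : (m b) => [|i].
      by exists 0%N => _; have := hm b b0; rewrite mb /= => ->; rewrite linear0.
    have := pd_nilX (fun c => leq_bigmax c) (leqnn (_ - w b + _)) hN.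
    move=> /(IH (fun c => if c == b then i else m c)) [].
    - move: mt; rewrite (bigD1 b) //= [X in _ -> (X < _)%N](bigD1 b) //= eqxx mb ltnS addSn.
      apply: leq_ltn_trans; rewrite leq_add2l; apply: leq_sum => c /andP[_ /negbTE ->].
      exact: leqnn.
    - move=> c c0; case: eqP => [->|_]; last by rewrite iterD_pd hm // linear0.
      by have := hm b b0; rewrite mb iterSr.
    - by move=> r hr; exists r.
  exists (\max_b r b) => b b0; apply: iterD_le (hr b b0).
  exact: leq_bigmax.
(* u depends on x alone, so X acts on it as D_0; as X and D_0 commute, u is still killed by X^N,
   hence by D_0^N. *)
set u := Dpow r ord0 f.
have Du b : b != ord0 -> D b u = 0 by move=> b0; rewrite /u -iterD_pd hr.
have Xu : iterX N u = 0.
  have XD g : X (D ord0 g) = D ord0 (X g).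
    by rewrite pd_X /pd_shift big1 ?addr0 // => c _; rewrite shift0r scale0r.
  have XiD p g : X (Dpow p ord0 g) = Dpow p ord0 (X g) by elim: p => //= p <-; rewrite XD.
  have -> : iterX N u = Dpow r ord0 (iterX N f) by rewrite /u; elim: N {hN} => //= N ->.
  by rewrite hN iterD0.
exists (N + r)%N; rewrite iterD -/u.
suff <- : iterX N u = Dpow N ord0 u by [].
elim: N {hN Xu} => //= N ->; rewrite frame0E /twist big1 ?addr0 // => c _.
have [->|c0] := eqVneq c ord0; first by rewrite mulM0 mul0r.
by rewrite -iterD_pd Du // iterD0 mulr0.
Qed.

Lemma iterD_mul r a g u : D a u = 0 -> Dpow r a (g * u) = Dpow r a g * u.
Proof. by move=> au; elim: r => //= r ->; rewrite pdM au mulr0 addr0. Qed.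

Lemma iterD_exp a r : Dpow r a (q a ^+ r) = (r`!)%:R.
Proof.
elim: r => [|r IH]; first by rewrite expr0.
rewrite iterSr pd_exp_coord eqxx mul1r iterDMn IH factS natrM /=.
by rewrite mulr_natl.
Qed.

(** Taylor expansion in one variable at a time; r lists the variables on which f may depend. The
    leading coefficient u in the variable c no longer depends on c, and subtracting its monomial
    lowers the nilpotency exponent in c. *)
Lemma nil_Pol (r : seq 'I_n.+1) f : (forall c, c \notin r -> D c f = 0) ->
  (forall c, exists m, Dpow m c f = 0) -> Pol f.
Proof.
elim: r f => [|c r IH] f Dr nil_f.
  by rewrite (pd_const (fun c => Dr c isT)); apply: Pol_cst.
have [m hm] := nil_f c; elim: m f Dr nil_f hm => [|m IHm] f Dr nil_f hm.
  by rewrite (hm : f = 0); apply: Pol0.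
pose u := Dpow m c f.
have Du : D c u = 0 by exact: hm.
have pu : Pol u.
  apply: IH => [b br|b].
    have [->//|bc] := eqVneq b c.
    by rewrite /u -iterD_pd Dr ?iterD0 // inE negb_or bc.
  by have [p hp] := nil_f b; exists p; rewrite /u iterDC hp iterD0.
pose f1 := f - (m`!)%:R^-1 *: (q c ^+ m * u).
have Dq b p : b != c -> Dpow p b (q c ^+ m * u) = q c ^+ m * Dpow p b u.
  move=> bc; elim: p => //= p ->; rewrite pdM pd_exp_coord (negbTE bc) mul0r mul0rn.
  by rewrite mul0r add0r.
have -> : f = f1 + (m`!)%:R^-1 *: (q c ^+ m * u) by rewrite subrK.
apply: PolD; last by apply/PolZ/PolM => //; apply/Pol_exp/Pol_coord.
have nilc : Dpow m c f1 = 0.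
  rewrite iterDB -[X in _ - Dpow _ _ X]addr0 iterD_lin iterD0 addr0 iterD_mul //.
  have e z : (m`!)%:R * z = (m`!)%:R *: z :> A by rewrite mulr_natl scaler_nat.
  by rewrite iterD_exp e scalerA mulVf ?scale1r ?subrr // pnatr_eq0 -lt0n fact_gt0.
apply: IHm => // [b|b].
  rewrite inE negb_or => /andP[bc br]; have := Dq b 1%N bc => /= Dqb.
  by rewrite /f1 linearB linearZ /= Dqb /u -iterD_pd !Dr ?iterD0 ?mulr0 ?scaler0 ?subr0 //
    inE negb_or bc.
have [->|bc] := eqVneq b c; first by exists m.
have [p hp] := nil_f b; exists p.
rewrite iterDB hp -[X in _ - Dpow _ _ X]addr0 iterD_lin iterD0 addr0 Dq //.
by rewrite /u iterDC hp iterD0 mulr0 scaler0 subr0.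
Qed.

End LocallyNilpotent.

(** * The calculus of smooth functions *)

Section Directional.
Variables (R : realType) (V : normedModType R).
Implicit Types (f : V -> R) (p u e : V).

Lemma derive_line f p e (s : R) : derivable f (p + s *: e) e ->
  is_derive s 1 (fun s => f (p + s *: e)) ('D_e f (p + s *: e)).
Proof.
have quot : (fun h : R => h^-1 *: (((fun s => f (p + s *: e)) \o shift s) (h *: 1)
    - f (p + s *: e))) =
    (fun h => h^-1 *: ((f \o shift (p + s *: e)) (h *: e) - f (p + s *: e))).
  apply/funext => h /=; congr (_ *: (f _ - _)).
  by rewrite scalerDl addrCA [h *: 1]mulr1.
by move=> df; split; rewrite /derivable /derive quot.
Qed.

Lemma mvt_direction f e p (h : R) : (forall p, derivable f p e) ->
  exists2 x, `|x| <= `|h| & f (p + h *: e) - f p = h * 'D_e f (p + x *: e).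
Proof.
move=> df; pose g := (fun s : R => f (p + s *: e)).
have dg (s : R) : is_derive s 1 g ('D_e f (p + s *: e)) by apply: derive_line.
have cg (a b : R) : {within `[a, b], continuous g}.
  apply: continuous_subspaceT => s; apply: differentiable_continuous.
  by apply/derivable1_diffP; apply: ex_derive.
have g0 : f p = g 0 by rewrite /g scale0r addr0.
rewrite g0 -/(g h); have [h0|h0] := leP 0 h.
  have [x] := MVT_segment h0 (fun s _ => dg s) (cg 0 h).
  rewrite in_itv /= => /andP[x0 xh] ->; exists x; first by rewrite !ger0_norm.
  by rewrite subr0 mulrC.
have [x] := MVT_segment (ltW h0) (fun s _ => dg s) (cg h 0).
rewrite in_itv /= => /andP[x0 xh] gE; exists x.
  by rewrite !ler0_norm ?lerN2 // ltW.
by rewrite -opprB gE sub0r mulrN opprK mulrC.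
Qed.

(** The increment splits into a step along u and a step along e. The second is a value of the
    derivative along e at an intermediate point, and continuity of that derivative at p gives the
    limit. *)
Lemma derive_add f p u e (x a : R) : (forall p, derivable f p e) ->
  {for p, continuous (fun p => 'D_e f p)} ->
  is_derive p u f a -> is_derive p (u + x *: e) f (a + x * 'D_e f p).
Proof.
move=> df cf [du <-].
pose q2 := (fun h : R => h^-1 *: ((f \o shift p) (h *: u) - f p)).
pose q1 := (fun h : R => h^-1 *: (f (h *: (u + x *: e) + p) - f (h *: u + p))).
have lim2 : q2 @ 0^' --> 'D_u f p by [].
have lim1 : q1 @ 0^' --> x * 'D_e f p.
  apply/cvgrPdist_le => eps eps0.
  have x1 : 0 < `|x| + 1 by rewrite ltr_wpDl.
  have /cvgrPdist_lt/(_ (eps / (`|x| + 1))) := cf.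
  rewrite divr_gt0 // => /(_ isT)/nbhs_ballP[d /= d0 hd].
  (* The intermediate point is within |h| (|u| + |x| |e|) of p; the summand 1 only makes the divisor
     positive. *)
  have K0 : 0 < `|u| + `|x| * `|e| + 1 by rewrite ltr_wpDl // addr_ge0 // mulr_ge0.
  have : \forall h \near (0 : R)^', `|h| < d / (`|u| + `|x| * `|e| + 1).
    by apply: dnbhs0_lt; rewrite divr_gt0.
  move=> hnear; near=> h.
  have h0 : h != 0 by near: h; apply: nbhs_dnbhs_neq.
  have hlt : `|h| < d / (`|u| + `|x| * `|e| + 1) by near: h.
  rewrite /q1; have [z zh zE] := mvt_direction (p + h *: u) (h * x) df.
  have -> : f (h *: (u + x *: e) + p) - f (h *: u + p) =
      h * x * 'D_e f (p + h *: u + z *: e).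
    by rewrite -zE scalerDr scalerA [h *: u + p]addrC [_ + p]addrC addrA.
  rewrite /GRing.scale /= !mulrA mulVf // mul1r -mulrBr normrM.
  have : `|'D_e f p - 'D_e f (p + h *: u + z *: e)| < eps / (`|x| + 1).
    apply: hd; rewrite -ball_normE /ball_ /=.
    have -> : p - (p + h *: u + z *: e) = - (h *: u + z *: e).
      by rewrite -[p + _ + _]addrA opprD addrA subrr add0r.
    rewrite normrN.
    apply: (le_lt_trans (ler_normD _ _)); rewrite !normrZ.
    have : `|h| * `|u| + `|z| * `|e| <= `|h| * (`|u| + `|x| * `|e| + 1).
      have : `|z| * `|e| <= `|h| * `|x| * `|e| by rewrite ler_wpM2r // -normrM.
      by have := normr_ge0 h; nra.
    move=> /le_lt_trans; apply.
    by rewrite -ltr_pdivlMr.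
  move=> hlt2; rewrite (le_trans (ler_wpM2l (normr_ge0 x) (ltW hlt2))) //.
  rewrite mulrCA ger_pMr // ler_pdivrMr // mul1r.
  by rewrite lerDl.
have lim : (fun h : R => h^-1 *: ((f \o shift p) (h *: (u + x *: e)) - f p)) @ 0^'
    --> 'D_u f p + x * 'D_e f p.
  rewrite (_ : (fun h => _) = (fun h => q2 h + q1 h)); first exact: (cvgD lim2 lim1).
  apply/funext => h; rewrite /q1 /q2 /= -scalerDr; congr (_ *: _).
  by rewrite [RHS]addrC addrA subrK.
by split; [apply: cvgP lim | apply: cvg_lim lim].
Unshelve. all: by end_near. Qed.

Lemma is_derive_translate f p e v : derivable f (p + v) e ->
  is_derive p e (fun y => f (y + v)) ('D_e f (p + v)).
Proof.
have quot : (fun h : R => h^-1 *: (((fun y => f (y + v)) \o shift p) (h *: e)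
    - f (p + v))) = (fun h => h^-1 *: ((f \o shift (p + v)) (h *: e) - f (p + v))).
  by apply/funext => h /=; rewrite addrA.
by move=> df; split; rewrite /derivable /derive quot.
Qed.

End Directional.

Section SmoothFunctions.
Variables (R : realType) (n : nat).
Local Notation V := 'rV[R]_n.+1.
Local Notation delta c := (delta_mx 0 c : V).
Local Notation Ck := (@Ck R n.+1).
Implicit Types (f g : V -> R) (c : 'I_n.+1).

Lemma Ck_continuous m f : Ck m f -> continuous f.
Proof. by case: m => [|m] []. Qed.

Lemma CkS_derivable m f c p : Ck m.+1 f -> derivable f p (delta c).
Proof. by move=> [_ /(_ c)[]]. Qed.

Lemma CkS_partial m f c : Ck m.+1 f -> Ck m (fun p => 'D_(delta c) f p).
Proof. by move=> [_ /(_ c)[]]. Qed.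

(** [Ck] speaks of coordinate directions only; every other direction is reached by adding basis
    vectors one by one with [derive_add]. *)
Lemma Ck_is_derive m f p v : Ck m.+1 f ->
  is_derive p v f (\sum_c v 0 c * 'D_(delta c) f p).
Proof.
move=> hf; rewrite [X in is_derive _ X](row_sum_delta v).
elim: (index_enum _) => [|c r IH]; first by rewrite !big_nil; apply: is_derive0.
rewrite !big_cons addrC [X in is_derive _ _ _ X]addrC.
apply: derive_add IH; first by move=> q; apply: CkS_derivable hf.
exact: Ck_continuous (@CkS_partial _ _ c hf) p.
Qed.

Lemma CkW m f : Ck m.+1 f -> Ck m f.
Proof.
elim: m f => [|m IH] f [cf hf]; first by split.
by split=> // c; have [df pf] := hf c; split=> //; apply: IH.
Qed.

Lemma Ck_cst m (x : R) : Ck m (fun=> x).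
Proof.
elim: m x => [|m IH] x; split=> //; [exact: cst_continuous|exact: cst_continuous|].
move=> c; split=> [p|]; first exact: derivable_cst.
rewrite [X in Ck _ X](_ : _ = fun=> 0); first exact: IH.
by apply/funext => p; rewrite derive_cst.
Qed.

Lemma Ck_add m f g : Ck m f -> Ck m g -> Ck m (f + g).
Proof.
elim: m f g => [|m IH] f g hf hg; split=> //;
  try by move=> p; apply: continuousD; [apply: (Ck_continuous hf) | apply: (Ck_continuous hg)].
move=> c; have df p := @CkS_derivable _ _ c p hf; have dg p := @CkS_derivable _ _ c p hg.
split=> [p|]; first exact: derivableD.
rewrite [X in Ck _ X](_ : _ =
  (fun p => 'D_(delta c) f p) + (fun p => 'D_(delta c) g p)).
  by apply: IH; apply: CkS_partial.
by apply/funext => p; rewrite deriveD.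
Qed.

Lemma Ck_mul m f g : Ck m f -> Ck m g -> Ck m (f * g).
Proof.
elim: m f g => [|m IH] f g hf hg; split=> //;
  try by move=> p; apply: continuousM; [apply: (Ck_continuous hf) | apply: (Ck_continuous hg)].
move=> c; have df p := @CkS_derivable _ _ c p hf; have dg p := @CkS_derivable _ _ c p hg.
split=> [p|]; first exact: derivableM.
rewrite [X in Ck _ X](_ : _ =
  f * (fun p => 'D_(delta c) g p) + g * (fun p => 'D_(delta c) f p)).
  by apply: Ck_add; apply: IH;
    [exact: CkW hf | exact: CkS_partial hg | exact: CkW hg | exact: CkS_partial hf].
by apply/funext => p; rewrite deriveM.
Qed.

Lemma is_derive_coord c (p v : V) : is_derive p v (fun p : V => p 0 c) (v 0 c).
Proof.
have quot : (fun h : R => h^-1 *: (((fun p : V => p 0 c) \o shift p) (h *: v) - p 0 c))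
    @ 0^' --> v 0 c.
  apply: cvg_near_cst; near=> h.
  have h0 : h != 0 by near: h; apply: nbhs_dnbhs_neq.
  by rewrite /= !mxE addrK /GRing.scale /= mulrA mulVf // mul1r.
by split; [apply: cvgP quot | apply: cvg_lim quot].
Unshelve. all: by end_near. Qed.

Lemma Ck_coord m c : Ck m (fun p => p 0 c).
Proof.
case: m => [|m]; split=> //; try by move=> p; apply: coord_continuous.
move=> a; split=> [p|]; first by have [] := is_derive_coord c p (delta a).
rewrite [X in Ck _ X](_ : _ = fun=> (delta a) 0 c); first exact: Ck_cst.
by apply/funext => p; have [] := is_derive_coord c p (delta a).
Qed.

(** The mean value theorem along a for y |-> f(y + h b) - f(y), then along b for the derivative of f
    along a. *)
Lemma second_difference m f a b p (h : R) : Ck m.+2 f ->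
  exists2 y : V, `|p - y| <= `|h| * (`|delta a| + `|delta b|) &
  f (p + h *: delta a + h *: delta b) - f (p + h *: delta a) - (f (p + h *: delta b) - f p) =
  h * (h * 'D_(delta b) (fun p => 'D_(delta a) f p) y).
Proof.
move=> hf; pose g (y : V) := f (y + h *: delta b) - f y.
have df c q : derivable f q (delta c) by apply: CkS_derivable hf.
have dg q : is_derive q (delta a) g
    ('D_(delta a) f (q + h *: delta b) - 'D_(delta a) f q).
  apply: is_deriveB; first exact: is_derive_translate.
  exact: derivableP.
have [|x xh gE] := @mvt_direction R _ g (delta a) p h.
  by move=> q; have [] := dg q.
have [|z zh fE] := @mvt_direction R _ (fun p => 'D_(delta a) f p) (delta b)
    (p + x *: delta a) h.
  by move=> q; exact: (@CkS_derivable m _ b q (@CkS_partial m.+1 f a hf)).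
exists (p + x *: delta a + z *: delta b).
  rewrite -addrA opprD addrA subrr add0r normrN (le_trans (ler_normD _ _)) //.
  by rewrite mulrDr !normrZ lerD // ler_wpM2r.
by rewrite -fE; have [_ <-] := dg (p + x *: delta a).
Qed.

Lemma ltr_dist_half (x y z e : R) : `|x - z| < e / 2 -> `|y - z| < e / 2 -> `|x - y| < e.
Proof.
move=> xz yz; rewrite (_ : x - y = (x - z) - (y - z)); last by ring.
by rewrite (le_lt_trans (ler_normB _ _)) // (splitr e) ltrD.
Qed.

(* Both mixed derivatives are limits of the same second difference quotient. *)
Lemma partialC m f a b p : Ck m.+2 f ->
  'D_(delta a) (fun p => 'D_(delta b) f p) p = 'D_(delta b) (fun p => 'D_(delta a) f p) p.
Proof.
move=> hf; set F1 := fun p => 'D_(delta b) (fun p => 'D_(delta a) f p) p.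
set F2 := fun p => 'D_(delta a) (fun p => 'D_(delta b) f p) p.
have c1 : continuous F1 by apply: (@Ck_continuous m); do 2!apply: CkS_partial.
have c2 : continuous F2 by apply: (@Ck_continuous m); do 2!apply: CkS_partial.
apply/eqP; rewrite -subr_eq0 -normr_eq0; set e := `|_|; apply: contraT => n0.
have e0 : 0 < e by rewrite lt_def n0 normr_ge0.
have e2 : 0 < e / 2 by rewrite divr_gt0.
have /cvgrPdist_lt/(_ _ e2)/nbhs_ballP[d1 /= d1_gt0 h1] := c1 p.
have /cvgrPdist_lt/(_ _ e2)/nbhs_ballP[d2 /= d2_gt0 h2] := c2 p.
(* Scales h so that the intermediate points of both expansions fall into both balls. *)
pose K := `|delta a| + `|delta b| + 1.
have K0 : 0 < K by rewrite ltr_wpDl // addr_ge0.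
pose h := Num.min d1 d2 / K.
have h0 : 0 < h by rewrite divr_gt0 // lt_min d1_gt0.
have hK x : x <= `|h| * (`|delta a| + `|delta b|) -> x < Num.min d1 d2.
  move=> /le_lt_trans; apply; rewrite gtr0_norm // -[ltRHS](divfK (lt0r_neq0 K0)) -/h.
  by rewrite ltr_pM2l // /K ltrDl.
have [y1 /hK + E1] := second_difference a b p h hf.
have [y2 + E2] := second_difference b a p h hf.
rewrite [`|delta b| + _]addrC => /hK; rewrite !lt_min => /andP[_ y2d] /andP[y1d _].
have F12 : F1 y1 = F2 y2.
  have {E1 E2} : h * (h * F1 y1) = h * (h * F2 y2).
    by rewrite -[LHS]E1 -[RHS]E2 [p + h *: delta b + _]addrAC !opprB addrACA [RHS]addrACA
      [- f (p + h *: delta a) - _]addrC.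
  by move: (F1 y1) (F2 y2) => x1 x2 /(mulfI (lt0r_neq0 h0))/(mulfI (lt0r_neq0 h0)).
have := h1 y1; rewrite -ball_normE /ball_ /= => /(_ y1d).
have := h2 y2; rewrite -ball_normE /ball_ /= => /(_ y2d).
rewrite F12 -/(F1 p) -/(F2 p) => l2 l1; suff : e < e by rewrite ltxx.
exact: (ltr_dist_half l2 l1).
Qed.

Lemma partial0_cst m f : Ck m.+1 f -> (forall c p, 'D_(delta c) f p = 0) ->
  forall p, f p = f 0.
Proof.
move=> hf f0 p; have df q := Ck_is_derive q p hf.
have [|x _] := @mvt_direction R V f p 0 1; first by move=> q; have [] := df q.
rewrite scale1r !add0r mul1r; have [_ ->] := df (x *: p).
by rewrite big1 => [/eqP|c _]; [rewrite subr_eq0 => /eqP | rewrite f0 mulr0].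
Qed.

End SmoothFunctions.

(** * Smooth functions as an instance of [calculus] *)

Section SmoothCalculus.
Variables (R : realType) (n : nat).
Local Notation V := 'rV[R]_n.+1.
Local Notation delta c := (delta_mx 0 c : V).

Definition smooth_pred : {pred V -> R} := fun f => `[< forall m, Ck m f >].

Lemma smooth_predP f : reflect (forall m, Ck m f) (f \in smooth_pred).
Proof. by apply: (iffP idP) => [/asboolP|?]; last apply/asboolP. Qed.

Fact smooth_subring : subring_closed smooth_pred.
Proof.
have smM (f g : V -> R) : f \in smooth_pred -> g \in smooth_pred -> f * g \in smooth_pred.
  by move=> /smooth_predP sf /smooth_predP sg; apply/smooth_predP => m; apply: Ck_mul.
split=> //; first by apply/smooth_predP => m; exact: (@Ck_cst R n m 1).
move=> f g /smooth_predP sf sg; apply/smooth_predP => m; apply: Ck_add => //.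
apply/smooth_predP: m; rewrite -mulN1r; apply: smM => //.
by apply/smooth_predP => m; exact: (@Ck_cst R n m (-1)).
Qed.
HB.instance Definition _ := GRing.isSubringClosed.Build (V -> R) smooth_pred smooth_subring.

Record smoothfun := SmoothFun { smooth_fun :> V -> R; _ : smooth_fun \in smooth_pred }.
HB.instance Definition _ := [isSub for smooth_fun].
HB.instance Definition _ := [Choice of smoothfun by <:].
HB.instance Definition _ := [SubChoice_isSubComNzRing of smoothfun by <:].

Lemma smoothfunP (f : smoothfun) m : Ck m f.
Proof. by case: f => f /= /smooth_predP. Qed.

Definition to_smooth (f : V -> R) (sf : forall m, Ck m f) : smoothfun :=
  SmoothFun (introT (smooth_predP f) sf).

(** Scaling is multiplication by a constant function, so smoothness comes from the subring
    structure. *)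
Definition smooth_scale (x : R) (f : smoothfun) : smoothfun :=
  to_smooth (fun m => @Ck_cst R n m x) * f.

Lemma smooth_scaleE x f p : smooth_scale x f p = x * f p.
Proof. by []. Qed.

Lemma smoothP (f g : smoothfun) : (forall p, f p = g p) -> f = g.
Proof. by move=> fg; apply: val_inj; apply/funext. Qed.

Fact smooth_scaleA a b v : smooth_scale a (smooth_scale b v) = smooth_scale (a * b) v.
Proof. by apply: smoothP => p; rewrite !smooth_scaleE mulrA. Qed.

Fact smooth_scale1 : left_id 1 smooth_scale.
Proof. by move=> v; apply: smoothP => p; rewrite smooth_scaleE mul1r. Qed.

Fact smooth_scaleDr : right_distributive smooth_scale +%R.
Proof. by move=> a u v; rewrite /smooth_scale mulrDr. Qed.

Fact smooth_scaleDl v : {morph smooth_scale^~ v : a b / a + b}.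
Proof. by move=> a b; apply: smoothP => p; rewrite smooth_scaleE mulrDl. Qed.

HB.instance Definition _ := GRing.Zmodule_isLmodule.Build R smoothfun
  smooth_scaleA smooth_scale1 smooth_scaleDr smooth_scaleDl.

Fact smooth_scaleAl (a : R) (u v : smoothfun) : a *: (u * v) = a *: u * v.
Proof. exact: mulrA. Qed.

HB.instance Definition _ := GRing.Lmodule_isLalgebra.Build R smoothfun smooth_scaleAl.
HB.instance Definition _ := GRing.Lalgebra_isComAlgebra.Build R smoothfun.

Definition smooth_pd c (f : smoothfun) : smoothfun :=
  to_smooth (fun m => @CkS_partial R n m f c (smoothfunP f m.+1)).

Lemma smooth_derivable (f : smoothfun) p v : is_derive p v f (\sum_c v 0 c * smooth_pd c f p).
Proof. exact: Ck_is_derive (smoothfunP f 1). Qed.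

Fact smooth_pd_linear c : linear (smooth_pd c).
Proof.
move=> a f g; apply: smoothP => p.
have df (h : smoothfun) : derivable h p (delta c) by have [] := smooth_derivable h p (delta c).
have -> : smooth_pd c (a *: f + g) p = 'D_(delta c) ((fun=> a) * (f : V -> R) + (g : V -> R)) p by [].
rewrite deriveD //; last by apply: derivableM => //; apply: derivable_cst.
by rewrite deriveM // ?derive_cst ?scaler0 ?addr0 //; apply: derivable_cst.
Qed.
HB.instance Definition _ c := GRing.isLinear.Build R smoothfun smoothfun *:%R
  (smooth_pd c) (smooth_pd_linear c).

Definition smooth_coord c : smoothfun := to_smooth (fun m => @Ck_coord R n m c).

Definition smooth_ev (f : smoothfun) : R^o := f 0.
Fact smooth_ev_linear : linear smooth_ev.
Proof. by []. Qed.
HB.instance Definition _ := GRing.isLinear.Build R smoothfun R^o *:%R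
  smooth_ev smooth_ev_linear.

Fact smooth_pdM c f g : smooth_pd c (f * g) = smooth_pd c f * g + f * smooth_pd c g.
Proof.
apply: smoothP => p.
have df (h : smoothfun) : derivable h p (delta c) by have [] := smooth_derivable h p (delta c).
have -> : smooth_pd c (f * g) p = 'D_(delta c) ((f : V -> R) * (g : V -> R)) p by [].
rewrite deriveM // addrC; congr (_ + _).
by rewrite /GRing.scale /= mulrC.
Qed.

Fact smooth_pdC a c f : smooth_pd a (smooth_pd c f) = smooth_pd c (smooth_pd a f).
Proof. by apply: smoothP => p; apply: (@partialC _ _ 0) (smoothfunP f 2). Qed.

Fact smooth_pd_coord a c : smooth_pd a (smooth_coord c) = (a == c)%:R.
Proof.
apply: smoothP => p; have [_ /= ->] := is_derive_coord c p (delta a).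
by rewrite mxE eqxx eq_sym; case: (a == c).
Qed.

Fact smooth_ev_coord c : smooth_ev (smooth_coord c) = 0.
Proof. by rewrite /smooth_ev /= mxE. Qed.

Fact smooth_pd_const f : (forall c, smooth_pd c f = 0) -> f = (smooth_ev f)%:A.
Proof.
move=> f0; apply: smoothP => p.
rewrite (partial0_cst (smoothfunP f 1)) => [|c x]; first by rewrite /= -[RHS]/(_ * 1) mulr1.
by have /(congr1 (fun h : smoothfun => h x)) := f0 c.
Qed.

Definition smooth_calculus : calculus R n.+1 :=
  @Calculus R n.+1 smoothfun smooth_pd smooth_coord smooth_ev smooth_pdM smooth_pdC
    smooth_pd_coord (fun f g => erefl) erefl smooth_ev_coord smooth_pd_const.

End SmoothCalculus.

(** * From components in the frame to vector fields *)

Section SmoothFields.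
Variables (R : realType) (n : nat) (W : grading R n).
Local Notation V := 'rV[R]_n.+1.
Local Notation A := (smooth_calculus R n).
Local Notation field := ('I_n.+1 -> A).
Local Notation M := (shift_mx W).
Implicit Types (t u : field) (p v : V) (f g : A).

Definition at_point p (f : smoothfun R n) : R^o := f p.

Fact at_point_linear p : linear (at_point p).
Proof. by []. Qed.

Fact at_pointM0 p (f g : smoothfun R n) : at_point p (f * g) = at_point p f * at_point p g.
Proof. by []. Qed.

HB.instance Definition _ p := GRing.isLinear.Build R (smoothfun R n) R^o *:%R
  (at_point p) (at_point_linear p).

Definition eval p : {linear A -> R^o} := at_point p.

Lemma evalM p f g : eval p (f * g) = eval p f * eval p g.
Proof. exact: at_pointM0. Qed.

Lemma evalZ p x f : eval p (x *: f) = x * eval p f.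
Proof. exact: linearZ. Qed.

Lemma eval_inj f g : (forall p, eval p f = eval p g) -> f = g.
Proof. exact: smoothP. Qed.

Lemma eval_coord p c : eval p (coordf A c) = p 0 c.
Proof. by []. Qed.

Lemma eval_ev0 f : eval 0 f = ev0 A f.
Proof. by []. Qed.

Lemma eval_derive p v f : is_derive p v (fun p => eval p f) (\sum_a v 0 a * eval p (pd A a f)).
Proof. exact: smooth_derivable. Qed.

Lemma eval_Ck m f : Ck m (fun p => eval p f).
Proof. exact: smoothfunP. Qed.

Lemma eval_surj (h : V -> R) : (forall m, Ck m h) -> exists f, forall p, eval p f = h p.
Proof. by move=> sh; exists (to_smooth sh). Qed.

Local Opaque eval.

Definition field_of t : V -> V := locked (fun p => \row_c eval p (coords W t c)).

Lemma field_of_coord t p c : field_of t p 0 c = eval p (coords W t c).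
Proof. by rewrite /field_of -lock mxE. Qed.

Lemma mulM_coord_eval c p : eval p (mulM W (coordf A) c) = (p *m M) 0 c.
Proof.
rewrite /mulM (raddf_sum (eval p)) mxE; apply: eq_bigr => a _ /=.
by rewrite evalZ eval_coord mulrC.
Qed.

Lemma coords_eval t c p : eval p (coords W t c) =
  eval p (t c) + eval p (t ord0) * (p *m M) 0 c.
Proof. by rewrite /coords (raddfD (eval p)) /= evalM mulM_coord_eval. Qed.

Lemma coords_linear (x : R) t u c :
  coords W (x *: t + u) c = x *: coords W t c + coords W u c.
Proof.
rewrite /coords -[(x *: t + u) _]/(x *: t c + u c).
rewrite -[(x *: t + u) _]/(x *: t ord0 + u ord0) mulrDl scalerDr -scalerAl.
by rewrite addrACA.
Qed.

Fact field_of_linear : linear field_of.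
Proof.
move=> x t u; apply/funext => p; apply/rowP => c.
have fieldsE (F G : V -> V) : (x *: F + G) p 0 c = x * F p 0 c + G p 0 c.
  by rewrite -[(x *: F + G) p]/(x *: F p + G p) !mxE.
apply: etrans (field_of_coord _ p c) _; rewrite coords_linear linearP.
by apply: esym; rewrite fieldsE; congr (_ * _ + _); apply: field_of_coord.
Qed.
HB.instance Definition _ := GRing.isLinear.Build R field (V -> V) *:%R field_of field_of_linear.

Lemma field_of_inj : injective field_of.
Proof.
move=> t u h; apply: (@coords_inj _ _ _ W); apply/funext => c; apply: eval_inj => p.
by rewrite -!field_of_coord h.
Qed.

Lemma smooth_field_of t : smooth (field_of t).
Proof.
move=> m c; have -> : (fun p => field_of t p 0 c) = (fun p => eval p (coords W t c)).
  by apply/funext => p; rewrite field_of_coord.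
exact: eval_Ck.
Qed.

Lemma field_of_surj (S : V -> V) : smooth S -> exists t, field_of t = S.
Proof.
move=> sS; have /choice[s sE] : forall c, exists f, forall p, eval p f = S p 0 c.
  by move=> c; apply: eval_surj => m; apply: sS.
exists (fun c => s c - s ord0 * mulM W (coordf A) c).
apply/funext => p; apply/rowP => c; rewrite field_of_coord /coords mulM0 mulr0 subr0.
by rewrite subrK.
Qed.

Lemma derive_field_of t p v c : ('D_v (field_of t) p) 0 c =
  \sum_a v 0 a * eval p (pd A a (coords W t c)).
Proof.
have dc b : is_derive p v (fun p => field_of t p 0 b)
    (\sum_a v 0 a * eval p (pd A a (coords W t b))).
  have -> : (fun p => field_of t p 0 b) = (fun p => eval p (coords W t b)).
    by apply/funext => q; rewrite field_of_coord.
  exact: eval_derive.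
rewrite derive_mx ?mxE; first by have [_ ->] := dc c.
by apply/derivable_mxP => i b; rewrite ord1; have [] := dc b.
Qed.

Lemma vbrk_field_of t u : vbrk (field_of t) (field_of u) = field_of (br W t u).
Proof.
apply/funext => p; apply/rowP => c; rewrite field_of_coord coords_br.
have lie_eval (x : field) (f : A) : eval p (lie W x f) =
    \sum_a field_of x p 0 a * eval p (pd A a f).
  rewrite lieE (raddf_sum (eval p)); apply: eq_bigr => a _ /=.
  by rewrite evalM field_of_coord.
rewrite (raddfB (eval p)).
have vbrkE (F G : V -> V) : vbrk F G p 0 c = ('D_(F p) G p) 0 c - ('D_(G p) F p) 0 c.
  by rewrite /vbrk !mxE.
apply: etrans (vbrkE _ _) _.
by congr (_ - _); apply: etrans (derive_field_of _ _ _ _) _; apply: esym; apply: lie_eval.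
Qed.

(** The component along V_c of the tangent vector v at p, which undoes [coords]: V_0 at p has c-th
    coordinate (p M)_c for c != 0. *)
Definition frame_component p v c : R := v 0 c - v 0 ord0 * (p *m M) 0 c.

Lemma mulM0_eval p : (p *m M) 0 ord0 = 0.
Proof. by rewrite mxE big1 // => a _; rewrite shiftr0 mulr0. Qed.

Lemma frame_component_field_of t p c :
  frame_component p (field_of t p) c = eval p (t c).
Proof.
by rewrite /frame_component !field_of_coord !coords_eval mulM0_eval mulr0 addr0 addrK.
Qed.

(** A distribution spanned by the frame fields V_a with a in J is tested on these fields: by the
    Leibniz rule [br_frame] the coefficients of a general section contribute nothing outside J. *)
Lemma preserves_frame (P : tangent_distribution R n.+1) (J : pred 'I_n.+1) t :
  (forall p v, reflect (forall c, ~~ J c -> frame_component p v c = 0) (v \in P p)) ->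
  preserves (field_of t) P <->
  forall a c, J a -> ~~ J c -> br W (unit_field A a) t c = 0.
Proof.
move=> PJ; split=> [pres a c Ja Jc|bt T [sT PT] p].
  have sec : vsection P (field_of (unit_field A a)).
    split=> [|p]; first exact: smooth_field_of.
    apply/PJ => b Jb; rewrite frame_component_field_of /unit_field.
    by have /negbTE -> : a != b by apply: contraNneq Jb => <-.
  apply: eval_inj => p; have /PJ/(_ c Jc) := pres _ sec p.
  rewrite vbrk_field_of frame_component_field_of brN => /eqP.
  by rewrite oppr_eq0 => /eqP.
have [u uT] := field_of_surj sT; rewrite -uT vbrk_field_of; apply/PJ => c Jc.
have u0 b : ~~ J b -> u b = 0.
  move=> Jb; apply: eval_inj => x; have /PJ/(_ b Jb) := PT x.
  by rewrite -uT frame_component_field_of.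
rewrite frame_component_field_of brN fctE br_frame u0 // linear0 subr0 big1 ?oppr0 // => b _.
by have [Jb|Jb] := boolP (J b); [rewrite bt // mulr0 | rewrite u0 // mul0r].
Qed.

End SmoothFields.

(** * The distributions of the two kinds *)

Section CoordinateFields.
Variables (R : realType) (k l : nat).
Local Notation V := 'rV[R]_(k + l).+1.
Local Notation down := (@Defs.down R k l).
Implicit Types (p v : V) (c : 'I_(k + l).+1).

Lemma down0 p : down p 0 ord0 = 0.
Proof. exact: down_ix. Qed.

Lemma fieldX_coord p c : fieldX p 0 c = (c == ord0)%:R + down p 0 c.
Proof. by rewrite /fieldX mxE [eX _ _ _ _ _]mxE eqxx. Qed.

Lemma line_coord (u v : V) c : u 0 c = 0 -> v \in <[u]>%VS -> v 0 c = 0.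
Proof. by move=> uc /vlineP[x ->]; rewrite mxE uc mulr0. Qed.

Lemma sum_line_coord (F : nat -> V) (a b : nat) v c :
  (forall i, (a <= i < b)%N -> F i 0 c = 0) ->
  v \in (\sum_(a <= i < b) <[F i]>)%VS -> v 0 c = 0.
Proof.
move=> Fc; rewrite big_nat; move: v; pose K (U : {vspace V}) := forall v, v \in U -> v 0 c = 0.
apply: (big_ind K) => [v|U U' hU hU' v|i hi v].
- by rewrite memv0 => /eqP ->; rewrite mxE.
- by move=> /memv_addP[x /hU xc [y /hU' yc ->]]; rewrite mxE xc yc addr0.
- by apply: line_coord; apply: Fc.
Qed.

Lemma mem_sum_line (F : nat -> V) (a b i : nat) : (a <= i < b)%N ->
  F i \in (\sum_(a <= i < b) <[F i]>)%VS.
Proof.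
move=> /andP[ai ib]; rewrite big_geq_mkord.
have := @sumv_sup _ _ _ (Ordinal ib) (fun i : 'I_b => (a <= i)%N) <[F i]>%VS
  (fun i : 'I_b => <[F i]>%VS) ai (subvv _).
by move/subvP; apply; apply: memv_line.
Qed.

Lemma eY_coord i c : (i < k)%N -> eY R k l i 0 c = (c == i.+1 :> nat)%:R.
Proof. by move=> ik; rewrite mxE eqxx /= /iy -val_eqE /= inordK // ltnS; lia. Qed.

Lemma eZ_coord j c : (j < l)%N -> eZ R k l j 0 c = (c == (k + j).+1 :> nat)%:R.
Proof. by move=> jl; rewrite mxE eqxx /= /iz -val_eqE /= inordK // ltnS; lia. Qed.

Lemma delta_eY c : (0 < c <= k)%N -> delta_mx 0 c = eY R k l c.-1.
Proof.
move=> hc; apply/rowP => b; rewrite eY_coord; last by lia.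
by rewrite mxE eqxx -val_eqE /= prednK //; lia.
Qed.

Lemma delta_eZ c : (k < c)%N -> delta_mx 0 c = eZ R k l (c - k.+1).
Proof.
have := ltn_ord c => cl hc; apply/rowP => b; rewrite eZ_coord; last by lia.
by rewrite mxE eqxx -val_eqE /=; congr (_ == _)%:R; lia.
Qed.

End CoordinateFields.

Section Distributions.
Variables (R : realType) (k l s : nat).
Hypothesis k_ge2 : (2 <= k)%N.
Hypothesis kl : (k < l)%N.
Variables (k_gt0 : (0 < k)%N) (l_gt0 : (0 < l)%N) (ks : (k <= s)%N).
Local Notation W := (nil_grading R k_gt0 l_gt0 ks).
Local Notation V := 'rV[R]_(k + l).+1.
Local Notation down := (@Defs.down R k l).
Implicit Types (p v : V) (c : 'I_(k + l).+1).

Lemma frame_componentE p v c : frame_component W p v c = v 0 c - v 0 ord0 * down p 0 c.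
Proof. by rewrite /frame_component -down_mxE. Qed.

Lemma distXP p v :
  reflect (forall c, ~~ (c == ord0) -> frame_component W p v c = 0) (v \in distX p).
Proof.
apply: (iffP (vlineP _ _)) => [[x ->] c /negbTE c0|h].
  have E b : (x *: fieldX p) 0 b = x * fieldX p 0 b by rewrite mxE.
  rewrite frame_componentE !E !fieldX_coord c0 eqxx down0.
  by rewrite add0r addr0 mulr1 subrr.
exists (v 0 ord0); apply/rowP => c; rewrite mxE fieldX_coord.
have [->|c0] := eqVneq c ord0; first by rewrite down0 addr0 mulr1.
by have := h c c0; rewrite frame_componentE add0r => /eqP; rewrite subr_eq0 => /eqP.
Qed.

(** The excluded indices 0, 1 and k + 1 are those of x, y_0 and z_0. *)
Definition in_F1 c := [&& c != 0%N :> nat, c != 1%N :> nat & c != k.+1 :> nat].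

Lemma distF1P p v :
  reflect (forall c, ~~ in_F1 c -> frame_component W p v c = 0) (v \in @distF1 R k l p).
Proof.
apply: (iffP idP) => [vF c hc|h].
  have v0 b : ~~ in_F1 b -> v 0 b = 0.
    move=> hb; move: vF => /memv_addP[y yF [z zF ->]]; rewrite mxE.
    rewrite (sum_line_coord (c := b) _ yF); last first.
      move=> i hi; rewrite eY_coord; last by lia.
      by have -> : (b == i.+1 :> nat) = false by move: hb; rewrite /in_F1; lia.
    rewrite (sum_line_coord (c := b) _ zF) ?addr0 // => i hi.
    rewrite eZ_coord; last by lia.
    by have -> : (b == (k + i).+1 :> nat) = false by move: hb; rewrite /in_F1; lia.
  by rewrite frame_componentE !v0 ?mul0r ?subrr // subr0 v0.
rewrite [v]row_sum_delta; apply: memv_suml => c _.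
have v0 : v 0 ord0 = 0.
  by have := h ord0 isT; rewrite frame_componentE down0 mulr0 subr0.
have [hc|hc] := boolP (in_F1 c); last first.
  by have := h c hc; rewrite frame_componentE v0 mul0r subr0 => ->; rewrite scale0r mem0v.
apply: memvZ; have [ck|ck] := leqP c k.
  rewrite delta_eY; last by move: hc; rewrite /in_F1; lia.
  apply: (subvP (addvSl _ _)); apply: (mem_sum_line (eY R k l)).
  by move: hc; rewrite /in_F1; lia.
rewrite delta_eZ //; apply: (subvP (addvSr _ _)); apply: (mem_sum_line (eZ R k l)).
by have := ltn_ord c; move: hc; rewrite /in_F1; lia.
Qed.

Lemma distDP p v :
  reflect (forall c, ~~ last_index c -> frame_component W p v c = 0) (v \in @distD R k l p).
Proof.
apply: (iffP idP) => [|h].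
  move=> /memv_addP[y /memv_addP[x /vlineP[a ->] [y' /vlineP[b ->] ->]] [z /vlineP[d ->] ->]].
  move=> c hc; rewrite frame_componentE.
  have Y0 e : ~~ last_index e || (e == ord0) -> eY R k l k.-1 0 e = 0.
    rewrite eY_coord; last by lia.
    rewrite /last_index -val_eqE /= => he.
    by have -> : (e == k.-1.+1 :> nat) = false by lia.
  have Z0 e : ~~ last_index e || (e == ord0) -> eZ R k l l.-1 0 e = 0.
    rewrite eZ_coord; last by lia.
    rewrite /last_index -val_eqE /= => he.
    by have -> : (e == (k + l.-1).+1 :> nat) = false by lia.
  have ve e : ~~ last_index e || (e == ord0) ->
      (a *: fieldX p + b *: eY R k l k.-1 + d *: eZ R k l l.-1) 0 e = a * fieldX p 0 e.
    move=> he; rewrite mxE [X in X + _]mxE [X in _ + X + _]mxE [X in _ + X]mxE Y0 // Z0 //.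
    by rewrite !mulr0 !addr0 mxE.
  rewrite !ve ?hc ?eqxx ?orbT // !fieldX_coord eqxx down0 addr0 mulr1.
  have /negbTE -> : c != ord0 by move: hc; rewrite /last_index -val_eqE /=; lia.
  by rewrite add0r subrr.
have -> : v = v 0 ord0 *: fieldX p + v 0 (inord k) *: eY R k l k.-1
     + v 0 (inord (k + l)) *: eZ R k l l.-1.
  apply/rowP => c; rewrite mxE [X in X + _]mxE [X in _ = X + _ + _]mxE.
  rewrite [X in _ = _ + X + _]mxE [X in _ = _ + X]mxE fieldX_coord.
  have -> : eY R k l k.-1 0 c = (c == k :> nat)%:R.
    by rewrite eY_coord; [congr (_ == _)%:R | ]; lia.
  have -> : eZ R k l l.-1 0 c = (c == (k + l)%N :> nat)%:R.
    by rewrite eZ_coord; [congr (_ == _)%:R | ]; lia.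
  have [hc|hc] := boolP (last_index c); last first.
    have := h c hc; rewrite frame_componentE => /eqP; rewrite subr_eq0 => /eqP ->.
    move: hc; rewrite /last_index -[c == ord0]/(c == 0%N :> nat) !negb_or.
    by move=> /and3P[/negbTE -> /negbTE -> /negbTE ->]; rewrite !mulr0 !addr0 add0r.
  rewrite (down_coord k_gt0 l_gt0 ks) hc addr0.
  have inordE i : (i <= k + l)%N -> c = i :> nat -> c = inord i.
    by move=> hi ci; apply: val_inj; rewrite /= inordK.
  move: (hc); rewrite /last_index => /or3P[]/eqP ci.
  - rewrite -[c == ord0]/(c == 0%N :> nat) ci eqxx /=.
    have -> : (0 == k)%N = false by lia.
    have -> : (0 == k + l)%N = false by lia.
    by rewrite !mulr0 !addr0 mulr1; congr (v 0 _); apply: val_inj.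
  - rewrite -[c == ord0]/(c == 0%N :> nat) ci eqxx.
    have -> : (k == 0)%N = false by lia.
    have -> : (k == k + l)%N = false by lia.
    by rewrite !mulr0 addr0 add0r mulr1 -inordE //; lia.
  - rewrite -[c == ord0]/(c == 0%N :> nat) ci eqxx.
    have -> : (k + l == 0)%N = false by lia.
    have -> : (k + l == k)%N = false by lia.
    by rewrite !mulr0 !add0r mulr1 -inordE.
apply: memv_add; last by apply: memvZ; apply: memv_line.
by apply: memv_add; apply: memvZ; apply: memv_line.
Qed.

End Distributions.

(** * The weight filtration and polynomiality of symmetries *)

Section FilteredSymmetries.
Variables (R : realType) (k l s : nat) (A : calculus R (k + l).+1).
Hypothesis k_ge2 : (2 <= k)%N.
Hypothesis kl : (k < l)%N.
Variables (k_gt0 : (0 < k)%N) (l_gt0 : (0 < l)%N) (ks : (k <= s)%N).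
Local Notation W := (nil_grading R k_gt0 l_gt0 ks).
Local Notation w := (weight W).
Local Notation M := (shift_mx W).
Local Notation D := (@pd R (k + l).+1 A).
Local Notation X := (@frame R (k + l) A W ord0).
Implicit Types (a b c e : 'I_(k + l).+1).
Variable t : 'I_(k + l).+1 -> A.

Definition filtered := forall a c, bad W a c -> br W (unit_field A a) t c = 0.
Definition preserves_comp (J : pred 'I_(k + l).+1) :=
  forall a c, J a -> ~~ J c -> br W (unit_field A a) t c = 0.
Definition triangular := forall a c, a != ord0 -> c != ord0 -> (w a < w c)%N ->
  D a (t c) = - (M a c *: t ord0).

Lemma br_unit_pd a c : a != ord0 ->
  br W (unit_field A a) t c = D a (t c) + M a c *: t ord0.
Proof. by move=> a0; rewrite br_unit (negbTE a0) mul0r subr0 frameE // mulr_algl. Qed.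

Lemma filteredE : filtered <-> preserves_comp (pred1 ord0) /\ triangular.
Proof.
split=> [h|[h0 h1] a c].
  split=> [a c /eqP-> c0|a c a0 c0 wac]; first by apply: h; rewrite /bad c0 eqxx.
  have := h a c; rewrite /bad c0 wac orbT => /(_ isT); rewrite br_unit_pd // => /eqP.
  by rewrite addr_eq0 => /eqP.
rewrite /bad => /andP[c0 /orP[/eqP->|wac]]; first exact: h0.
have [->|a0] := eqVneq a ord0; first exact: h0.
by rewrite br_unit_pd // h1 // addNr.
Qed.

Lemma X_preserves c : preserves_comp (pred1 ord0) -> c != ord0 -> X (t c) = mulM W t c.
Proof.
move=> h c0; have := h ord0 c (eqxx _) c0.
by rewrite br_unit shift0r scale0r mul0r addr0 eqxx mul1r => /eqP; rewrite subr_eq0 => /eqP.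
Qed.

Lemma shift_coord a c : M a c = (~~ last_index c && (a == c.+1 :> nat))%:R.
Proof. exact: (down_mx_coord R k_gt0 l_gt0 ks). Qed.

Lemma weight_coord c : w c = if c == 0%N :> nat then 1%N
  else if (c <= k)%N then (s.+1 - c)%N else (l - (c - k.+1))%N.
Proof.
rewrite /= /nil_weight /nil_deg; have := ltn_ord c.
by case: ifP => // h1; case: ifP => h2; lia.
Qed.

Lemma weight_pred a c : M a c != 0 -> w c = (w a).+1.
Proof. exact: weight_shift. Qed.

(** For s = l both y_0 and z_0 have weight l, and every vertical index of smaller weight lies in
    F_1, which settles c = y_0, z_0. The induction then climbs the chains, since t_c = X t_(c-1), by
    commuting D_a with X. *)
Lemma triangular_F1 : s = l -> preserves_comp (pred1 ord0) -> preserves_comp (@in_F1 k l) ->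
  triangular.
Proof.
move=> sl h0 h1.
suff h j a c : (c <= j)%N -> a != ord0 -> c != ord0 -> (w a < w c)%N ->
    D a (t c) = - (M a c *: t ord0) by move=> a c; apply: (h c).
elim: j a c => [|j IH] a c; first by rewrite leqn0 => /eqP c0 _; rewrite -val_eqE /= c0.
move=> cj a0 c0 wac; have c0' : c != 0%N :> nat by [].
have a0' : a != 0%N :> nat by [].
have [Fc|Fc] := boolP (in_F1 c); last first.
  have Fa : in_F1 a.
    move: wac Fc; rewrite /in_F1 !weight_coord sl; have := ltn_ord a; have := ltn_ord c.
    by do 4?case: ifP; lia.
  by have := h1 a c Fa Fc; rewrite br_unit_pd // => /eqP; rewrite addr_eq0 => /eqP.
pose c' : 'I_(k + l).+1 := inord c.-1.
have c'v : c' = c.-1 :> nat by rewrite inordK //; have := ltn_ord c; lia.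
have Mc' e : M e c' = (e == c)%:R.
  rewrite shift_coord c'v prednK ?lt0n // (_ : ~~ last_index c' = true) //.
  by move: Fc; rewrite /in_F1 /last_index c'v; have := ltn_ord c; lia.
have c'0 : c' != ord0 by rewrite -val_eqE /= c'v; move: Fc; rewrite /in_F1; lia.
have tc : t c = X (t c').
  rewrite X_preserves // /mulM (bigD1 c) //= Mc' eqxx scale1r big1 ?addr0 // => e /negbTE ec.
  by rewrite Mc' ec scale0r.
have wc' : w c' = (w c).+1.
  by apply: weight_pred; rewrite Mc' eqxx oner_neq0.
have cj' : (c' <= j)%N by rewrite c'v; lia.
rewrite {1}tc pd_X IH ?wc' //; last by rewrite ltnS ltnW.
have Mac' : M a c' = 0.
  rewrite Mc'; case: eqP => // ac; by move: wac; rewrite ac ltnn.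
rewrite Mac' scale0r oppr0 linear0 add0r /pd_shift (bigD1 c) //= big1 ?addr0 => [|e ec].
  have [->|/weight_pred wca] := eqVneq (M a c) 0; first by rewrite !scale0r oppr0.
  by rewrite IH ?wc' // Mc' eqxx scale1r scalerN.
have [->|Mae] := eqVneq (M a e) 0; first by rewrite scale0r.
have we := weight_pred Mae; have e0 : e != ord0.
  by apply: contraNneq Mae => ->; rewrite shiftr0.
by rewrite IH ?wc' ?we // Mc' (negbTE ec) scale0r oppr0 scaler0.
Qed.

(** For s = k the last indices have weight 1, and D handles them directly. The induction descends in
    a instead of climbing in c, since D_a is the commutator of D_(a+1) with X. *)
Lemma triangular_D : s = k -> preserves_comp (pred1 ord0) -> preserves_comp (@last_index k l) ->
  triangular.
Proof.
move=> sk h0 h1.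
suff h j a c : (k + l - a <= j)%N -> a != ord0 -> c != ord0 -> (w a < w c)%N ->
    D a (t c) = - (M a c *: t ord0) by move=> a c; apply: (h (k + l - a)%N).
elim: j a c => [|j IH] a c aj a0 c0 wac;
  have c0' : c != 0%N :> nat by []; have a0' : a != 0%N :> nat by [].
  have la : last_index a by rewrite /last_index; have := ltn_ord a; lia.
  have lc : ~~ last_index c.
    move: wac la; rewrite /last_index !weight_coord sk; have := ltn_ord a; have := ltn_ord c.
    by do 4?case: ifP; lia.
  by have := h1 a c la lc; rewrite br_unit_pd // => /eqP; rewrite addr_eq0 => /eqP.
have [la|la] := boolP (last_index a).
  have lc : ~~ last_index c.
    move: wac la; rewrite /last_index !weight_coord sk; have := ltn_ord a; have := ltn_ord c.
    by do 4?case: ifP; lia.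
  by have := h1 a c la lc; rewrite br_unit_pd // => /eqP; rewrite addr_eq0 => /eqP.
pose a1 : 'I_(k + l).+1 := inord a.+1.
have a1v : a1 = a.+1 :> nat.
  by rewrite inordK //; move: la; rewrite /last_index; have := ltn_ord a; lia.
have Ma1 e : M a1 e = (e == a)%:R.
  rewrite shift_coord a1v eqSS [a == e :> nat]eq_sym -[e == a]/(e == a :> nat).
  by have [/val_inj->|] := eqVneq (e : nat) a; rewrite ?la ?andbF.
have a10 : a1 != ord0 by rewrite -val_eqE /= a1v.
have wa : w a = (w a1).+1 by apply: weight_pred; rewrite Ma1 eqxx oner_neq0.
have Dashift g : pd_shift W a1 g = D a g.
  rewrite /pd_shift (bigD1 a) //= Ma1 eqxx scale1r big1 ?addr0 // => e /negbTE ea.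
  by rewrite Ma1 ea scale0r.
have aj1 : (k + l - a1 <= j)%N by rewrite a1v; lia.
have -> : D a (t c) = D a1 (X (t c)) - X (D a1 (t c)) by rewrite pd_X Dashift addrC addKr.
rewrite (IH a1 c) //; last by move: wac; rewrite wa; lia.
rewrite Ma1 (_ : (c == a) = false); last by apply: contraTF wac => /eqP ->; rewrite ltnn.
rewrite scale0r oppr0 linear0 subr0 X_preserves // /mulM (raddf_sum (D a1)) /=.
rewrite (bigD1 a) //= linearZ /= big1 ?addr0 => [|e ea].
  have [->|/weight_pred wca] := eqVneq (M a c) 0; first by rewrite !scale0r oppr0.
  by rewrite IH ?wa // Ma1 eqxx scale1r scalerN.
have [->|Mec] := eqVneq (M e c) 0; first by rewrite scale0r linear0.
have e0 : e != ord0 by apply: contraNneq Mec => ->; rewrite shift0r.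
rewrite linearZ /= IH //; last by have := weight_pred Mec; move: wac; rewrite wa; lia.
by rewrite Ma1 (negbTE ea) scale0r oppr0 scaler0.
Qed.

(** For s = k the last indices are exactly those of weight 1, so D is the first step of the
    filtration. *)
Lemma filtered_D : s = k -> filtered <->
  preserves_comp (pred1 ord0) /\ preserves_comp (@last_index k l).
Proof.
move=> sk; split=> [h|[h0 h1]]; last by apply/filteredE; split=> //; apply: triangular_D.
have /filteredE[h0 _] := h; split=> // a c la lc; apply: h.
have c0 : c != ord0 by move: lc; rewrite /last_index -val_eqE /=; lia.
rewrite /bad c0 andTb -[a == ord0]/(a == 0%N :> nat).
move: la lc; rewrite /last_index !weight_coord sk; have := ltn_ord a; have := ltn_ord c.
by do 4?case: ifP; lia.
Qed.

(** The component along X is not constrained by [bad]. That it vanishes on F_1 follows by writing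
    t_0 as a derivative of the component along y_0 or z_0. *)
Lemma filtered_F1 : s = l -> filtered <->
  preserves_comp (pred1 ord0) /\ preserves_comp (@in_F1 k l).
Proof.
move=> sl; split=> [h|[h0 h1]]; last by apply/filteredE; split=> //; apply: triangular_F1.
have /filteredE[h0 tri] := h; split=> // a c Fa Fc.
have a0 : a != ord0 by case/andP: Fa.
have wa : (w a < l)%N.
  move: Fa => /and3P[/eqP x1 /eqP x2 /eqP x3]; rewrite weight_coord sl.
  by have := ltn_ord a; case: ifP => h1; [|case: ifP => h2]; lia.
rewrite br_unit_pd //; have [->|c0] := eqVneq c ord0; last first.
  rewrite tri ?addNr //; apply: leq_trans wa _; rewrite weight_coord sl.
  move: Fc c0; rewrite /in_F1 -[c == ord0]/(c == 0%N :> nat) => Fc c0.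
  have [c1|c1] : c = 1%N :> nat \/ c = k.+1 :> nat by lia.
    by rewrite c1; case: ifP; lia.
  by rewrite c1; case: ifP; lia.
rewrite shiftr0 scale0r addr0.
(* Of the two coordinates y_0 and z_0, use the one that is not the image of the
   a-th basis vector. *)
have [e [b [e0 b0 we Mb Ma]]] : exists e b, [/\ e != ord0, b != ord0,
    w e = l, M b e = 1 & M a e = 0].
  have [a2|a2] := eqVneq (a : nat) 2%N.
    exists (inord k.+1), (inord k.+2).
    have v1 : (inord k.+1 : 'I_(k + l).+1) = k.+1 :> nat by rewrite inordK //; lia.
    have v2 : (inord k.+2 : 'I_(k + l).+1) = k.+2 :> nat by rewrite inordK //; lia.
    rewrite !shift_coord weight_coord /last_index -!val_eqE /= v1 v2 a2 sl.
    have -> : ~~ [|| k.+1 == 0%N, k.+1 == k | k.+1 == (k + l)%N] by lia.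
    rewrite eqxx; split=> //; first by case: ifP; lia.
    by have -> : (2 == k.+2)%N = false by lia.
  exists (inord 1), (inord 2).
  have v1 : (inord 1 : 'I_(k + l).+1) = 1%N :> nat by rewrite inordK //; lia.
  have v2 : (inord 2 : 'I_(k + l).+1) = 2%N :> nat by rewrite inordK //; lia.
  rewrite !shift_coord weight_coord /last_index -!val_eqE /= v1 v2 sl (negbTE a2) andbF.
  have -> : ~~ [|| 1 == 0, 1 == k | 1 == (k + l)]%N by lia.
  by split=> //; case: ifP; lia.
have wbe : (w b < w e)%N by rewrite (@weight_pred b e) // Mb oner_neq0.
have t0 : t ord0 = - D b (t e) by rewrite tri // Mb scale1r opprK.
by rewrite t0 linearN /= pdC tri ?we // Ma scale0r oppr0 linear0 oppr0.
Qed.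

Hypothesis sl : (s <= l)%N.
Hypothesis t_sym : filtered.

Lemma X_comp c : c != ord0 -> X (t c) = mulM W t c.
Proof. by have /filteredE[h _] := t_sym; apply: X_preserves. Qed.

Lemma pd_comp a c : a != ord0 -> c != ord0 -> (w a < w c)%N -> D a (t c) = - (M a c *: t ord0).
Proof. by have /filteredE[_ h] := t_sym; apply: h. Qed.

(** X replaces t_c by components of weight one less, and all weights are positive. *)
Lemma iterX_comp c : c != ord0 -> iter (w c) X (t c) = 0.
Proof.
move: {2}(w c) (erefl (w c)) => m; elim: m c => [|m IH] c wc c0.
  by have := weight_gt0 W c; rewrite wc.
rewrite wc iterSr X_comp // /mulM iterX_sum big1 // => b _.
have [->|Mbc] := eqVneq (M b c) 0; first by rewrite scale0r.
have wb : w b = m by have := weight_shift Mbc; rewrite wc => -[].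
rewrite -{1}wb IH ?scaler0 //; apply: contraNneq Mbc => ->.
by rewrite shift0r.
Qed.

Let y0 : 'I_(k + l).+1 := inord 1.
Let z0 : 'I_(k + l).+1 := inord k.+1.
Let z1 : 'I_(k + l).+1 := inord k.+2.

(** The chain of z is taken because l >= 3, so z_1 is not a last index, whereas y_1 is one when k =
    2; [top_nil2] relies on this. *)
Lemma pd_t0 : t ord0 = - D z1 (t z0).
Proof.
have z1v : z1 = k.+2 :> nat by rewrite inordK //; lia.
have z0v : z0 = k.+1 :> nat by rewrite inordK //; lia.
rewrite pd_comp ?opprK.
- rewrite shift_coord /last_index z0v z1v eqxx andbT.
  by rewrite (_ : ~~ _ = true) ?scale1r //; lia.
- by rewrite -val_eqE /= z1v.
- by rewrite -val_eqE /= z0v.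
- by rewrite !weight_coord z1v z0v /=; do 2!case: ifP; lia.
Qed.

(** D_a t_c is a constant multiple of t_0. Moreover D_a t_0 = - D_z1 (D_a t_z0) = 0, as a is not
    z_1. *)
Lemma top_nil2 a c : last_index a -> a != ord0 -> (c == y0) || (c == z0) ->
  iter 2 (D a) (t c) = 0.
Proof.
have y0v : y0 = 1%N :> nat by rewrite inordK //; lia.
have z1v : z1 = k.+2 :> nat by rewrite inordK //; lia.
have z0v : z0 = k.+1 :> nat by rewrite inordK //; lia.
move=> + a0 hc; rewrite /last_index -[_ == 0%N]/(a == ord0) (negbTE a0) /= => la.
have c0 : c != ord0 by case/orP: hc => /eqP ->; rewrite -val_eqE /= ?y0v ?z0v.
have wac c' : (c' == y0) || (c' == z0) -> (w a < w c')%N.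
  by case/orP => /eqP ->; rewrite !weight_coord ?y0v ?z0v; case/orP: la => /eqP ->; do 4?case: ifP; lia.
have Daz0 : D a (t z0) = 0.
  rewrite pd_comp ?wac ?eqxx ?orbT //; last by rewrite -val_eqE /= z0v.
  rewrite shift_coord z0v (_ : (a == k.+2 :> nat) = false) ?andbF ?scale0r ?oppr0 //.
  by case/orP: la => /eqP ->; lia.
rewrite /= (pd_comp a0 c0 (wac c hc)) linearN linearZ /= pd_t0 linearN /= pdC Daz0.
by rewrite linear0 !(oppr0, scaler0).
Qed.

(** Nilpotency starts at the last indices and descends the chains, as D_a is the commutator of
    D_(a+1) with X; each descent doubles the exponent ([nilp_shift]). *)
Lemma nilp_comp c a : (c == y0) || (c == z0) -> a != ord0 -> exists r, nilp W a r (t c).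
Proof.
move=> hc a0; have c0 : c != ord0.
  by case/orP: hc => /eqP ->; rewrite -val_eqE /= inordK //; lia.
have [m] := ubnP (k + l - a)%N; elim: m a a0 => // m IH a a0 am.
have [la|la] := boolP (last_index a).
  by exists (2 + w c)%N; apply: nilp_start; [exact: top_nil2 | exact: iterX_comp].
have ha : (a < k + l)%N.
  have := ltn_ord a; rewrite ltnS leq_eqVlt => /predU1P[e|//].
  by move: la; rewrite /last_index e eqxx !orbT.
have a1v : (inord a.+1 : 'I_(k + l).+1) = a.+1 :> nat by rewrite inordK.
have [||r hr] := IH (inord a.+1); first by rewrite -val_eqE /= a1v.
  by rewrite a1v; lia.
exists (r + r)%N; apply: nilp_shift hr => g.
rewrite /pd_shift (bigD1 a) //= shift_coord la a1v eqxx scale1r big1 ?addr0 // => b ba.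
rewrite shift_coord a1v eqSS [a == b :> nat]eq_sym (_ : (b == a :> nat) = false) ?andbF ?scale0r //.
by apply/negbTE.
Qed.

Lemma Pol_generator c : (c == y0) || (c == z0) -> Pol (t c).
Proof.
move=> hc; have c0 : c != ord0.
  by case/orP: hc => /eqP ->; rewrite -val_eqE /= inordK //; lia.
have /choice[m hm] : forall a, exists r, a != ord0 -> nilp W a r (t c).
  move=> a; have [->|a0] := eqVneq a ord0; first by exists 0%N.
  by have [r hr] := nilp_comp hc a0; exists r.
have hm0 a : a != ord0 -> iter (m a) (D a) (t c) = 0 by move=> a0; apply: (hm a a0 0%N).
have [r0 hr0] := pd0_nil hm0 (iterX_comp c0).
apply: (@nil_Pol _ _ A (enum 'I_(k + l).+1)) => [a|a]; first by rewrite mem_enum.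
have [->|a0] := eqVneq a ord0; first by exists r0.
by exists (m a); apply: hm0.
Qed.

(** The components along y_0 and z_0 generate all others: X climbs each chain, and t_0 is a
    derivative of the component along z_0. *)
Lemma Pol_comp c : Pol (t c).
Proof.
have [->|c0] := eqVneq c ord0.
  by rewrite pd_t0; apply/PolN/Pol_pd/Pol_generator; rewrite eqxx orbT.
have [m] := ubnP c; elim: m c c0 => // m IH c c0 cm.
have [hc|hc] := boolP ((c == y0) || (c == z0)); first exact: Pol_generator.
move: hc; rewrite negb_or -!val_eqE /= !inordK; try lia; move=> hc.
have cpos : (0 < c)%N by rewrite lt0n.
have cv : (inord c.-1 : 'I_(k + l).+1) = c.-1 :> nat.
  by rewrite inordK //; have := ltn_ord c; lia.
have -> : t c = X (t (inord c.-1)).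
  rewrite X_comp; last by rewrite -val_eqE /= cv; lia.
  rewrite /mulM (bigD1 c) //= shift_coord cv /last_index cv prednK // eqxx.
  rewrite (_ : ~~ _ = true); last by have := ltn_ord c; lia.
  rewrite scale1r big1 ?addr0 // => b bc; rewrite shift_coord cv prednK //.
  by rewrite [b == c :> nat](negbTE bc) andbF scale0r.
apply: Pol_frame; apply: IH; first by rewrite -val_eqE /= cv; lia.
by rewrite cv; lia.
Qed.

End FilteredSymmetries.

(** * The isomorphism onto the smooth symmetries *)

Section Realization.
Variables (R : realType) (k l s : nat).
Hypothesis k_ge2 : (2 <= k)%N.
Hypothesis kl : (k < l)%N.
Variables (k_gt0 : (0 < k)%N) (l_gt0 : (0 < l)%N) (ks : (k <= s)%N).
Local Notation W := (nil_grading R k_gt0 l_gt0 ks).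
Local Notation A := (smooth_calculus R (k + l)).
Local Notation V := 'rV[R]_(k + l).+1.
Local Notation down := (@Defs.down R k l).
Local Notation g := (symmetryLie A W).

Lemma down_eY1 : down (eY R k l 1) = delta_mx 0 (iy k l 0).
Proof.
apply/rowP => c; rewrite -[delta_mx _ _]/(eY R k l 0) eY_coord // (down_coord k_gt0 l_gt0 ks).
rewrite /last_index; case: ifPn => [hc|]; first by case: eqP => // c1; move: hc; rewrite c1; lia.
rewrite !negb_or => hc; rewrite eY_coord // inordK //; have := ltn_ord c; lia.
Qed.

Lemma down_eZ1 : down (eZ R k l 1) = delta_mx 0 (iz k l 0).
Proof.
apply/rowP => c; rewrite -[delta_mx _ _]/(eZ R k l 0) eZ_coord // (down_coord k_gt0 l_gt0 ks).
rewrite /last_index addn0; case: ifPn => [hc|].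
  by case: eqP => // c1; move: hc; rewrite c1; lia.
rewrite !negb_or => hc; rewrite eZ_coord; last by lia.
by rewrite inordK ?addn1 //; have := ltn_ord c; lia.
Qed.

Definition symmetry_field (t : g) : V -> V := field_of W (symmetry_val t).

Fact symmetry_field_linear : linear symmetry_field.
Proof. by move=> x t u; apply: field_of_linear. Qed.
HB.instance Definition _ :=
  GRing.isLinear.Build R g (V -> V) *:%R symmetry_field symmetry_field_linear.

Lemma tanaka_right_field :
  tanaka_prolongation (Stab (lineX R k l s)) (right_field A W).
Proof.
(* Y_1 and Z_1, which exist because k, l >= 2, serve as the two vectors with independent images Y_0
   and Z_0 under [down]. *)
apply: (@symmetry_tanaka R k l s A W (@down_mxE R k l) (nil_weightE k_gt0 l_gt0 ks)
  (eY R k l 1) (eZ R k l 1) (iy k l 0) (iz k l 0)) => //.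
- by rewrite eY_coord.
- by rewrite eZ_coord //; lia.
- exact: down_eY1.
- exact: down_eZ1.
- by rewrite -val_eqE /= !inordK //; lia.
Qed.

Lemma symmetry_field_natural :
  @natural_at_origin R k l s g (@right_field R k l s A W) symmetry_field.
Proof.
have at0 t c : field_of W t 0 0 c = ev0 A (t c).
  by rewrite field_of_coord coords_eval mul0mx mxE mulr0 addr0 eval_ev0.
split=> [v|d t d0 ht]; apply/rowP => c; rewrite /symmetry_field at0 mxE; first exact: ev0_rf.
exact: ev0_eigen_field ht d0.
Qed.

Lemma symmetry_field_iso (G : set (V -> V)) : (s <= l)%N ->
  (forall t, G (field_of W t) <-> filtered k_gt0 l_gt0 ks t) ->
  (forall S, G S -> smooth S) -> lie_iso G symmetry_field.
Proof.
move=> sl GE Gs; split.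
- by move=> t u /field_of_inj/val_inj.
- apply/seteqP; split=> [_ [t _ <-]|S GS].
    by apply/GE; apply: (symmetryP t).1.
  have [t tS] := field_of_surj W (Gs S GS); rewrite -tS in GS.
  have tf := (GE t).1 GS; have st : symmetric W t by split=> // c; apply: (Pol_comp k_ge2 kl sl tf c).
  by exists (to_symmetry st).
- by move=> t u; rewrite /symmetry_field vbrk_field_of.
Qed.

End Realization.

Theorem theorem2 (R : realType) (k l : nat) (hk : (2 <= k)%N) (hkl : (k < l)%N) :
  (exists (g : gradedLie R) (iota : {linear nilI R k l -> g})
          (psi : {linear g -> ('rV[R]_(k + l).+1 -> 'rV[R]_(k + l).+1)}),
     [/\ tanaka_prolongation (Stab (lineX R k l l)) iota,
         lie_iso (symI R k l) psi &
         natural_at_origin iota psi]) /\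
  (exists (g : gradedLie R) (iota : {linear nilII R k l -> g})
          (psi : {linear g -> ('rV[R]_(k + l).+1 -> 'rV[R]_(k + l).+1)}),
     [/\ tanaka_prolongation (Stab (lineX R k l k)) iota,
         lie_iso (symII R k l) psi &
         natural_at_origin iota psi]).
Proof.
have k_gt0 : (0 < k)%N := ltnW hk; have l_gt0 : (0 < l)%N := leq_ltn_trans (leq0n k) hkl.
split.
  exists (symmetryLie (smooth_calculus R (k + l)) (nil_grading R k_gt0 l_gt0 (ltnW hkl))).
  exists (@right_field _ _ _ _ _ _); exists (@symmetry_field R k l l k_gt0 l_gt0 (ltnW hkl)).
  split; [exact: tanaka_right_field | | exact: symmetry_field_natural].
  apply: symmetry_field_iso => // [t|S []//].
  apply: iff_trans (iff_sym (filtered_F1 hk hkl k_gt0 l_gt0 (ltnW hkl) t erefl)).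
  have X := preserves_frame t (@distXP R k l l k_gt0 l_gt0 (ltnW hkl)).
  have F := preserves_frame t (@distF1P R k l l hk hkl k_gt0 l_gt0 (ltnW hkl)).
  split=> [[_ /X ? /F ?] //|[/X ? /F ?]]; split=> //; exact: smooth_field_of.
exists (symmetryLie (smooth_calculus R (k + l)) (nil_grading R k_gt0 l_gt0 (leqnn k))).
exists (@right_field _ _ _ _ _ _); exists (@symmetry_field R k l k k_gt0 l_gt0 (leqnn k)).
split; [exact: tanaka_right_field | | exact: symmetry_field_natural].
apply: symmetry_field_iso => // [|t|S []//]; first exact: ltnW.
apply: iff_trans (iff_sym (filtered_D hk hkl k_gt0 l_gt0 (leqnn k) t erefl)).
have X := preserves_frame t (@distXP R k l k k_gt0 l_gt0 (leqnn k)).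
have F := preserves_frame t (@distDP R k l k hk hkl k_gt0 l_gt0 (leqnn k)).
split=> [[_ /X ? /F ?] //|[/X ? /F ?]]; split=> //; exact: smooth_field_of.
Qed.
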